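(* Let $n\ge4$, $\widetilde{W}$ the affine Weyl group of type $\widetilde{D}_n$, and $w\in\widetilde{W}^S$. Then $w$ is palindromic if and only if the underlying (uncolored) shape of $\pi(w)$ is a one-row shape $(j)$ with $1\le j\le n-1$ or $j=2n-2$, or a staircase shape $(k,k-1,k-2,\dots,1)$ with $k\le n-1$. (When $j=n-1$ or $k=n-1$ there are two distinct such elements, corresponding to the two colors of parts of size $n-1$.)
   Context: $\widetilde{W}$ has generators $s_0,\dots,s_n$ with $m=3$ for $(s_0,s_2)$, $(s_1,s_2)$, $(s_i,s_{i+1})$ ($2\le i\le n-2$), $(s_{n-2},s_n)$, all others commuting. $S=\{s_1,\dots,s_n\}$, $S'=\{s_0,s_2,\dots,s_n\}$; $\widetilde{W}^S$, $\widetilde{W}^{S'}$ are the minimal length left coset representatives for $W_S$, $W_{S'}$. Colored segments (colors $b,c$ only at length $n-1$): $\sigma_1(j)=s_j\cdots s_2s_1$ ($1\le j\le n-2$), $\sigma_1^b(n-1)=s_{n-1}s_{n-2}\cdots s_1$, $\sigma_1^c(n-1)=s_ns_{n-2}\cdots s_1$, $\sigma_1(j)=s_{2n-j-1}\cdots s_{n-2}s_{n-1}s_ns_{n-2}\cdots s_2s_1$ ($n\le j\le 2n-2$); $\sigma_0^z(j)$ is obtained from $\sigma^z_1(j)$ by interchanging $s_0\leftrightarrow s_1$ and $s_{n-1}\leftrightarrow s_n$. Every $w\in\widetilde{W}^S$, $w\ne\mathrm{id}$, factors uniquely $w=uv$ with $u\in\widetilde{W}^{S'}$, $v\in W_{S'}$,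 lengths adding, and $v=\sigma^{c_1}_0(\lambda_1)$; if $u\ne\mathrm{id}$, $u=u'v'$ with $u'\in\widetilde{W}^S$, $v'=\sigma_1^{c_2}(\lambda_2)\in W_S$; alternating gives $w=\cdots\sigma_0^{c_3}(\lambda_3)\sigma_1^{c_2}(\lambda_2)\sigma_0^{c_1}(\lambda_1)$ and $\pi(w)=(\lambda_1^{c_1},\lambda_2^{c_2},\dots)$ ($\pi(\mathrm{id})=\emptyset$), whose underlying shape is a partition of $\ell(w)$ (the staircase with $k=0$ is the empty shape). $P_w(t)=\sum_{v\in\widetilde{W}^S,v\le w}t^{\ell(v)}$ (Bruhat order); $w$ is palindromic if its coefficients satisfy $a_i=a_{\ell(w)-i}$ for all $i$. *)

(* Defs.v *)
From HB Require Import structures.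
From mathcomp Require Import all_boot all_order all_algebra.
From mathcomp Require Import boolp classical_sets fsbigop.

Set Implicit Arguments.
Unset Strict Implicit.
Unset Printing Implicit Defensive.

Local Open Scope classical_set_scope.
Local Open Scope quotient_scope.
Local Open Scope group_scope.

Section CoxeterGroup.
Variables (I : choiceType) (m : I -> I -> nat).

(* The congruence on words in the generators spanned by s_i s_i = 1 and
   (s_i s_j)^(m i j) = 1; [m i j = 0] stands for an infinite exponent. *)
Inductive cox_equiv : seq I -> seq I -> Prop :=
| cox_refl x : cox_equiv x x
| cox_sym x y : cox_equiv x y -> cox_equiv y x
| cox_trans x y z : cox_equiv x y -> cox_equiv y z -> cox_equiv x z
| cox_invol x y i : cox_equiv (x ++ [:: i; i] ++ y) (x ++ y)
| cox_braid x y i j :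
    cox_equiv (x ++ flatten (nseq (m i j) [:: i; j]) ++ y) (x ++ y).

Definition cox_rel : rel (seq I) := fun x y => `[< cox_equiv x y >].

Fact cox_rel_refl : reflexive cox_rel.
Proof. by move=> x; apply/asboolP; exact: cox_refl. Qed.

Fact cox_rel_sym : symmetric cox_rel.
Proof. by move=> x y; apply/asboolP/asboolP; exact: cox_sym. Qed.

Fact cox_rel_trans : transitive cox_rel.
Proof.
by move=> y x z /asboolP xy /asboolP yz; apply/asboolP; exact: cox_trans xy yz.
Qed.

Canonical cox_equiv_rel :=
  EquivRel cox_rel cox_rel_refl cox_rel_sym cox_rel_trans.

Definition coxeter := {eq_quot cox_equiv_rel}.

HB.instance Definition _ := Choice.on coxeter.

Definition cox_class (x : seq I) : coxeter := \pi_coxeter x.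

Fact cox_classP x y : cox_class x = cox_class y <-> cox_equiv x y.
Proof.
split; first by move/eqquotP => /asboolP.
by move=> xy; apply/eqquotP/asboolP.
Qed.

Fact cox_class_repr w : cox_class (repr w) = w.
Proof. exact: reprK. Qed.

Definition cox_one := cox_class [::].
Definition cox_mul (u v : coxeter) := cox_class (repr u ++ repr v).
Definition cox_inv (u : coxeter) := cox_class (rev (repr u)).

Fact cox_equiv_catl z x y : cox_equiv x y -> cox_equiv (z ++ x) (z ++ y).
Proof.
elim=> {x y} [x|x y _ IH|x y t _ IH1 _ IH2|x y i|x y i j].
- exact: cox_refl.
- exact: cox_sym.
- exact: cox_trans IH1 IH2.
- by rewrite !(catA z); exact: cox_invol.
- by rewrite !(catA z); exact: cox_braid.
Qed.

Fact cox_equiv_catr z x y : cox_equiv x y -> cox_equiv (x ++ z) (y ++ z).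
Proof.
elim=> {x y} [x|x y _ IH|x y t _ IH1 _ IH2|x y i|x y i j].
- exact: cox_refl.
- exact: cox_sym.
- exact: cox_trans IH1 IH2.
- by rewrite -!catA; exact: cox_invol.
- by rewrite -!catA; exact: cox_braid.
Qed.

Fact cox_class_cat x y : cox_mul (cox_class x) (cox_class y) = cox_class (x ++ y).
Proof.
have eqx := cox_class_repr (cox_class x); have eqy := cox_class_repr (cox_class y).
apply/cox_classP; move/cox_classP: eqx => eqx; move/cox_classP: eqy => eqy.
exact: cox_trans (cox_equiv_catr _ eqx) (cox_equiv_catl _ eqy).
Qed.

Fact cox_equiv_revK x : cox_equiv (x ++ rev x) [::].
Proof.
elim: x => [|i x IH]; first exact: cox_refl.
rewrite rev_cons -cats1 catA cat_cons.
apply: (@cox_trans _ [:: i; i]); last exact: (cox_invol [::] [::] i).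
exact: (cox_equiv_catl [:: i] (cox_equiv_catr [:: i] IH)).
Qed.

Fact cox_mulA : associative cox_mul.
Proof.
move=> u v w.
by rewrite -(cox_class_repr u) -(cox_class_repr v) -(cox_class_repr w)
  !cox_class_cat catA.
Qed.

Fact cox_mul1 : left_id cox_one cox_mul.
Proof. by move=> u; rewrite -(cox_class_repr u) cox_class_cat. Qed.

Fact cox_mulr1 : right_id cox_one cox_mul.
Proof. by move=> u; rewrite -(cox_class_repr u) cox_class_cat cats0. Qed.

Fact cox_mulV : left_inverse cox_one cox_inv cox_mul.
Proof.
move=> u; rewrite -{2}(cox_class_repr u) cox_class_cat; apply/cox_classP.
by rewrite -{2}(revK (repr u)); exact: cox_equiv_revK.
Qed.

Fact cox_mulrV : right_inverse cox_one cox_inv cox_mul.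
Proof.
move=> u; rewrite -{1}(cox_class_repr u) cox_class_cat; apply/cox_classP.
exact: cox_equiv_revK.
Qed.

HB.instance Definition _ :=
  isGroup.Build coxeter cox_mulA cox_mul1 cox_mulr1 cox_mulV cox_mulrV.

Definition cox_gen (i : I) : coxeter := cox_class [:: i].

Definition word_prod (x : seq I) : coxeter := \prod_(i <- x) cox_gen i.

Fact word_prodE x : word_prod x = cox_class x.
Proof.
rewrite /word_prod; elim: x => [|i x IH]; first by rewrite big_nil.
by rewrite big_cons IH; exact: (cox_class_cat [:: i] x).
Qed.

Definition has_word_of_size (w : coxeter) : pred nat :=
  fun k => `[< exists2 x, size x = k & word_prod x = w >].

Fact has_word (w : coxeter) : exists k, has_word_of_size w k.
Proof.
exists (size (repr w)); apply/asboolP; exists (repr w) => //.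
by rewrite word_prodE cox_class_repr.
Qed.

Definition cox_length (w : coxeter) : nat := ex_minn (has_word w).

(* Generators are involutions, so words with letters in J exhaust the
   subgroup generated by J. *)
Definition parabolic (J : {pred I}) : set coxeter :=
  [set w | exists2 x, all (mem J) x & word_prod x = w].

Definition min_coset_rep (J : {pred I}) : set coxeter :=
  [set w | forall v, parabolic J v -> (cox_length w <= cox_length (w * v)%g)%N].

Definition cox_reflection : set coxeter :=
  [set t | exists w i, t = w * cox_gen i * w^-1].

Inductive bruhat_le (u : coxeter) : coxeter -> Prop :=
| bruhat_refl : bruhat_le u u
| bruhat_step v t : bruhat_le u v -> cox_reflection t ->
    (cox_length v < cox_length (v * t)%g)%N -> bruhat_le u (v * t).

End CoxeterGroup.

Local Close Scope group_scope.

(* Edges (i, j), listed in one direction only, of the Dynkin diagram of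
   affine type D_n. *)
Definition affD_edge (n i j : nat) : bool :=
  [|| (i == 0) && (j == 2), (i == 1) && (j == 2),
      (2 <= i <= n - 2) && (j == i.+1) | (i == n - 2) && (j == n)].

Definition affD_matrix (n : nat) (i j : 'I_n.+1) : nat :=
  if i == j then 1 else if affD_edge n i j || affD_edge n j i then 3 else 2.

Definition affD (n : nat) := coxeter (@affD_matrix n).

HB.instance Definition _ n := Group.on (affD n).

(* [gens_but n 0] is S and [gens_but n 1] is S'. *)
Definition gens_but (n e : nat) : {pred 'I_n.+1} := [pred i | val i != e].
Arguments gens_but : clear implicits.

Inductive color := color_b | color_c.

HB.instance Definition _ := gen_eqMixin color.
HB.instance Definition _ := gen_choiceMixin color.

Definition part : Type := nat * option color.

HB.instance Definition _ := Choice.on part.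

Definition valid_part (n : nat) (p : part) : Prop :=
  1 <= p.1 <= 2 * n - 2 /\ (p.2 <> None <-> p.1 = n - 1).

(* Only meant for valid parts. *)
Definition segment1 (n : nat) (p : part) : seq nat :=
  let j := p.1 in
  if j <= n - 2 then rev (iota 1 j)
  else if j == n - 1 then
    (if p.2 is Some color_b then n - 1 else n) :: rev (iota 1 (n - 2))
  else iota (2 * n - j - 1) (j - n + 1) ++ n :: rev (iota 1 (n - 2)).

Definition swap_ends (n i : nat) : nat :=
  if i == 0 then 1 else if i == 1 then 0
  else if i == n - 1 then n else if i == n then n - 1 else i.

Definition segment (n : nat) (e : bool) (p : part) : seq nat :=
  if e then segment1 n p else map (swap_ends n) (segment1 n p).

Definition sigma (n : nat) (e : bool) (p : part) : affD n :=
  word_prod (@affD_matrix n) (map inord (segment n e p)).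

(* [factors_as e w ps] : w, a minimal representative for the subgroup omitting
   s_e, has iterated factorization ... sigma_(1-e)(ps_2) sigma_e(ps_1); the
   bool e is read as the index 0 or 1. *)
Fixpoint factors_as (n : nat) (e : bool) (w : affD n) (ps : seq part) : Prop :=
  if ps is p :: ps' then
    w <> 1%g /\
    exists u v : affD n,
      [/\ w = (u * v)%g,
          min_coset_rep (gens_but n (~~ e)) u,
          parabolic (gens_but n (~~ e)) v &
          cox_length w = cox_length u + cox_length v] /\
      [/\ valid_part n p, v = sigma n e p & factors_as (~~ e) u ps']
  else w = 1%g.

(* The colored partition of w, the sequence being unique for w in W^S. *)
Definition colored_partition (n : nat) (w : affD n) : seq part :=
  xget [::] [set ps | factors_as false w ps].

Definition underlying_shape (ps : seq part) : seq nat := map fst ps.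

Definition staircase (k : nat) : seq nat := rev (iota 1 k).

(* The coloring of a shape by z : only parts of size n - 1 carry a color. *)
Definition color_shape (n : nat) (z : color) (sh : seq nat) : seq part :=
  [seq (j, if j == n - 1 then Some z else None) | j <- sh].

Definition lower_interval (n : nat) (w : affD n) : set (affD n) :=
  [set v | min_coset_rep (gens_but n 0) v /\ bruhat_le v w].

Definition poincare (n : nat) (w : affD n) : {poly int} :=
  (\sum_(v \in lower_interval w) ('X^(cox_length v) : {poly int}))%R.

Definition palindromic (n : nat) (w : affD n) : Prop :=
  forall i, (i <= cox_length w)%N ->
    ((poincare w)`_i = (poincare w)`_(cox_length w - i))%R.

(* Main.v *)
Require Import Defs.
From mathcomp Require Import all_boot all_order all_algebra.
From mathcomp Require Import boolp classical_sets fsbigop.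
From mathcomp Require Import zify.

(* W acts on integer labelings of its diagram by the numbers game, and the
   labels of w x, for x dominant, show the left descents of w. In coordinates
   the game for the labeling concentrated on one of the nodes 0, 1 becomes an
   insertion procedure: a segment lets the first coordinate x_1 travel past
   x_2, x_3, ..., x_n, and then past -x_(n-1), ..., -x_2 on its way back, and
   each step is an ascent iff x_1 is larger than what it passes. Between
   consecutive segments the map x_1 -> 1 - x_1, x_n -> - x_n exchanges the
   roles of the nodes 0 and 1. It follows that the elements of W^S are the
   sequences of colored parts in which each part is smaller than the previous
   one, or equal to it if it is at least n - 1.

   A palindromic w <> 1 has as few elements of colength 1 and 2 below it as of
   length 1 and 2, that is, at most one of each. Deleting letters from segments
   produces two such elements unless the shape has one row, or is
   (n-1)^r, or is (n-1)^r, n-2, ..., 1 or a smaller staircase. For r >= 2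
   the elements of shape (n-1)^r and (n-1)^r, n-2, ..., 1, whose points in
   coordinates are balanced vectors with entries of absolute value c and c + 1,
   have further elements of colength 1 or 2 below them, depending on the
   residue of r modulo n. For one row of length between n and 2n - 3 the two
   colors of n - 1 break the symmetry.

   Conversely one-row elements have explicit lower intervals, and the elements
   below a staircase are the strict partitions with parts at most k, on which
   complementation in {1, ..., k} reverses lengths. *)

Set Implicit Arguments.
Unset Strict Implicit.
Unset Printing Implicit Defensive.

(** * Coxeter groups: strong exchange and parabolic quotients *)

(** Following the game along a whole sequence of segments would require all coordinates of the point
    reached. Instead, an ascent at the end node opposite to the starting one is shown to depend on
    the two rightmost segments alone; the longest segment, the only one containing its end letter
    twice, needs a separate argument. This is why colored partitions are described by a condition on
    consecutive parts. Bruhat relations are produced by deleting letters, while intervals are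
    bounded by parabolic subgroups: a row lies in W_S', and a staircase in a subgroup of type
    D_(k+1), whose spinor quotient consists of strict partitions. Colengths 1 and 2 are the useful
    ones because W^S has a single element of each of the lengths 1 and 2, but several of length 3.
    For some residues the witnesses are reached only by deleting two letters. For repeated parts n -
    1, color c needs no computation of its own: the symmetry exchanging s_(n-1) and s_n carries
    color b to it. *)

Section CoxeterTheory.
Local Open Scope group_scope.
Variables (I : choiceType) (m : I -> I -> nat).
Implicit Types (u v w t : coxeter m) (x y : seq I) (J : {pred I}).

Local Notation W := (coxeter m).
Local Notation s := (cox_gen m).
Local Notation wp := (word_prod m).
Local Notation len w := (@cox_length I m w%g).

Lemma word_prod_nil : wp [::] = 1.
Proof. by rewrite /word_prod big_nil. Qed.

Lemma word_prod_cons i x : wp (i :: x) = s i * wp x.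
Proof. by rewrite /word_prod big_cons. Qed.

Lemma word_prod_cat x y : wp (x ++ y) = wp x * wp y.
Proof. by rewrite /word_prod big_cat. Qed.

Lemma word_prod1 i : wp [:: i] = s i.
Proof. by rewrite word_prod_cons word_prod_nil mulg1. Qed.

Lemma word_prod_surj w : exists x, wp x = w.
Proof. by exists (repr w); rewrite word_prodE cox_class_repr. Qed.

Lemma word_prodP x y : wp x = wp y <-> cox_equiv m x y.
Proof. by rewrite !word_prodE cox_classP. Qed.

Lemma cox_gen_sq i : s i * s i = 1.
Proof.
rewrite -word_prod_nil -!word_prod1 -word_prod_cat; apply/word_prodP.
exact: (cox_invol _ [::] [::] i).
Qed.

Lemma cox_genV i : (s i)^-1 = s i.
Proof. by apply: mulg1_eq; exact: cox_gen_sq. Qed.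

Lemma cox_genK i w : s i * (s i * w) = w.
Proof. by rewrite mulgA cox_gen_sq mul1g. Qed.

Lemma word_prod_rev x : wp (rev x) = (wp x)^-1.
Proof.
elim: x => [|i x IH]; first by rewrite word_prod_nil invg1.
by rewrite rev_cons -cats1 word_prod_cat IH word_prod1 word_prod_cons invgM cox_genV.
Qed.

Lemma cox_length_witness w : exists2 x, size x = len w & wp x = w.
Proof. by rewrite /cox_length; case: ex_minnP => k /asboolP. Qed.

Lemma cox_length_le x : (len (wp x) <= size x)%N.
Proof.
rewrite /cox_length; case: ex_minnP => k _; apply; apply/asboolP.
by exists x.
Qed.

Lemma cox_length1 : len 1 = 0%N.
Proof. by apply/eqP; rewrite -leqn0 -word_prod_nil cox_length_le. Qed.

Lemma cox_length_eq0 w : len w = 0%N -> w = 1.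
Proof.
move=> w0; have [x + <-] := cox_length_witness w.
by rewrite w0 => /size0nil ->; exact: word_prod_nil.
Qed.

Lemma cox_lengthV w : len w^-1 = len w.
Proof.
have leV u : (len u^-1 <= len u)%N.
  have [x <- {1}<-] := cox_length_witness u.
  by rewrite -word_prod_rev -(size_rev x) cox_length_le.
by apply/eqP; rewrite eqn_leq leV -{1}(invgK w) leV.
Qed.

Lemma cox_lengthM u v : (len (u * v) <= len u + len v)%N.
Proof.
have [x <- <-] := cox_length_witness u; have [y <- <-] := cox_length_witness v.
by rewrite -word_prod_cat -size_cat cox_length_le.
Qed.

Lemma word_parity x y : wp x = wp y -> odd (size x) = odd (size y).
Proof.
move/word_prodP; elim=> {x y} //= [x y z _ -> _ -> //|x y i|x y i j].
  by rewrite !size_cat /= !oddD /= negbK.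
rewrite !size_cat !oddD; suff -> : odd (size (flatten (nseq (m i j) [:: i; j]))) = false by [].
by elim: (m i j) => //= k IH; rewrite negbK.
Qed.

Lemma odd_cox_length x : odd (len (wp x)) = odd (size x).
Proof. by have [y <-] := cox_length_witness (wp x) => /word_parity. Qed.

Lemma cox_length_genM i w : len (s i * w) = (len w).+1 \/ len w = (len (s i * w)).+1.
Proof.
have le1 u : (len (s i * u) <= (len u).+1)%N.
  have [x <- <-] := cox_length_witness u.
  by rewrite -word_prod_cons; exact: (cox_length_le (i :: x)).
have := le1 w; have := le1 (s i * w); rewrite cox_genK.
have : odd (len (s i * w)) = ~~ odd (len w).
  by have [x <-] := word_prod_surj w; rewrite -word_prod_cons !odd_cox_length.
by lia.
Qed.

Lemma cox_length_Mgen i w : len (w * s i) = (len w).+1 \/ len w = (len (w * s i)).+1.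
Proof.
have := cox_length_genM i w^-1.
by rewrite -(cox_lengthV (w * s i)) invgM cox_genV cox_lengthV.
Qed.

Lemma cox_length_gen i : len (s i) = 1%N.
Proof. by have := cox_length_genM i 1; rewrite mulg1 cox_length1 => -[]. Qed.

Lemma left_descent w : w <> 1 -> exists i, (len (s i * w) < len w)%N.
Proof.
have [[|i x] sx xw] := cox_length_witness w; first by rewrite -xw word_prod_nil.
by move=> _; exists i; rewrite -sx -xw word_prod_cons cox_genK ltnS cox_length_le.
Qed.

Lemma right_descent w : w <> 1 -> exists i, (len (w * s i) < len w)%N.
Proof.
move=> w1; have [|i] := @left_descent w^-1; first by move/eqP; rewrite invg_eq1 => /eqP.
by rewrite -(cox_lengthV (s i * w^-1)) invgM invgK cox_genV cox_lengthV; exists i.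
Qed.

(* The reflections t for which multiplying the product of x by t on the right
   amounts to deleting one letter. *)
Fixpoint word_refls x : seq W :=
  if x is i :: x' then s i ^ wp x' :: word_refls x' else [::].

(** Tits' cocycle: unlike the list [word_refls x] itself, this parity depends only on the product of
    [x], so a given word can be compared with a reduced one. *)
Definition refl_parity x t := odd (count_mem t (word_refls x)).

Lemma word_refls_cat x y :
  word_refls (x ++ y) = [seq t ^ wp y | t <- word_refls x] ++ word_refls y.
Proof. by elim: x => //= i x ->; rewrite word_prod_cat conjgM. Qed.

Lemma refl_parity_cat x y t :
  refl_parity (x ++ y) t = refl_parity x (t ^ (wp y)^-1) (+) refl_parity y t.
Proof.
rewrite /refl_parity word_refls_cat count_cat oddD count_map; congr (odd _ (+) _).
by apply: eq_count => r /=; rewrite (can2_eq (conjgK _) (conjgKV _)).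
Qed.

(** With [a] inverse to s_i s_j, the alternating word of k pairs contributes the elements a^p s_j
    for p < 2k, and a^k = 1 makes the second half of this list repeat the first. *)
Lemma refl_parity_periodic i j k t : (s i * s j) ^+ k = 1 ->
  refl_parity (flatten (nseq k [:: i; j])) t = false.
Proof.
move=> k1.
have altE l : wp (flatten (nseq l [:: i; j])) = (s i * s j) ^+ l.
  elim: l => [|l IH]; first by rewrite word_prod_nil.
  by rewrite /= !word_prod_cons IH mulgA expgS.
pose a := (s i * s j)^-1.
have aE : a = s j * s i by rewrite /a invgM !cox_genV.
have swap l : a ^+ l * s j = s j * (s i * s j) ^+ l.
  elim: l => [|l IH]; first by rewrite mul1g mulg1.
  by rewrite expgS -mulgA IH aE expgS !mulgA.
have reflsE l : word_refls (flatten (nseq l [:: i; j])) =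
    rev (mkseq (fun p => a ^+ p * s j) (l + l)).
  elim: l => [|l IH] //; rewrite addnS addSn !mkseqS !rev_rcons -IH /=.
  rewrite word_prod_cons altE; congr [:: _, _ & _].
    rewrite conjgE invgM cox_genV -expVgn -/a -swap !mulgA.
    by rewrite -(mulgA (a ^+ l) (s j) (s i)) -aE -expgSr -expgnDr addSn.
  by rewrite conjgE -expVgn -/a -swap mulgA -expgnDr.
rewrite /refl_parity reflsE count_rev /mkseq iotaD map_cat count_cat oddD.
rewrite (_ : [seq _ | p <- iota (0 + k) k] = [seq a ^+ p * s j | p <- iota 0 k]) ?addbb //.
rewrite add0n -{1}(addn0 k) iotaDl -map_comp; apply: eq_map => p /=.
by rewrite expgnDr {1}/a expVgn k1 invg1 mul1g.
Qed.

Lemma refl_parity_equiv x y : cox_equiv m x y -> refl_parity x =1 refl_parity y.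
Proof.
have cancel_mid x' y' z t : wp z = 1 -> (forall r, refl_parity z r = false) ->
    refl_parity (x' ++ z ++ y') t = refl_parity (x' ++ y') t.
  by move=> z1 z0; rewrite !refl_parity_cat word_prod_cat z1 mul1g z0 addFb.
elim=> {x y} [//|x y _ IH t|x y z _ IH1 _ IH2 t|x y i t|x y i j t].
- by rewrite IH.
- by rewrite IH1.
- apply: cancel_mid => [|r]; first by rewrite !word_prod_cons word_prod_nil mulg1 cox_gen_sq.
  by rewrite /refl_parity /= word_prod1 word_prod_nil conjg1 conjgE mulgA cox_genV cox_gen_sq mul1g; case: eqP.
- have ij1 : wp (flatten (nseq (m i j) [:: i; j])) = 1.
    by rewrite -word_prod_nil; apply/word_prodP; have := cox_braid m [::] [::] i j; rewrite cats0.
  apply: cancel_mid => // r; apply: refl_parity_periodic; rewrite -ij1.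
  elim: (m i j) => [|l IH]; first by rewrite word_prod_nil.
  by rewrite /= !word_prod_cons -IH expgS mulgA.
Qed.

Lemma mem_word_refls x t : t \in word_refls x ->
  exists x1 i x2, x = x1 ++ i :: x2 /\ wp x * t = wp (x1 ++ x2).
Proof.
elim: x => //= i x IH; rewrite inE => /orP[/eqP->|/IH[x1 [j [x2 [-> e]]]]].
  by exists [::], i, x; split=> //; rewrite word_prod_cons conjgE !mulgA mulgK cox_gen_sq mul1g.
by exists (i :: x1), j, x2; split=> //; rewrite /= !word_prod_cons -mulgA e.
Qed.

(** In the palindromic word y, i, rev y for [t], the outer parts contribute at [t] what they
    contribute in y ++ rev y, hence evenly, as that word is trivial; the middle letter contributes
    one occurrence. *)
Lemma refl_parity_reflection x t : cox_reflection t -> wp x = t -> refl_parity x t.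
Proof.
case=> b [i ->]; have [y <-] := word_prod_surj b => xE.
have /refl_parity_equiv-> : cox_equiv m x (y ++ [:: i] ++ rev y).
  by apply/word_prodP; rewrite xE !word_prod_cat word_prod1 word_prod_rev mulgA.
have yV : forall r, refl_parity (y ++ rev y) r = false.
  by move=> r; rewrite (refl_parity_equiv (cox_equiv_revK m y)).
have tV : (wp y * s i * (wp y)^-1) ^ wp y = s i.
  by rewrite conjgE -!mulgA mulKg mulVg mulg1.
move: (yV (wp y * s i * (wp y)^-1)).
rewrite !refl_parity_cat word_prod_cat word_prod1 word_prod_rev invgM invgK cox_genV.
rewrite conjgM !tV conjgE cox_genV cox_genK.
by rewrite /refl_parity /= word_prod_nil conjg1 eqxx; case: odd; case: odd.
Qed.

(** If [t] had even parity in [x], appending a word of [t] would make its parity odd in a reduced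
    word of w t; deleting the corresponding letter there would give a word of w shorter than its
    length. *)
Lemma strong_exchange w t x : cox_reflection t -> (len (w * t) < len w)%N -> wp x = w ->
  exists x1 i x2, x = x1 ++ i :: x2 /\ w * t = wp (x1 ++ x2).
Proof.
move=> tR lt_wt xw; rewrite -xw; apply: mem_word_refls.
rewrite -has_pred1 has_count; case E: (refl_parity x t); first by move: E; rewrite /refl_parity; case: count.
have [y sy yE] := cox_length_witness (w * t).
have [z zE] := word_prod_surj t.
have tt : t * t = 1.
  by case: tR => b [i ->]; rewrite !mulgA -(mulgA _ b^-1) mulVg mulg1 -(mulgA b) cox_gen_sq mulg1 mulgV.
have: refl_parity y t.
  rewrite (@refl_parity_equiv y (x ++ z)) ?refl_parity_cat; last first.
    by apply/word_prodP; rewrite yE word_prod_cat xw zE.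
  rewrite zE conjgE invgK mulgV mulg1 E addFb.
  exact: refl_parity_reflection.
rewrite /refl_parity => /odd_gt0; rewrite -has_count has_pred1 => /mem_word_refls[x1 [i [x2 [yE' e]]]].
have := cox_length_le (x1 ++ x2); rewrite -e yE -mulgA tt mulg1.
by move: sy lt_wt; rewrite yE' !size_cat /=; lia.
Qed.

Lemma left_exchange i w x : (len (s i * w) < len w)%N -> wp x = w ->
  exists x1 j x2, x = x1 ++ j :: x2 /\ s i * w = wp (x1 ++ x2).
Proof.
have -> : s i * w = w * (w^-1 * s i * w) by rewrite !mulgA mulgV mul1g.
by apply: strong_exchange; exists w^-1, i; rewrite invgK.
Qed.

(** Scanning from the right, the first letter that fails to lengthen the product cancels against a
    later one by the exchange property, so a non-reduced word loses two letters. Working with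
    subwords keeps the letters inside a given set. *)
Lemma reduced_subword x :
  exists2 y : seq I, subseq y x & wp y = wp x /\ size y = len (wp x).
Proof.
have [k] := ubnP (size x); elim: k x => // k IHk x lexk.
suff [xred|[y sub_yx [lt_yx <-]]] : size x = len (wp x) \/
    exists2 y : seq I, subseq y x & (size y < size x)%N /\ wp y = wp x.
- by exists x.
- have [|z zy zE] := IHk y; first exact: leq_trans lt_yx lexk.
  by exists z => //; exact: subseq_trans sub_yx.
elim: x {lexk} => [|i x IHx]; first by left; rewrite word_prod_nil cox_length1.
case: IHx => [xred|[y sub_yx [lt_yx yE]]]; last first.
  right; exists (i :: y); rewrite /= ?eqxx //; split; first lia.
  by rewrite !word_prod_cons yE.
have [up|down] := cox_length_genM i (wp x).
  by left; rewrite /= xred word_prod_cons up.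
right; have [|x1 [j [x2 [xE e]]]] := @left_exchange i (wp x) x _ erefl; first lia.
exists (x1 ++ x2); last by rewrite word_prod_cons e xE /= !size_cat /=; split=> //; lia.
by rewrite xE -cat_rcons -cat_cons cat_subseq // -cats1; apply: subseq_trans (subseq_cons _ _); exact: prefix_subseq.
Qed.

Lemma reduced_behead i x : len (s i * wp x) = (size x).+1 -> len (wp x) = size x.
Proof. by move=> sx; have := cox_length_le x; have := cox_length_genM i (wp x); rewrite sx; lia. Qed.

(** * Parabolic subgroups and minimal coset representatives *)

Lemma parabolic1 J : parabolic J (1 : W).
Proof. by exists [::]; rewrite ?word_prod_nil. Qed.

Lemma parabolicM J u v : parabolic J u -> parabolic J v -> parabolic J (u * v).
Proof. by move=> [x Jx <-] [y Jy <-]; exists (x ++ y); rewrite ?all_cat ?Jx ?word_prod_cat. Qed.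

Lemma parabolicV J u : parabolic J u -> parabolic J u^-1.
Proof. by move=> [x Jx <-]; exists (rev x); rewrite ?all_rev ?word_prod_rev. Qed.

Lemma parabolic_gen J i : i \in J -> parabolic J (s i).
Proof. by move=> Ji; exists [:: i]; rewrite ?word_prod1 /= ?andbT. Qed.

Lemma parabolic_reduced J v : parabolic J v ->
  exists2 x, all (mem J) x & wp x = v /\ size x = len v.
Proof.
move=> [x Jx <-]; have [y yx yE] := reduced_subword x; exists y => //.
by apply/allP => i /(mem_subseq yx); exact: (allP Jx).
Qed.

(** For reduced words x of u and y of v, a reduced word of u v is found inside x ++ y. Its part
    inside x has a product in u W_J, so minimality of u lets it lose no letter. *)
Lemma min_coset_repM J u v : min_coset_rep J u -> parabolic J v ->
  len (u * v) = (len u + len v)%N.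
Proof.
move=> uJ vJ; have [x sx xu] := cox_length_witness u.
have [y Jy [yv sy]] := parabolic_reduced vJ.
have [z /subseqP[b sb zE] []] := reduced_subword (x ++ y).
rewrite word_prod_cat xu yv => zuv sz.
move: zE; rewrite -(cat_take_drop (size x) b) mask_cat; last first.
  by rewrite size_takel // sb size_cat leq_addr.
set z1 := mask _ x; set z2 := mask _ y => zE.
have z2J : parabolic J (wp z2).
  by exists z2 => //; apply/allP => i /mem_mask; exact: (allP Jy).
have z1E : wp z1 = u * (v * (wp z2)^-1).
  by rewrite mulgA -zuv zE word_prod_cat mulgK.
have le_uz1 : (len u <= size z1)%N.
  apply: leq_trans (cox_length_le z1); rewrite z1E; apply: uJ.
  exact: parabolicM vJ (parabolicV z2J).
have z1x : z1 = x.
  by apply/eqP; rewrite -(size_subseq_leqif (mask_subseq _ _)) eqn_leq -/z1 sx le_uz1 andbT -sx size_subseq // mask_subseq.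
have z2v : wp z2 = v.
  by apply: (mulgI u); rewrite -zuv zE word_prod_cat z1x xu.
apply/eqP; rewrite eqn_leq cox_lengthM -sz zE size_cat z1x sx leq_add2l.
by rewrite -z2v cox_length_le.
Qed.

Lemma parabolic_decomp J w : exists u v,
  [/\ w = u * v, min_coset_rep J u, parabolic J v & len w = (len u + len v)%N].
Proof.
pose P := [pred k | `[< exists2 v, parabolic J v & len (w * v) = k >]].
have exP : exists k, P k.
  by exists (len w); apply/asboolP; exists 1; rewrite ?mulg1 //; exact: parabolic1.
case: (ex_minnP exP) => k /asboolP[v vJ lenk] kmin.
have wvJ : min_coset_rep J (w * v).
  move=> v' v'J; rewrite lenk; apply: kmin; apply/asboolP.
  by exists (v * v'); rewrite ?mulgA //; exact: parabolicM.
exists (w * v), v^-1; split => //; first by rewrite mulgK.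
  exact: parabolicV.
by rewrite -(min_coset_repM wvJ (parabolicV vJ)) mulgK.
Qed.

Lemma min_coset_rep_eq1 J u v : min_coset_rep J u -> min_coset_rep J (u * v) ->
  parabolic J v -> v = 1.
Proof.
move=> uJ uvJ vJ; apply: cox_length_eq0.
have := min_coset_repM uJ vJ; have := min_coset_repM uvJ (parabolicV vJ).
by rewrite mulgK; lia.
Qed.

Lemma parabolic_decomp_uniq J u v u' v' :
  min_coset_rep J u -> min_coset_rep J u' -> parabolic J v -> parabolic J v' ->
  u * v = u' * v' -> u = u' /\ v = v'.
Proof.
move=> uJ u'J vJ v'J e.
have u'E : u' = u * (v * v'^-1) by rewrite mulgA e mulgK.
have vv' : v * v'^-1 = 1.
  apply: min_coset_rep_eq1 uJ _ _; first by rewrite -u'E.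
  exact: parabolicM (parabolicV _).
split; first by rewrite u'E vv' mulg1.
by rewrite -[v'](mul1g) -vv' mulgVK.
Qed.

Lemma min_coset_repP J w :
  (forall i, i \in J -> (len w < len (w * s i))%N) -> min_coset_rep J w.
Proof.
move=> up; have [u [v [wE uJ vJ _]]] := parabolic_decomp J w.
suff v1 : v = 1 by rewrite wE v1 mulg1.
have [x Jx [xv sx]] := parabolic_reduced vJ.
case/lastP: x => [|x i] in Jx xv sx; first by rewrite -xv word_prod_nil.
move: Jx; rewrite all_rcons => /andP[Ji Jx].
have vsi : v * s i = wp x.
  by rewrite -xv -cats1 word_prod_cat word_prod1 -mulgA cox_gen_sq mulg1.
have := up i Ji; rewrite wE -mulgA !(min_coset_repM uJ) //; last first.
  by apply: parabolicM (parabolic_gen _).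
rewrite ltn_add2l vsi -sx size_rcons => /leq_trans/(_ (cox_length_le x)).
by rewrite ltnNge leqnSn.
Qed.

Lemma min_coset_rep_gt J w i : min_coset_rep J w -> i \in J -> (len w < len (w * s i))%N.
Proof. by move=> wJ iJ; rewrite (min_coset_repM wJ (parabolic_gen iJ)) cox_length_gen addn1. Qed.

Lemma min_coset_rep1 J : min_coset_rep J (1 : W).
Proof. by move=> v _; rewrite cox_length1. Qed.

Lemma min_coset_rep_suffix J u v : len (u * v) = (len u + len v)%N ->
  min_coset_rep J (u * v) -> min_coset_rep J v.
Proof.
move=> luv uvJ v' v'J; have := uvJ v' v'J; rewrite luv -mulgA.
by move/leq_trans/(_ (cox_lengthM _ _)); rewrite leq_add2l.
Qed.

(** Deodhar's lemma. If s_i w is longer than w and not minimal, it has a descent j in J, and strong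
    exchange deletes a letter from i :: x with x reduced for w. A letter inside x would contradict
    the minimality of w, so it is the leading i. *)
Lemma min_coset_rep_genM J w i : min_coset_rep J w ->
  min_coset_rep J (s i * w) \/ exists2 j, j \in J & s i * w = w * s j.
Proof.
move=> wJ; have [up|down] := cox_length_genM i w; last first.
  left; apply: (@min_coset_rep_suffix J (s i)); rewrite cox_genK //.
  by rewrite cox_length_gen.
have [[j Jj lt_j]|nex] := pselect (exists2 j, j \in J & (len (s i * w * s j) < len (s i * w))%N).
  right; exists j => //.
  have [x sx xw] := cox_length_witness w.
  have sjR : cox_reflection (s j : W) by exists 1, j; rewrite mul1g invg1 mulg1.
  have [x1 [k [x2 [+ e]]]] := @strong_exchange (s i * w) (s j) (i :: x) sjR lt_j (etrans (word_prod_cons _ _) (congr1 _ xw)).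
  case: x1 e => [|k' x1] e [ik xE]; first by apply: (mulIg (s j)); rewrite e -xE xw -mulgA cox_gen_sq mulg1.
  have := min_coset_rep_gt wJ Jj.
  have -> : w * s j = wp (x1 ++ x2).
    by apply: (mulgI (s i)); rewrite mulgA e ik -word_prod_cons.
  by have := cox_length_le (x1 ++ x2); move: sx; rewrite xE !size_cat /=; lia.
left; apply: min_coset_repP => j Jj; have [->//|lt_j] := cox_length_Mgen j (s i * w).
by case: nex; exists j => //; rewrite [ltnRHS]lt_j.
Qed.

(** * Bruhat order *)

Lemma bruhat_trans u v w : bruhat_le u v -> bruhat_le v w -> bruhat_le u w.
Proof. by move=> uv; elim=> // w' t _ IH tR lt; exact: bruhat_step IH tR lt. Qed.

Lemma bruhat_length u w : bruhat_le u w -> (len u <= len w)%N.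
Proof. by elim=> // v t _ le_uv _ lt_v; exact: leq_trans le_uv (ltnW lt_v). Qed.

Lemma bruhat_eq u w : bruhat_le u w -> len u = len w -> u = w.
Proof. by case=> // v t /bruhat_length le_uv _ lt_v; lia. Qed.

Lemma bruhat_delete x1 i x2 :
  (len (wp (x1 ++ x2)) < len (wp (x1 ++ i :: x2)))%N ->
  bruhat_le (wp (x1 ++ x2)) (wp (x1 ++ i :: x2)).
Proof.
have -> : wp (x1 ++ i :: x2) = wp (x1 ++ x2) * s i ^ wp x2.
  by rewrite !word_prod_cat word_prod_cons conjgE -!mulgA mulVKg.
move=> lt; apply: bruhat_step (bruhat_refl _) _ lt.
by exists (wp x2)^-1, i; rewrite invgK conjgE mulgA.
Qed.

Lemma bruhat_parabolic J u w : bruhat_le u w -> parabolic J w -> parabolic J u.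
Proof.
elim=> // v t _ IH tR lt_v /parabolic_reduced[x Jx [xE sx]]; apply: IH.
have tt : v * t * t = v.
  case: tR => b [i ->]; rewrite -[RHS]mulg1 -!mulgA; congr (_ * _).
  by rewrite mulKg cox_genK mulgV.
have [|x1 [i [x2 [x12 e]]]] := @strong_exchange (v * t) t x tR _ xE; first by rewrite tt.
rewrite -tt e; exists (x1 ++ x2) => //.
by move: Jx; rewrite x12 !all_cat /= => /and3P[-> _ ->].
Qed.

(** Removing the first letter by exchange stays inside W_J, so s_i itself lies in W_J as a quotient
    of two of its elements. Injectivity of the generators then puts i in J; it is obtained later
    from the numbers game. *)
Lemma reduced_word_letters J x : injective s -> size x = len (wp x) ->
  parabolic J (wp x) -> all (mem J) x.
Proof.
move=> s_inj; elim: x => // i x IH; rewrite word_prod_cons => sx Jx.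
have xred : size x = len (wp x).
  by rewrite (reduced_behead (esym sx)).
have Jx' : parabolic J (wp x).
  have [y Jy [yE _]] := parabolic_reduced Jx.
  have [|y1 [j [y2 [y12 e]]]] := @left_exchange i (s i * wp x) y _ yE.
    by rewrite cox_genK -sx /= xred.
  rewrite cox_genK in e; exists (y1 ++ y2) => //.
  by move: Jy; rewrite y12 !all_cat /= => /and3P[-> _ ->].
apply/andP; split; last exact: IH.
have : parabolic J (s i) by rewrite -[s i](mulgK (wp x)); exact: parabolicM (parabolicV _).
case/parabolic_reduced => y Jy [yE]; rewrite cox_length_gen.
case: y Jy yE => [|j []] //=; rewrite andbT word_prod1 => Jj /s_inj <- _ //.
Qed.

End CoxeterTheory.

(** * The numbers game on simply laced diagrams *)

Definition simply_laced (I : finType) (m : I -> I -> nat) : Prop :=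
  [/\ forall i, m i i = 1%N, forall i j, m i j = m j i
    & forall i j, i != j -> m i j = 2 \/ m i j = 3].

Section NumbersGame.
Local Open Scope group_scope.
Import GRing.Theory Num.Theory Order.TTheory.
Variables (I : finType) (m : I -> I -> nat).
Hypothesis laced : simply_laced m.
Implicit Types (u v w : coxeter m) (x y : seq I) (c d : I -> int) (J : {pred I}).

Local Notation W := (coxeter m).
Local Notation s := (cox_gen m).
Local Notation wp := (word_prod m).
Local Notation len w := (@cox_length I m w%g).

Let m_diag i : m i i = 1%N.
Proof. by case: laced. Qed.

Let m_sym i j : m i j = m j i.
Proof. by case: laced. Qed.

Let m_laced i j : i != j -> m i j = 2 \/ m i j = 3.
Proof. by case: laced => _ _; apply. Qed.

(** Labels are the values of a vector of the dual space on the simple roots, and firing is the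
    contragredient action of s_i. It is defined for labels of any sign; only firings at positive
    labels count as ascents. *)
Definition fire (i : I) c : I -> int :=
  fun j => if j == i then (- c i)%R else if m i j == 3 then (c j + c i)%R else c j.

Definition game x c := foldr fire c x.

Lemma game_cat x y c : game (x ++ y) c = game x (game y c).
Proof. exact: foldr_cat. Qed.

Lemma fireK i : involutive (fire i).
Proof.
move=> c; apply/funext => j; rewrite /fire eqxx.
by case: eqP => [->|_]; [rewrite opprK | case: (m i j == 3) => //=; lia].
Qed.

Lemma game_braid i j c : game (flatten (nseq (m i j) [:: i; j])) c = c.
Proof.
have [<-|ne_ij] := eqVneq i j; first by rewrite m_diag /= fireK.
have ne_ji : (j == i) = false by rewrite eq_sym (negbTE ne_ij).
have mji := m_sym j i.
case: (m_laced ne_ij) => mij; rewrite mij in mji; rewrite mij /=; apply/funext => k;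
  rewrite /fire !eqxx (negbTE ne_ij) ne_ji mij mji /=;
  (case: (eqVneq k i) => [->|ki]; last case: (eqVneq k j) => [->|kj]);
  rewrite ?eqxx ?(negbTE ne_ij) ?ne_ji ?mij ?mji /=;
  try (case: (m i k == 3); case: (m j k == 3)); rewrite /=; lia.
Qed.

Lemma game_equiv x y : wp x = wp y -> game x = game y.
Proof.
move/word_prodP; elim=> {x y} [//|x y _ -> //|x y z _ -> _ -> //|x y i|x y i j];
  apply/funext => c; rewrite !game_cat; congr game.
  exact: fireK.
exact: game_braid.
Qed.

Definition cox_game w := game (repr w).

Lemma cox_gameE x : cox_game (wp x) = game x.
Proof. by apply: game_equiv; rewrite [LHS]word_prodE cox_class_repr. Qed.

Lemma cox_gameM u v c : cox_game (u * v) c = cox_game u (cox_game v c).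
Proof.
have [x <-] := word_prod_surj u; have [y <-] := word_prod_surj v.
by rewrite -word_prod_cat !cox_gameE game_cat.
Qed.

Lemma cox_game1 c : cox_game 1 c = c.
Proof. by rewrite -word_prod_nil cox_gameE. Qed.

Lemma cox_game_gen i c : cox_game (s i) c = fire i c.
Proof. by rewrite -word_prod1 cox_gameE. Qed.

(* The sign of a coordinate detects left descents; P is meant to be
   nonnegativity or positivity. *)
Lemma cox_game_sign (P : int -> bool) c w i :
  (forall a b : int, P a -> P b -> P (a + b)%R) -> (forall j, P (c j)) ->
  (len w < len (s i * w))%N -> P (cox_game w c i).
Proof.
move=> PD Pc; have [k] := ubnP (len w); elim: k w i => // k IH w i lewk up_i.
have [->|/eqP w1] := eqVneq w 1; first by rewrite cox_game1.
have [j down_j] := left_descent w1.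
have ne_ij : i != j.
  by apply: contraTneq up_i => ->; rewrite -leqNgt ltnW.
have ne_ji : (j == i) = false by rewrite eq_sym (negbTE ne_ij).
have [w1' wE] : exists w1', w = s j * w1' by exists (s j * w); rewrite cox_genK.
have wlen : len w = (len w1').+1.
  by have := cox_length_genM j w1'; move: down_j; rewrite wE cox_genK; lia.
have lt1 : (len w1' < k)%N by rewrite -ltnS -wlen.
have up_j1 : (len w1' < len (s j * w1'))%N by rewrite -wE wlen.
have cj c' : fire j c' i = if m i j == 3 then (c' i + c' j)%R else c' i.
  by rewrite /fire (negbTE ne_ij) m_sym.
(* For a left descent j of w = s_j w1, the label of w at i is that of w1, increased by the label at
   j when i and j are adjacent. *)
rewrite wE cox_gameM cox_game_gen cj.
have lew : (len (s i * w) <= (len w).+1)%N by have := cox_length_genM i w; lia.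
have [up_i1|down_i1] := cox_length_genM i w1'.
  have Pi : P (cox_game w1' c i) by apply: IH; rewrite // up_i1.
  by case: ifP => // _; apply: PD => //; exact: IH.
have sbraid : wp (flatten (nseq (m i j) [:: i; j])) = 1.
  by rewrite -word_prod_nil; apply/word_prodP; have := cox_braid m [::] [::] i j; rewrite cats0.
(* Here s_i shortens w1 as well. If i and j commute, s_i then shortens w, against the hypothesis. If
   they are adjacent, w1 = s_i w2 and the two labels of w1 add up to the label of w2 at j, where
   induction applies. *)
case: (m_laced ne_ij) => mij; rewrite mij /= !word_prod_cons word_prod_nil mulg1 in sbraid *.
  have comm : s i * s j = s j * s i.
    apply: (mulIg (s i * s j)); rewrite -!mulgA sbraid; symmetry.
    by rewrite cox_genK cox_gen_sq.
  have e : s j * (s i * w1') = s i * w by rewrite mulgA -comm -mulgA -wE.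
  have := cox_lengthM (s j) (s i * w1'); rewrite e cox_length_gen => lew'.
  by exfalso; lia.
have [w2 w1E] : exists w2, w1' = s i * w2 by exists (s i * w1'); rewrite cox_genK.
rewrite w1E cox_genK -w1E in down_i1.
have braid : s i * s j * s i = s j * s i * s j.
  apply: (mulIg (s j * s i * s j)); rewrite -!mulgA sbraid; symmetry.
  by rewrite !(cox_genK, cox_gen_sq).
have up_j2 : (len w2 < len (s j * w2))%N.
  have [->//|down] := cox_length_genM j w2.
  have e : s j * s i * (s j * w2) = s i * w.
    by rewrite !mulgA -braid -!mulgA -w1E -wE.
  have := cox_lengthM (s j * s i) (s j * w2); have := cox_lengthM (s j) (s i).
  by rewrite e !cox_length_gen; lia.
have := IH w2 j _ up_j2; rewrite w1E cox_gameM cox_game_gen {1 2}/fire eqxx ne_ji mij /=.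
rewrite (_ : (_ + _)%R = cox_game w2 c j); last by lia.
by apply; lia.
Qed.

Lemma cox_game_ge0 c w i : (forall j, 0 <= c j)%R ->
  (len w < len (s i * w))%N -> (0 <= cox_game w c i)%R.
Proof. by move=> c0; apply: (cox_game_sign (P := fun a => 0 <= a)%R) => // a b; exact: addr_ge0. Qed.

Lemma cox_game_gt0 c w i : (forall j, 0 < c j)%R ->
  (len w < len (s i * w))%N -> (0 < cox_game w c i)%R.
Proof. by move=> c0; apply: (cox_game_sign (P := fun a => 0 < a)%R) => // a b; exact: addr_gt0. Qed.

Lemma cox_game_le0 c w i : (forall j, 0 <= c j)%R ->
  (len (s i * w) < len w)%N -> (cox_game w c i <= 0)%R.
Proof.
move=> c0 down; have := @cox_game_ge0 c (s i * w) i c0; rewrite cox_genK => /(_ down).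
by rewrite cox_gameM cox_game_gen /fire eqxx oppr_ge0.
Qed.

Lemma cox_game_lt0 c w i : (forall j, 0 < c j)%R ->
  (len (s i * w) < len w)%N -> (cox_game w c i < 0)%R.
Proof.
move=> c0 down; have := @cox_game_gt0 c (s i * w) i c0; rewrite cox_genK => /(_ down).
by rewrite cox_gameM cox_game_gen /fire eqxx oppr_gt0.
Qed.

Lemma cox_gen_inj : injective s.
Proof.
move=> i j eq_ij; have := cox_game_gen i (fun=> 1%R); rewrite eq_ij cox_game_gen.
move/(congr1 (@^~ i)); rewrite /fire eqxx; case: eqVneq => // _.
by case: ifP.
Qed.

Definition delta (e : I) : I -> int := fun j => ((j == e)%:R)%R.

Lemma delta_ge0 e j : (0 <= delta e j)%R.
Proof. exact: ler0n. Qed.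

Lemma fire_sum i c (F : I -> I -> int) :
  fire i (fun j => \sum_l c l * F l j)%R = (fun j => \sum_l c l * fire i (F l) j)%R.
Proof.
apply/funext => j; rewrite /fire; case: eqP => _; last case: ifP => _ //.
  by rewrite -sumrN; apply: eq_bigr => l _; rewrite mulrN.
by rewrite -big_split; apply: eq_bigr => l _; rewrite mulrDr.
Qed.

Lemma cox_game_sum w c k : cox_game w c k = (\sum_l c l * cox_game w (delta l) k)%R.
Proof.
have [x <-] := word_prod_surj w; rewrite cox_gameE; elim: x k => [|i x IH] k.
  rewrite (bigD1 k) //= /delta eqxx mulr1 big1 ?addr0 // => l ne_lk.
  by rewrite eq_sym (negbTE ne_lk) mulr0.
have gE : game x c = (fun j => \sum_l c l * game x (delta l) j)%R by apply/funext.
by rewrite /= gE fire_sum.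
Qed.

Lemma cox_game_parabolic J v c : (forall i, i \in J -> c i = 0%R) ->
  parabolic J v -> cox_game v c = c.
Proof.
move=> c0 [x + <-]; rewrite cox_gameE; elim: x => //= i x IH /andP[Ji /IH->].
apply/funext => j; rewrite /fire (c0 i Ji) oppr0 addr0.
by case: eqP => [->|_]; rewrite ?(c0 i Ji) //; case: ifP.
Qed.

Section MaximalParabolic.
Variables (J : {pred I}) (e : I).
Hypothesis Je : forall i, (i \in J) = (i != e).

Lemma delta_parabolic v : parabolic J v -> cox_game v (delta e) = delta e.
Proof. by apply: cox_game_parabolic => i; rewrite Je /delta => /negbTE->. Qed.

(** The only possible right descent of w is e, and such a descent makes the label of w^-1 at e
    nonpositive, whereas w^-1 fixes [delta e], with label 1 there. *)
Lemma min_coset_rep_stab w : min_coset_rep J w -> cox_game w (delta e) = delta e -> w = 1.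
Proof.
move=> wJ we; have [//|/eqP w1] := eqVneq w 1.
have [i down] := right_descent w1.
have ie : i = e.
  by apply/eqP; rewrite -[_ == _]negbK -Je; apply/negP => /(min_coset_rep_gt wJ); lia.
have := @cox_game_le0 (delta e) w^-1 i (delta_ge0 e).
rewrite -(cox_lengthV (s i * w^-1)) invgM invgK cox_genV cox_lengthV => /(_ down).
by rewrite -{1}we -cox_gameM mulVg cox_game1 ie /delta eqxx.
Qed.

Lemma min_coset_rep_inj u w : min_coset_rep J u -> min_coset_rep J w ->
  cox_game u (delta e) = cox_game w (delta e) -> u = w.
Proof.
move=> uJ wJ uw; have [a [b [uwE aJ bJ _]]] := parabolic_decomp J (u^-1 * w).
have a1 : a = 1.
  apply: min_coset_rep_stab => //; have <- : u^-1 * w * b^-1 = a by rewrite uwE mulgK.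
  rewrite !cox_gameM (delta_parabolic (parabolicV bJ)) -uw.
  by rewrite -cox_gameM mulVg cox_game1.
have wE : w = u * b by rewrite -[b]mul1g -a1 -uwE mulgA mulgV mul1g.
by rewrite wE (@min_coset_rep_eq1 _ _ J u b) ?mulg1 // -wE.
Qed.

(** The other alternative in Deodhar's lemma, s_i w = w s_j with j in J, would leave the point of w
    unchanged, while firing a positive label changes it. *)
Lemma min_coset_rep_ascent w i : min_coset_rep J w -> (0 < cox_game w (delta e) i)%R ->
  min_coset_rep J (s i * w) /\ len (s i * w) = (len w).+1.
Proof.
move=> wJ pos; split; last first.
  have [//|down] := cox_length_genM i w.
  suff: (cox_game w (delta e) i <= 0)%R by lia.
  by apply: cox_game_le0; [exact: delta_ge0 | rewrite [ltnRHS]down].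
have [//|[j Jj /(congr1 (@cox_game^~ (delta e)))]] := min_coset_rep_genM i wJ.
rewrite !cox_gameM (delta_parabolic (parabolic_gen m Jj)) cox_game_gen.
by move/(congr1 (@^~ i)); rewrite /fire eqxx; lia.
Qed.

Lemma ascent_min_coset_rep w i : min_coset_rep J w -> min_coset_rep J (s i * w) ->
  (len w < len (s i * w))%N -> (0 < cox_game w (delta e) i)%R.
Proof.
move=> wJ siwJ up; rewrite lt_def (cox_game_ge0 (delta_ge0 e) up) andbT.
apply: contraTneq up => c0; rewrite (@min_coset_rep_inj (s i * w) w) ?ltnn //.
rewrite cox_gameM cox_game_gen; apply/funext => j; rewrite /fire c0 oppr0 addr0.
by case: eqP => [->|_]; rewrite ?c0 //; case: ifP.
Qed.

(** Apply (u a)^-1 to the labeling with all labels 1, and expand the image under u^-1 over the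
    labelings [delta l]. The coefficients with l in J are positive because u is minimal; the one at
    e has unknown sign, but it multiplies the label of a^-1 (delta e) at f, which vanishes. This
    makes the ascent at f independent of the left factor u. *)
Lemma min_coset_repM_ascent a u f :
  min_coset_rep J u -> (len a < len (a * s f))%N -> cox_game a^-1 (delta e) f = 0%R ->
  (len (u * a) < len (u * a * s f))%N.
Proof.
move=> uJ up_a ae; have [->//|down] := cox_length_Mgen f (u * a).
have := @cox_game_lt0 (fun=> 1%R) (u * a)^-1 f (fun=> ltr01).
rewrite -(cox_lengthV (s f * _)) invgM invgK cox_genV cox_lengthV {1}down ltnSn => /(_ erefl).
rewrite invgM cox_gameM cox_game_sum ltNge => /negP[]; apply: sumr_ge0 => l _.
have [->|ne_le] := eqVneq l e; first by rewrite ae mulr0.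
apply: mulr_ge0.
  apply/ltW/cox_game_gt0 => //.
  rewrite -(cox_lengthV (s l * _)) invgM invgK cox_genV cox_lengthV.
  by apply: (min_coset_rep_gt uJ); rewrite Je.
apply: cox_game_ge0; first exact: delta_ge0.
by rewrite -(cox_lengthV (s f * _)) invgM invgK cox_genV cox_lengthV.
Qed.

Fixpoint ascending x c : bool :=
  if x is i :: x' then ascending x' c && (0 < game x' c i)%R else true.

Lemma ascending_cat x y c : ascending (x ++ y) c = ascending x (game y c) && ascending y c.
Proof. by elim: x => //= i x ->; rewrite game_cat andbAC. Qed.

Lemma ascending_min_coset_rep x : ascending x (delta e) ->
  min_coset_rep J (wp x) /\ len (wp x) = size x.
Proof.
elim: x => [|i x IH] /=.
  by rewrite word_prod_nil cox_length1; split=> //; exact: min_coset_rep1.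
case/andP=> /IH[xJ sx] pos; rewrite word_prod_cons -sx.
by apply: min_coset_rep_ascent; rewrite // cox_gameE.
Qed.

Lemma min_coset_rep_ascending x : min_coset_rep J (wp x) -> len (wp x) = size x ->
  ascending x (delta e).
Proof.
elim: x => //= i x IH; rewrite word_prod_cons => xJ sx.
have lx : len (wp x) = size x by exact: reduced_behead sx.
have xJ' : min_coset_rep J (wp x).
  by apply: min_coset_rep_suffix xJ; rewrite sx lx cox_length_gen.
rewrite IH //= -cox_gameE; apply: ascent_min_coset_rep => //.
by rewrite sx lx.
Qed.

End MaximalParabolic.
End NumbersGame.

Import GRing.Theory Num.Theory Order.TTheory.

(** * Coordinates for the numbers game of affine type D *)

(** [lia] treats values of [x] at different index terms as unrelated unknowns, so indices that agree
    only arithmetically have to be made identical first. *)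
Ltac merge_indices x :=
  match goal with |- context [x ?a] => match goal with |- context [x ?b] =>
    tryif constr_eq a b then fail else (rewrite (_ : x b = x a); last by (congr x; lia))
  end end.

Ltac split_ifs := rewrite /=; repeat (case: ifP => ?; try (exfalso; lia); rewrite /=).

Ltac coords x := split_ifs; repeat merge_indices x; try lia.

Section Lattice.
Local Open Scope ring_scope.
Variables (n : nat) (hn : (4 <= n)%N).
Implicit Types (N : int) (x y : nat -> int) (i j k : nat) (ws : seq nat) (e : bool).

Local Notation M := (@affD_matrix n).

Definition affD_adj i j := affD_edge n i j || affD_edge n j i.

Lemma affD_laced : simply_laced M.
Proof.
rewrite /simply_laced /affD_matrix; split=> [i|i j|i j /negbTE->]; first by rewrite eqxx.
  by rewrite eq_sym orbC.
by case: ifP; [right | left].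
Qed.

Lemma affD_matrix_adj (i j : 'I_n.+1) : i != j -> (M i j == 3%N) = affD_adj i j.
Proof. by rewrite /affD_matrix /affD_adj => /negbTE->; case: ifP. Qed.

(* The simple affine roots, evaluated at the point with coordinates
   x 1, ..., x n; the affine one vanishes on the hyperplane x 1 + x 2 = N. *)
Definition affD_root N i x : int :=
  if i == 0%N then N - x 1%N - x 2%N
  else if i == n then x (n - 1)%N + x n else x i - x i.+1.

(** The reflections in the roots [affD_root]. The level N stays a parameter: it is 1 for a labeling
    concentrated on an end node and 2n - 2 for the labeling with all labels 1. *)
Definition affD_act N i x : nat -> int := fun k =>
  if i == 0%N then (if k == 1%N then N - x 2%N else if k == 2%N then N - x 1%N else x k)
  else if i == n then (if k == (n - 1)%N then - x n else if k == n then - x (n - 1)%N else x k)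
  else if k == i then x i.+1 else if k == i.+1 then x i else x k.

Lemma affD_root_act N i k x : (i <= n)%N -> (k <= n)%N ->
  affD_root N k (affD_act N i x) =
  if k == i then - affD_root N i x
  else if affD_adj i k then affD_root N k x + affD_root N i x else affD_root N k x.
Proof.
move=> le_in le_kn; rewrite /affD_root /affD_act /affD_adj /affD_edge.
have [i0|i0] := eqVneq i 0%N; last have [iN|iN] := eqVneq i n.
all: have [k0|k0] := eqVneq k 0%N; last have [kN|kN] := eqVneq k n.
all: have [ki|ki] := eqVneq k i.
all: try (exfalso; lia).
all: coords x.
Qed.

Lemma swap_ends_le i : (i <= n)%N -> (swap_ends n i <= n)%N.
Proof. by rewrite /swap_ends => ?; split_ifs; lia. Qed.

Lemma swap_endsK i : (i <= n)%N -> swap_ends n (swap_ends n i) = i.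
Proof. by rewrite {2}/swap_ends => ?; split_ifs; rewrite /swap_ends; split_ifs; lia. Qed.

Definition relabel e i := if e then i else swap_ends n i.

Lemma relabel_le e i : (i <= n)%N -> (relabel e i <= n)%N.
Proof. by case: e => //; exact: swap_ends_le. Qed.

Lemma relabelK e i : (i <= n)%N -> relabel e (relabel e i) = i.
Proof. by case: e => //; exact: swap_endsK. Qed.

Lemma relabel_eq e i k : (i <= n)%N -> (k <= n)%N -> (relabel e i == k) = (i == relabel e k).
Proof. by move=> le_in le_kn; apply/eqP/eqP => [<-|->]; rewrite relabelK. Qed.

Lemma affD_adj_swap i k : affD_adj i k -> affD_adj (swap_ends n i) (swap_ends n k).
Proof.
have edge_swap i' k' : affD_edge n i' k' -> affD_adj (swap_ends n i') (swap_ends n k').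
  have swapid l : (2 <= l <= n - 2)%N -> swap_ends n l = l.
    by move=> ?; rewrite /swap_ends; split_ifs.
  have swap0 : swap_ends n 0 = 1%N by [].
  have swap1 : swap_ends n 1 = 0%N by [].
  have swapN1 : swap_ends n (n - 1) = n by rewrite /swap_ends; split_ifs.
  have swapN : swap_ends n n = (n - 1)%N by rewrite /swap_ends; split_ifs.
  rewrite /affD_adj; case/or4P=> /andP[].
  - by move=> /eqP-> /eqP->; rewrite swap0 swapid //; lia.
  - by move=> /eqP-> /eqP->; rewrite swap1 swapid //; lia.
  - move=> ile /eqP->; rewrite (swapid i') //.
    have [->|ne] := eqVneq i' (n - 2)%N.
      rewrite (_ : (n - 2).+1 = (n - 1)%N); last by lia.
      by rewrite swapN1 /affD_edge !eqxx !orbT.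
    by rewrite swapid ?/affD_edge ?ile ?eqxx ?orbT //; lia.
  - move=> /eqP-> /eqP->; rewrite swapN swapid; last by lia.
    rewrite /affD_edge (_ : (n - 1)%N = (n - 2).+1) ?eqxx ?andbT; last by lia.
    by rewrite (_ : 1 < n - 2 <= n - 2)%N ?orbT //; lia.
by case/orP => /edge_swap //; rewrite /affD_adj orbC.
Qed.

Lemma affD_adj_relabel e i k : (i <= n)%N -> (k <= n)%N ->
  affD_adj (relabel e i) k = affD_adj i (relabel e k).
Proof.
case: e => // le_in le_kn; apply/idP/idP => /affD_adj_swap; rewrite /relabel.
  by rewrite swap_endsK.
by rewrite (swap_endsK le_kn).
Qed.

(** The flag [e] selects one of two identifications of nodes with roots, so that segments starting
    at node 0 obey the same formulas as those starting at node 1. *)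
Definition affD_conf e N x : 'I_n.+1 -> int := fun k : 'I_n.+1 => affD_root N (relabel e k) x.

Lemma fire_conf e N i x : (i <= n)%N ->
  fire M (inord (relabel e i)) (affD_conf e N x) = affD_conf e N (affD_act N i x).
Proof.
move=> le_in; apply/funext => k; have le_kn : (k <= n)%N by rewrite -ltnS.
have lab_le := relabel_le e le_in; have labk_le := relabel_le e le_kn.
rewrite /fire /affD_conf affD_root_act // !inordK //= relabelK //.
have eq_k : (k == inord (relabel e i)) = (relabel e k == i).
  by rewrite -val_eqE /= inordK // eq_sym relabel_eq // eq_sym.
rewrite eq_k; case: (eqVneq (relabel e k) i) => // ne_ki.
rewrite affD_matrix_adj ?inordK ?affD_adj_relabel //.
by rewrite eq_sym eq_k.
Qed.

Definition letters ws := map (inord : nat -> 'I_n.+1) ws.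

Definition affD_acts N ws x := foldr (affD_act N) x ws.

Fixpoint affD_asc N ws x : bool :=
  if ws is i :: ws' then affD_asc N ws' x && (0 < affD_root N i (affD_acts N ws' x)) else true.

Lemma affD_acts_cat N ws ws' x : affD_acts N (ws ++ ws') x = affD_acts N ws (affD_acts N ws' x).
Proof. exact: foldr_cat. Qed.

Lemma affD_asc_cat N ws ws' x :
  affD_asc N (ws ++ ws') x = affD_asc N ws (affD_acts N ws' x) && affD_asc N ws' x.
Proof. by elim: ws => //= i ws ->; rewrite affD_acts_cat andbAC. Qed.

Lemma game_conf e N ws x : all (leq^~ n) ws ->
  game M (letters (map (relabel e) ws)) (affD_conf e N x) = affD_conf e N (affD_acts N ws x).
Proof. by elim: ws => //= i ws IH /andP[le_in /IH->]; exact: fire_conf. Qed.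

Lemma ascending_conf e N ws x : all (leq^~ n) ws ->
  ascending M (letters (map (relabel e) ws)) (affD_conf e N x) = affD_asc N ws x.
Proof.
elim: ws => //= i ws IH /andP[le_in le_ws]; rewrite IH // game_conf //.
by rewrite /affD_conf inordK ?relabelK // ltnS relabel_le.
Qed.

Definition swap_coords N x : nat -> int :=
  fun k => if k == 1%N then N - x 1%N else if k == n then - x n else x k.

Lemma affD_root_swap N k x : (k <= n)%N ->
  affD_root N (swap_ends n k) (swap_coords N x) = affD_root N k x.
Proof.
move=> le_kn; move E: (swap_ends n k) => k'; move: E; rewrite /swap_ends.
by split_ifs => <- {k'}; rewrite /affD_root /swap_coords; coords x.
Qed.

Lemma conf_swap_coords e N x : affD_conf (~~ e) N (swap_coords N x) = affD_conf e N x.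
Proof.
apply/funext => k; have le_kn : (k <= n)%N by rewrite -ltnS.
rewrite /affD_conf; case: e; rewrite /relabel /=; first exact: affD_root_swap.
by rewrite -{1}(swap_endsK le_kn) affD_root_swap // swap_ends_le.
Qed.

Definition base_point : nat -> int := fun k => (k == 1%N)%:R.

Definition node e : 'I_n.+1 := inord e.

Lemma val_node e : node e = e :> nat.
Proof. by rewrite inordK //; case: e => //; lia. Qed.

Lemma gens_but_node e (i : 'I_n.+1) : (i \in gens_but n e) = (i != node e).
Proof. by rewrite inE -val_eqE /= val_node. Qed.

Lemma conf_base_point e : affD_conf e 1 base_point = delta (node e).
Proof.
apply/funext => k; have : (k <= n)%N by rewrite -ltnS.
rewrite /delta -val_eqE /= val_node /affD_conf; move: (nat_of_ord k) => {}k le_kn.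
case: e; rewrite /relabel; first by rewrite /affD_root /base_point; split_ifs; lia.
move E: (swap_ends n k) => k'; move: E; rewrite /swap_ends.
by split_ifs => <- {k'}; rewrite /affD_root /base_point; split_ifs; lia.
Qed.

Lemma affD_conf_inj e N x y : affD_conf e N x = affD_conf e N y ->
  forall k, (1 <= k <= n)%N -> x k = y k.
Proof.
move=> exy.
have root_eq i : (i <= n)%N -> affD_root N i x = affD_root N i y.
  move=> le_in; have := congr1 (@^~ (inord (relabel e i))) exy.
  by rewrite /affD_conf inordK ?relabelK // ltnS relabel_le.
have xn1 : x n = y n.
  have := root_eq n (leqnn _); have := root_eq (n - 1)%N (leq_subr _ _).
  rewrite /affD_root; split_ifs.
  by rewrite (_ : (n - 1).+1 = n) ; lia.
suff H d : (d < n)%N -> x (n - d)%N = y (n - d)%N.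
  by move=> k kn; rewrite -(@subKn k n) ?H; lia.
elim: d => [|d IH] lt_dn; first by rewrite subn0.
have := root_eq (n - d.+1)%N; rewrite /affD_root.
split_ifs; rewrite (_ : (n - d.+1).+1 = (n - d)%N); last by lia.
by rewrite IH => [/(_ (leq_subr _ _))|]; lia.
Qed.

End Lattice.

(** * Segments *)

Section Segments.
Local Open Scope ring_scope.
Variables (n : nat) (hn : (4 <= n)%N).
Implicit Types (N : int) (x y : nat -> int) (i j k : nat) (ws : seq nat) (e : bool) (p q : part).

Local Notation M := (@affD_matrix n).
Local Notation acts := (affD_acts n).
Local Notation asc := (affD_asc n).

Definition down j := rev (iota 1 j).

Lemma downS j : down j.+1 = j.+1 :: down j.
Proof.
rewrite /down -[RHS]revK rev_cons revK; congr rev.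
by rewrite -cats1 -[X in iota 1 X]addn1 iotaD add1n.
Qed.

Lemma acts_down N j x k : (j < n)%N -> acts N (down j) x k =
  if (1 <= k <= j)%N then x k.+1 else if k == j.+1 then x 1%N else x k.
Proof.
elim: j k => [|j IH] k lt_jn; first by split_ifs; coords x.
by rewrite downS /= /affD_act !IH; [coords x | lia..].
Qed.

Lemma asc_down N j x : (j < n)%N ->
  asc N (down j) x <-> (forall k, (1 <= k <= j)%N -> x k.+1 < x 1%N).
Proof.
elim: j => [|j IH] lt_jn; first by split=> // _ k; lia.
rewrite downS /=; have -> : affD_root n N j.+1 (acts N (down j) x) = x 1%N - x j.+2.
  by rewrite /affD_root !acts_down; [coords x | lia..].
rewrite subr_gt0; split=> [/andP[/IH H lt] k kj|H].
  have [->//|ne] := eqVneq k j.+1; apply: H; lia.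
by rewrite H ?andbT; last lia; apply/IH; [lia | move=> k kj; apply: H; lia].
Qed.

Lemma acts_up N m d x k : (0 < m)%N -> (m + d)%N = n -> acts N (iota m d) x k =
  if (k < m)%N then x k else if k == m then x n
  else if (k <= n)%N then x (k - 1)%N else x k.
Proof.
elim: d m k => [|d IH] m k m0 md; first by split_ifs; coords x.
by rewrite /= /affD_act !IH; [coords x | lia..].
Qed.

Lemma asc_up N m d x : (0 < m)%N -> (m + d)%N = n ->
  asc N (iota m d) x <-> (forall k, (m <= k < n)%N -> x n < x k).
Proof.
elim: d m => [|d IH] m m0 md; first by split=> // _ k; lia.
rewrite /=; have -> : affD_root n N m (acts N (iota m.+1 d) x) = x m - x n.
  by rewrite /affD_root !acts_up; [coords x | lia..].
rewrite subr_gt0; split=> [/andP[/IH H lt] k kj|H].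
  have [->//|ne] := eqVneq k m; apply: H; lia.
by rewrite H ?andbT; last lia; apply/IH; [lia | lia | move=> k kj; apply: H; lia].
Qed.

Lemma acts_spin N x k : acts N (n :: down (n - 2)) x k =
  if (1 <= k <= n - 2)%N then x k.+1 else if k == (n - 1)%N then - x n
  else if k == n then - x 1%N else x k.
Proof. by rewrite /= /affD_act !acts_down; [coords x | lia..]. Qed.

Lemma asc_spin N x : asc N (n :: down (n - 2)) x <->
  (forall k, (1 <= k <= n - 2)%N -> x k.+1 < x 1%N) /\ 0 < x 1%N + x n.
Proof.
have dn : asc N (down (n - 2)) x <-> (forall k, (1 <= k <= n - 2)%N -> x k.+1 < x 1%N).
  by apply: asc_down; lia.
rewrite /=; have -> : affD_root n N n (acts N (down (n - 2)) x) = x 1%N + x n.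
  by rewrite /affD_root !acts_down; [coords x | lia..].
by split=> [/andP[/dn ? ->]|[/dn-> ->]].
Qed.

Lemma segment1_low p : (p.1 <= n - 2)%N -> segment1 n p = down p.1.
Proof. by rewrite /segment1 => ->. Qed.

Lemma segment1_b : segment1 n ((n - 1)%N, Some color_b) = down (n - 1).
Proof.
rewrite /segment1 /= (_ : (n - 1 <= n - 2)%N = false) ?eqxx; last by lia.
by rewrite (_ : (n - 1)%N = (n - 2).+1) ?downS //; lia.
Qed.

Lemma segment1_c : segment1 n ((n - 1)%N, Some color_c) = n :: down (n - 2).
Proof. by rewrite /segment1 /= (_ : (n - 1 <= n - 2)%N = false) ?eqxx //; lia. Qed.

Lemma segment1_high p : (n <= p.1)%N ->
  segment1 n p = iota (2 * n - p.1 - 1) (p.1 - n + 1) ++ n :: down (n - 2).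
Proof. by move=> le_np; rewrite /segment1; split_ifs. Qed.

Lemma asc_high N p x : (n <= p.1 <= 2 * n - 2)%N -> asc N (segment1 n p) x <->
  [/\ forall k, (1 <= k <= n - 2)%N -> x k.+1 < x 1%N, 0 < x 1%N + x n, x n < x 1%N
    & forall k, (2 * n - p.1 - 1 <= k <= n - 2)%N -> 0 < x 1%N + x k.+1].
Proof.
move=> np; rewrite segment1_high ?affD_asc_cat; last by lia.
set z := acts N _ x.
have zE k : z k = if (1 <= k <= n - 2)%N then x k.+1 else if k == (n - 1)%N then - x n
  else if k == n then - x 1%N else x k by exact: acts_spin.
have up : asc N (iota (2 * n - p.1 - 1) (p.1 - n + 1)) z <->
    (forall k, (2 * n - p.1 - 1 <= k < n)%N -> z n < z k) by apply: asc_up; lia.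
have zn : z n = - x 1%N by rewrite zE; split_ifs.
split=> [/andP[/up H /asc_spin[H1 H2]]|[H1 H2 H3 H4]].
  split=> //.
    have := H (n - 1)%N; rewrite zn zE; split_ifs; lia.
  by move=> k kn; have := H k; rewrite zn zE; split_ifs; lia.
apply/andP; split; last by apply/asc_spin.
by apply/up => k kn; have := H4 k; rewrite zn zE; split_ifs; lia.
Qed.

Lemma acts_high N p x k : (n <= p.1 <= 2 * n - 2)%N -> acts N (segment1 n p) x k =
  if (1 <= k < 2 * n - p.1 - 1)%N then x k.+1 else if k == (2 * n - p.1 - 1)%N then - x 1%N
  else if k == n then - x n else x k.
Proof.
move=> np; rewrite segment1_high ?affD_acts_cat ?acts_up; try lia.
by rewrite !acts_spin; coords x.
Qed.

Lemma valid_part_cases p : valid_part n p ->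
  [\/ (1 <= p.1 <= n - 2)%N /\ p.2 = None, p = ((n - 1)%N, Some color_b),
      p = ((n - 1)%N, Some color_c) | (n <= p.1 <= 2 * n - 2)%N /\ p.2 = None].
Proof.
case: p => j c [/= jn cP].
have [jE|jN] := eqVneq j (n - 1)%N.
  case: c cP => [[]|] cP; [constructor 2 | constructor 3 |]; rewrite ?jE //.
  by case: cP => _ /(_ jE).
have c0 : c = None by case: c cP => // c [+ _] => /(_ ltac:(by []))/eqP; rewrite (negbTE jN).
have [le|gt] := leqP j (n - 2)%N; [constructor 1 | constructor 4]; split=> //; lia.
Qed.

Lemma valid_low j : (1 <= j <= n - 2)%N -> valid_part n (j, None).
Proof. by move=> jn; split=> /=; [lia | split=> //; lia]. Qed.

Lemma valid_mid c : valid_part n ((n - 1)%N, Some c).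
Proof. by split=> /=; [lia | split]. Qed.

Lemma valid_high j : (n <= j <= 2 * n - 2)%N -> valid_part n (j, None).
Proof. by move=> jn; split=> /=; [lia | split=> //; lia]. Qed.

Lemma size_segment1 p : valid_part n p -> size (segment1 n p) = p.1.
Proof.
case/valid_part_cases => [[pn _]|->|->|[pn _]].
- by rewrite segment1_low ?size_rev ?size_iota //; lia.
- by rewrite segment1_b size_rev size_iota.
- by rewrite segment1_c /= size_rev size_iota /=; lia.
- by rewrite segment1_high ?size_cat /= ?size_rev ?size_iota; lia.
Qed.

Lemma segment1_letters p : valid_part n p -> all (fun i => 1 <= i <= n)%N (segment1 n p).
Proof.
have dn j : (j <= n)%N -> all (fun i => 1 <= i <= n)%N (down j).
  by move=> jn; apply/allP => i; rewrite mem_rev mem_iota; lia.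
case/valid_part_cases => [[pn _]|->|->|[pn _]].
- by rewrite segment1_low ?dn //; lia.
- by rewrite segment1_b dn //; lia.
- by rewrite segment1_c /= dn ?leqnn ?andbT; lia.
- rewrite segment1_high ?all_cat /= ?dn ?leqnn ?andbT; try lia.
  by apply/andP; split; [apply/allP => i; rewrite mem_iota|]; lia.
Qed.

Lemma segmentE e p : segment n e p = map (relabel n e) (segment1 n p).
Proof. by case: e => //=; rewrite map_id. Qed.

Definition unit_vector (b : bool) k : nat -> int :=
  fun l => if l == k then (if b then 1 else -1) else 0.

(** The points reached from the first basis vector by W_S are the 2n vectors with a single nonzero
    entry 1 or -1, the weights of the vector representation of D_n. Parts correspond to all of them
    but the starting one; the two colors of n - 1 are the two signs in the last place. *)
Definition part_vector p : nat -> int :=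
  if (p.1 <= n - 2)%N then unit_vector true p.1.+1
  else if p.1 == (n - 1)%N then unit_vector (if p.2 is Some color_b then true else false) n
  else unit_vector false (2 * n - p.1 - 1).

Lemma acts_base_point p : valid_part n p -> acts 1 (segment1 n p) base_point = part_vector p.
Proof.
move=> vp; apply/funext => k; rewrite /part_vector; case/valid_part_cases: vp => [[pn _]|->|->|[pn _]].
- rewrite segment1_low ?acts_down ?/base_point ?/unit_vector; try lia.
  by split_ifs; lia.
- rewrite segment1_b acts_down /base_point /unit_vector /=; try lia.
  by split_ifs; lia.
- by rewrite segment1_c acts_spin /base_point /unit_vector /=; split_ifs; lia.
- by rewrite acts_high ?/base_point ?/unit_vector //; split_ifs; lia.
Qed.

Lemma asc_base_point p : valid_part n p -> asc 1 (segment1 n p) base_point.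
Proof.
case/valid_part_cases => [[pn _]|->|->|[pn _]].
- by rewrite segment1_low ?asc_down /base_point; try lia; apply/asc_down => [|k]; lia.
- by rewrite segment1_b; apply/asc_down => [|k]; rewrite /base_point; lia.
- by rewrite segment1_c; apply/asc_spin; split=> [k|]; rewrite /base_point; lia.
- by apply/asc_high => //; rewrite /base_point; split=> *; lia.
Qed.

Lemma unit_vector_inj (b b' : bool) k k' : (1 <= k <= n)%N ->
  (forall l, (1 <= l <= n)%N -> unit_vector b k l = unit_vector b' k' l) -> b = b' /\ k = k'.
Proof.
move=> kn /(_ k kn); rewrite /unit_vector eqxx; case: eqP => [->|_]; first by case: b; case: b'.
by case: b; case: b'.
Qed.

Definition part_position p : bool * nat :=
  if (p.1 <= n - 2)%N then (true, p.1.+1)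
  else if p.1 == (n - 1)%N then (if p.2 is Some color_b then true else false, n)
  else (false, 2 * n - p.1 - 1)%N.

Lemma part_vectorE p : part_vector p = unit_vector (part_position p).1 (part_position p).2.
Proof. by rewrite /part_vector /part_position; case: (_ <= _)%N => //; case: (_ == _). Qed.

Lemma part_vector_inj p q : valid_part n p -> valid_part n q ->
  (forall k, (1 <= k <= n)%N -> part_vector p k = part_vector q k) -> p = q.
Proof.
move=> vp vq; rewrite !part_vectorE => /unit_vector_inj[|].
  rewrite /part_position; case/valid_part_cases: vp => [[pn _]|->|->|[pn _]] /=; split_ifs; lia.
have lowE r : (1 <= r <= n - 2)%N -> part_position (r, None) = (true, r.+1).
  by rewrite /part_position /= => /andP[_ ->].
have bE : part_position ((n - 1)%N, Some color_b) = (true, n).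
  by rewrite /part_position /= eqxx; case: ifP => //; lia.
have cE : part_position ((n - 1)%N, Some color_c) = (false, n).
  by rewrite /part_position /= eqxx; case: ifP => //; lia.
have highE r : (n <= r <= 2 * n - 2)%N -> part_position (r, None) = (false, 2 * n - r - 1)%N.
  by move=> rn; rewrite /part_position; split_ifs.
case: p q vp vq => [j c] [j' c'] /valid_part_cases[[pn /= ->]|->|->|[pn /= ->]]
  /valid_part_cases[[qn /= ->]|->|->|[qn /= ->]] //;
  try move: pn => /= pn; try move: qn => /= qn;
  rewrite ?(lowE _ pn) ?(lowE _ qn) ?(highE _ pn) ?(highE _ qn) ?bE ?cE //= => // bb kk;
  try discriminate bb; try (exfalso; lia); congr (_, _); lia.
Qed.

Lemma part_vector_surj (b : bool) k : (1 <= k <= n)%N -> (b, k) <> (true, 1%N) ->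
  exists2 p, valid_part n p & part_vector p = unit_vector b k.
Proof.
move=> kn bk1; case: b bk1 => bk1.
  have k1 : k != 1%N by apply: contra_notN bk1 => /eqP->.
  have [kN|kN] := eqVneq k n.
    exists ((n - 1)%N, Some color_b); first exact: valid_mid.
    by rewrite /part_vector /= kN; split_ifs.
  exists ((k - 1)%N, None); first by apply: valid_low; lia.
  rewrite /part_vector /=; case: ifP => ?; last by exfalso; lia.
  by congr unit_vector; lia.
have [kN|kN] := eqVneq k n.
  exists ((n - 1)%N, Some color_c); first exact: valid_mid.
  by rewrite /part_vector /= kN; split_ifs.
exists ((2 * n - k - 1)%N, None); first by apply: valid_high; lia.
rewrite /part_vector /=; split_ifs.
by congr unit_vector; lia.
Qed.

Lemma acts_unit_vector ws : all (fun i => 1 <= i <= n)%N ws ->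
  exists b k, (1 <= k <= n)%N /\ acts 1 ws base_point = unit_vector b k.
Proof.
elim: ws => [_|i ws IH /= /andP[iN /IH[b [k [kN ->]]]]].
  exists true, 1%N; split; first lia.
  by apply/funext => k; rewrite /base_point /unit_vector /=; case: eqP.
have step b' k' : (1 <= k' <= n)%N -> affD_act n 1 i (unit_vector b k) =1 unit_vector b' k' ->
    exists b0 k0, (1 <= k0 <= n)%N /\ affD_act n 1 i (unit_vector b k) = unit_vector b0 k0.
  by move=> *; exists b', k'; split=> //; apply/funext.
have [iE|iN'] := eqVneq i n.
  have [kE|kE] := eqVneq k n; last have [kE'|kE'] := eqVneq k (n - 1)%N.
  - apply: (step (~~ b) (n - 1)%N) => [|l]; first lia.
    by rewrite /affD_act /unit_vector; split_ifs; case: (b); lia.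
  - apply: (step (~~ b) n) => [|l]; first lia.
    by rewrite /affD_act /unit_vector; split_ifs; case: (b); lia.
  - apply: (step b k) => // l.
    by rewrite /affD_act /unit_vector; split_ifs; case: (b); lia.
have [kE|kE] := eqVneq k i; last have [kE'|kE'] := eqVneq k i.+1.
- apply: (step b i.+1) => [|l]; first lia.
  by rewrite /affD_act /unit_vector; split_ifs; case: (b); lia.
- apply: (step b i) => [|l]; first lia.
  by rewrite /affD_act /unit_vector; split_ifs; case: (b); lia.
- apply: (step b k) => // l.
  by rewrite /affD_act /unit_vector; split_ifs; case: (b); lia.
Qed.

Definition okpair p q := ((q.1 < p.1) || (q == p) && (n - 1 <= p.1))%N.

Lemma swap_part_vector p k : valid_part n p -> (1 <= k <= n)%N ->
  swap_coords n 1 (part_vector p) k =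
  if k == 1%N then (if p.1 == (2 * n - 2)%N then 2 else 1)
  else if (p.1 <= n - 2)%N then (k == p.1.+1)%:R
  else if p.1 == (n - 1)%N then (if k == n then (if p.2 is Some color_b then -1 else 1) else 0)
  else - (k == 2 * n - p.1 - 1)%N%:R.
Proof.
move=> vp kn; rewrite /swap_coords /part_vector /unit_vector.
case/valid_part_cases: vp => [[pn _]|->|->|[pn _]] /=; split_ifs; lia.
Qed.

(** After [p], the first coordinate is 1, or 2 for the longest part, and at most one other
    coordinate is nonzero. A part up to n - 2 leaves a 1 at place p.1 + 1, which stops every segment
    of size at least p.1. Color b leaves -1 in the last place, which lets b pass but stops the
    letter n; color c leaves 1 there, with the roles reversed. A larger part leaves a -1, which
    blocks only the way back of a longer one. *)
Lemma asc_okpair p q : valid_part n p -> valid_part n q ->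
  asc 1 (segment1 n q) (swap_coords n 1 (part_vector p)) = okpair p q.
Proof.
move=> vp vq; set y := swap_coords n 1 _.
have yE k : (1 <= k <= n)%N -> y k = _ := swap_part_vector vp.
clearbody y.
have pqE : (q == p) = (q.1 == p.1) && ((q.1 == (n - 1)%N) ==> (q.2 == p.2)).
  apply/eqP/andP=> [->|[/eqP]]; first by rewrite !eqxx implybT.
  case: p q vp vq {yE} => [j c] [j' c'] [_ /= vp] [_ /= vq] /= jj /implyP cc; subst j'; congr (_, _).
  have [jn|jn] := eqVneq j (n - 1)%N; first by apply/eqP/cc/eqP.
  by case: c vp {cc} => [c|] vp; [case/eqP: jn; apply/vp|]; case: c' vq => // c' vq; case/eqP: jn; apply/vq.
rewrite /okpair pqE {pqE}.
have bc : (Some color_b == Some color_c) = false by apply/eqP.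
have cb : (Some color_c == Some color_b) = false by apply/eqP.
have y1 := yE 1%N; have yn := yE n; have yp := yE p.1.+1; have ym := yE (2 * n - p.1 - 1)%N.
case/valid_part_cases: vq => [[qn _]|->|->|[qn q2]].
- rewrite segment1_low; last by lia.
  apply/idP/idP => [/asc_down H|pq]; last first.
    apply/asc_down => [|k kn]; first lia.
    have := yE k.+1; move: y1; move: pq.
    case/valid_part_cases: vp {yE yn yp ym} => [[pn _]|->|->|[pn _]] /=; split_ifs; lia.
  case/valid_part_cases: vp => [[pn _]|pE|pE|[pn _]]; rewrite ?pE /=; try lia.
  have := H ltac:(lia) p.1; move: y1 yp; split_ifs; lia.
- rewrite segment1_b /=; apply/idP/idP => [/asc_down H|pq]; last first.
    apply/asc_down => [|k kn]; first lia.
    have := yE k.+1; move: y1; move: pq.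
    case/valid_part_cases: vp {yE yn yp ym} => [[pn _]|->|->|[pn _]] /=; rewrite ?bc ?cb ?eqxx; split_ifs; lia.
  case/valid_part_cases: vp => [[pn _]|pE|pE|[pn _]]; rewrite ?pE /= ?eqxx ?implybT ?bc ?cb; try lia.
    have := H ltac:(lia) p.1; move: y1 yp; split_ifs; lia.
  have := H ltac:(lia) (n - 1)%N; rewrite (_ : (n - 1).+1 = n); last by lia.
  by move: y1 yn; rewrite pE /=; split_ifs; lia.
- rewrite segment1_c /=; apply/idP/idP => [/asc_spin[H1 H2]|pq]; last first.
    apply/asc_spin; split=> [k kn|].
      have := yE k.+1; move: y1; move: pq.
      case/valid_part_cases: vp {yE yn yp ym} => [[pn _]|->|->|[pn _]] /=; rewrite ?bc ?cb ?eqxx; split_ifs; lia.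
    move: yn; move: y1; move: pq.
    case/valid_part_cases: vp {yE yp ym} => [[pn _]|->|->|[pn _]] /=; rewrite ?bc ?cb ?eqxx; split_ifs; lia.
  case/valid_part_cases: vp => [[pn _]|pE|pE|[pn _]]; rewrite ?pE /= ?eqxx ?implybT ?bc ?cb; try lia.
    have := H1 p.1; move: y1 yp; split_ifs; lia.
  by move: H2 y1 yn; rewrite pE /=; split_ifs; lia.
- apply/idP/idP => [/asc_high[//|H1 H2 H3 H4]|pq]; last first.
    apply/asc_high => //; split=> [k kn|||k kn].
    + have := yE k.+1; move: y1; move: pq.
      case/valid_part_cases: vp {yE yn yp ym} => [[pn _]|->|->|[pn _]] /=; split_ifs; lia.
    + move: yn; move: y1; move: pq.
      case/valid_part_cases: vp {yE yp ym} => [[pn _]|->|->|[pn _]] /=; split_ifs; lia.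
    + move: yn; move: y1; move: pq.
      case/valid_part_cases: vp {yE yp ym} => [[pn _]|->|->|[pn _]] /=; split_ifs; lia.
    + have := yE k.+1; move: y1; move: pq.
      case/valid_part_cases: vp {yE yn yp ym} => [[pn _]|->|->|[pn _]] /=; split_ifs; lia.
  case/valid_part_cases: vp => [[pn _]|pE|pE|[pn _]].
  + by exfalso; have := H1 p.1; move: y1 yp; split_ifs; lia.
  + by exfalso; move: H2 y1 yn; rewrite pE /=; split_ifs; lia.
  + by exfalso; move: H3 y1 yn; rewrite pE /=; split_ifs; lia.
  (* The place where [p] has left its -1: a longer segment [q] would have to pass it on the way
     back. *)
  + have := H4 (2 * n - p.1 - 2)%N; rewrite (_ : (2 * n - p.1 - 2).+1 = 2 * n - p.1 - 1)%N; last by lia.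
    by move: y1 ym; split_ifs; lia.
Qed.

End Segments.

(** * Colored partitions *)

Section Chains.
Local Open Scope ring_scope.
Variables (n : nat) (hn : (4 <= n)%N).
Implicit Types (x y : nat -> int) (e : bool) (p q : part) (ps : seq part) (ss : seq (seq nat)).

Local Notation M := (@affD_matrix n).
Local Notation W := (coxeter M).
Local Notation wp := (word_prod M).
Local Notation s := (cox_gen M).
Local Notation len w := (@cox_length _ M w%g).
Local Notation laced := (affD_laced n).
Local Notation Jnode := (gens_but_node hn).
Implicit Types u v w : W.

Lemma ascending_base e ws : all (leq^~ n) ws -> affD_asc n 1 ws base_point ->
  min_coset_rep (gens_but n e) (wp (letters n (map (relabel n e) ws))) /\
  len (wp (letters n (map (relabel n e) ws))) = size ws.
Proof.
move=> le_ws asc_ws.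
have [|? ->] := ascending_min_coset_rep laced (Jnode e) (x := letters n (map (relabel n e) ws)).
  by rewrite -(conf_base_point hn) ascending_conf.
by split=> //; rewrite !size_map.
Qed.

Lemma letters_relabel e (z : seq 'I_n.+1) :
  letters n (map (relabel n e) (map (fun i : 'I_n.+1 => relabel n e i) z)) = z.
Proof.
rewrite /letters -!map_comp -[RHS]map_id; apply: eq_map => i /=.
by rewrite relabelK ?inord_val // -ltnS.
Qed.

Lemma segment1_le p : valid_part n p -> all (leq^~ n) (segment1 n p).
Proof. by move/(segment1_letters hn); apply: sub_all => i /andP[]. Qed.

Lemma sigmaE e p : sigma n e p = wp (letters n (map (relabel n e) (segment1 n p))).
Proof. by rewrite /sigma segmentE. Qed.

Lemma sigma_min e p : valid_part n p ->
  min_coset_rep (gens_but n e) (sigma n e p) /\ len (sigma n e p) = p.1.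
Proof.
move=> vp; rewrite sigmaE -(size_segment1 hn vp).
by apply: ascending_base; [exact: segment1_le | exact: asc_base_point].
Qed.

Lemma relabel_node e i : (i <= n)%N -> (relabel n e i == ~~ e :> nat) = (i == 0%N).
Proof.
move=> le_in; case: e => //=; rewrite /relabel /swap_ends; split_ifs; lia.
Qed.

Lemma sigma_parabolic e p : valid_part n p -> parabolic (gens_but n (~~ e)) (sigma n e p).
Proof.
move=> vp; rewrite sigmaE; eexists; last by [].
rewrite all_map all_map; apply: sub_all (segment1_letters hn vp) => i /= /andP[i1 le_in].
by rewrite inE /= inordK ?relabel_node // -?lt0n // ltnS relabel_le.
Qed.

Lemma cox_game_sigma e p : valid_part n p ->
  cox_game (sigma n e p) (delta (node n e)) = affD_conf e 1 (part_vector n p).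
Proof.
move=> vp; rewrite sigmaE (cox_gameE laced) -(conf_base_point hn).
by rewrite game_conf ?segment1_le // acts_base_point.
Qed.

Lemma sigma_inj e p q : valid_part n p -> valid_part n q -> sigma n e p = sigma n e q -> p = q.
Proof.
move=> vp vq pq; apply: (part_vector_inj hn vp vq); apply: (affD_conf_inj hn (e := e) (N := 1)).
by rewrite -!cox_game_sigma // pq.
Qed.

(** The point of v is a signed basis vector, each of which is the starting point or a part vector,
    and a minimal representative is determined by its point. *)
Lemma parabolic_min_sigma e v : parabolic (gens_but n (~~ e)) v ->
  min_coset_rep (gens_but n e) v -> v = 1%g \/ exists2 p, valid_part n p & v = sigma n e p.
Proof.
move=> [z Jz zv] vJ; pose ws := map (fun i : 'I_n.+1 => relabel n e i) z.
have zE : z = letters n (map (relabel n e) ws) by rewrite letters_relabel.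
have ws_le : all (fun i => 1 <= i <= n)%N ws.
  rewrite all_map; apply: sub_all Jz => i; rewrite inE /= => ne_i.
  have le_in : (i <= n)%N by rewrite -ltnS.
  rewrite relabel_le // andbT lt0n; apply: contra ne_i => /eqP i0.
  by have := relabel_node e (relabel_le hn e le_in); rewrite relabelK // i0 eqxx.
have [b [k [kn bkE]]] := acts_unit_vector hn ws_le.
have vE : cox_game v (delta (node n e)) = affD_conf e 1 (unit_vector b k).
  rewrite -zv zE (cox_gameE laced) -(conf_base_point hn) game_conf ?bkE //.
  by apply: sub_all ws_le => i /andP[].
have [bk1|/eqP bk1] := eqVneq (b, k) (true, 1%N).
  left; apply: (min_coset_rep_stab laced (Jnode e)) => //; rewrite vE -(conf_base_point hn).
  case: bk1 => -> ->; congr affD_conf; apply/funext => l.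
  by rewrite /unit_vector /base_point; case: eqP.
have [p vp pE] := part_vector_surj hn kn bk1; right; exists p => //.
apply: (min_coset_rep_inj laced (Jnode e)) => //; first by case: (sigma_min e vp).
by rewrite vE cox_game_sigma // pE.
Qed.

(* Segments are listed from right to left, and the labels 0, 1 as well as
   n - 1, n are exchanged from each segment to the next. *)
Fixpoint gword e ss : seq nat :=
  if ss is s :: ss' then gword (~~ e) ss' ++ map (relabel n e) s else [::].

Fixpoint gpoint ss x :=
  if ss is s :: ss' then gpoint ss' (swap_coords n 1 (affD_acts n 1 s x)) else x.

Fixpoint gasc ss x : bool :=
  if ss is s :: ss' then affD_asc n 1 s x && gasc ss' (swap_coords n 1 (affD_acts n 1 s x))
  else true.

Lemma letters_cat ws ws' : letters n (ws ++ ws') = letters n ws ++ letters n ws'.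
Proof. exact: map_cat. Qed.

Lemma game_gword e ss x : all (all (leq^~ n)) ss ->
  game M (letters n (gword e ss)) (affD_conf e 1 x) =
  affD_conf (odd (size ss) (+) e) 1 (gpoint ss x).
Proof.
elim: ss e x => //= s1 ss IH e x /andP[le1 le_ss].
rewrite letters_cat game_cat game_conf // -(conf_swap_coords hn) IH //.
by rewrite addNb addbN.
Qed.

Lemma ascending_gword e ss x : all (all (leq^~ n)) ss ->
  ascending M (letters n (gword e ss)) (affD_conf e 1 x) = gasc ss x.
Proof.
elim: ss e x => //= s1 ss IH e x /andP[le1 le_ss].
rewrite letters_cat ascending_cat game_conf // ascending_conf // andbC.
by rewrite -(conf_swap_coords hn) IH.
Qed.

Lemma gpoint_cat ss ss' x : gpoint (ss ++ ss') x = gpoint ss' (gpoint ss x).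
Proof. by elim: ss x => //= s1 ss IH x; rewrite IH. Qed.

Lemma gasc_cat ss ss' x : gasc (ss ++ ss') x = gasc ss x && gasc ss' (gpoint ss x).
Proof. by elim: ss x => //= s1 ss IH x; rewrite IH andbA. Qed.

Lemma size_gword e ss : size (gword e ss) = sumn (map size ss).
Proof. by elim: ss e => //= s1 ss IH e; rewrite size_cat IH size_map addnC. Qed.

(** The entries of [ss] are arbitrary words, so that points and ascents can also be computed for
    segments from which letters have been deleted. *)
Definition gelt e ss : W := wp (letters n (gword e ss)).

Lemma gelt_min e ss : all (all (leq^~ n)) ss -> gasc ss base_point ->
  min_coset_rep (gens_but n e) (gelt e ss) /\ len (gelt e ss) = sumn (map size ss).
Proof.
move=> le_ss asc_ss.
have [|? lenE] := ascending_min_coset_rep laced (Jnode e) (x := letters n (gword e ss)).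
  by rewrite -(conf_base_point hn) ascending_gword.
by split=> //; rewrite [LHS]lenE size_map size_gword.
Qed.

Lemma gelt_point e ss : all (all (leq^~ n)) ss ->
  cox_game (gelt e ss) (delta (node n e)) = affD_conf (odd (size ss) (+) e) 1 (gpoint ss base_point).
Proof. by move=> le_ss; rewrite (cox_gameE laced) -(conf_base_point hn) game_gword. Qed.

Definition elt e ps : W := gelt e (map (segment1 n) ps).

Lemma elt_cons e p ps : elt e (p :: ps) = (elt (~~ e) ps * sigma n e p)%g.
Proof. by rewrite /elt /gelt /= letters_cat word_prod_cat sigmaE. Qed.

Lemma elt_nil e : elt e [::] = 1%g.
Proof. exact: word_prod_nil. Qed.

Fixpoint chain ps : Prop :=
  if ps is p :: ps' then
    [/\ valid_part n p, (if ps' is q :: _ then okpair n p q else true) & chain ps']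
  else True.

Lemma chain_valid ps : chain ps -> forall p, p \in ps -> valid_part n p.
Proof. by elim: ps => //= p ps IH [vp _ /IH H] q; rewrite inE => /predU1P[->|/H]. Qed.

Lemma segments_le ps : (forall p, p \in ps -> valid_part n p) ->
  all (all (leq^~ n)) (map (segment1 n) ps).
Proof. by move=> vps; rewrite all_map; apply/allP => p /vps/segment1_le. Qed.

Lemma elt_pair e p q : valid_part n p -> valid_part n q -> okpair n p q ->
  min_coset_rep (gens_but n e) (elt e [:: p; q]).
Proof.
move=> vp vq pq; case: (@gelt_min e (map (segment1 n) [:: p; q])) => //=.
  by rewrite !segment1_le.
by rewrite asc_base_point // acts_base_point // asc_okpair // pq.
Qed.

Lemma node_neq e : node n (~~ e) != node n e.
Proof. by rewrite -val_eqE /= !val_node //; case: e. Qed.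

Lemma node_relabel e : inord (relabel n e 1) = node n e.
Proof. by case: e => //; rewrite /relabel /swap_ends. Qed.

(** Only the longest segment contains the letter 1 twice; in all others it stands at the right end
    and nowhere else. *)
Lemma sigma_ends e p : valid_part n p -> (p.1 < 2 * n - 2)%N ->
  exists2 v', sigma n e p = (v' * s (node n e))%g & parabolic (gens_but n e) v'.
Proof.
move=> vp pn.
have dn j : (0 < j)%N -> down j = rev (iota 2 j.-1) ++ [:: 1%N].
  by case: j => // j _; rewrite /down /= rev_cons cats1.
have [z zE z_ge2] : exists2 z, segment1 n p = z ++ [:: 1%N] & all (fun i => 2 <= i <= n)%N z.
  case/(valid_part_cases hn): vp pn => [[pn' _] _|-> _|-> _|[pn' _] pn].
  - exists (rev (iota 2 p.1.-1)); first by rewrite segment1_low ?dn //; lia.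
    by apply/allP => i; rewrite mem_rev mem_iota; lia.
  - exists (rev (iota 2 (n - 1).-1)); first by rewrite segment1_b ?dn //; lia.
    by apply/allP => i; rewrite mem_rev mem_iota; lia.
  - exists (n :: rev (iota 2 (n - 2).-1)); first by rewrite segment1_c ?dn //; lia.
    by apply/allP => i; rewrite inE mem_rev mem_iota; lia.
  - exists (iota (2 * n - p.1 - 1) (p.1 - n + 1) ++ n :: rev (iota 2 (n - 2).-1)).
      by rewrite segment1_high ?dn -?catA //; lia.
    by apply/allP => i; rewrite mem_cat inE mem_rev !mem_iota; lia.
exists (wp (letters n (map (relabel n e) z))).
  by rewrite sigmaE zE map_cat letters_cat word_prod_cat /= word_prod1 node_relabel.
eexists; last by [].
rewrite !all_map; apply: sub_all z_ge2 => i /= iN; rewrite Jnode -node_relabel -val_eqE /=.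
have [le_in le1n] : (i <= n)%N /\ (1 <= n)%N by lia.
rewrite !inordK ?ltnS ?relabel_le // relabel_eq ?relabel_le // relabelK //; lia.
Qed.

(** The longest segment is out of reach of [sigma_ends], so a strictly dominant labeling is followed
    instead. This segment merely negates x_1 and x_n, hence the label N - x_1 - x_2 at the opposite
    end node is N + y_1 - y_2 in terms of the point y of u^-1, and y_1 - y_2 is a positive label
    because u is minimal. *)
Lemma sigma_top_ascent e u p : min_coset_rep (gens_but n (~~ e)) u ->
  valid_part n p -> p.1 = (2 * n - 2)%N ->
  (len (u * sigma n e p) < len (u * sigma n e p * s (node n (~~ e))))%N.
Proof.
move=> uJ vp pn; set v := sigma n e p; set f := node n (~~ e).
have [->//|down] := cox_length_Mgen f (u * v)%g.
(* At level 2n - 2, the point with n - k in place k has all labels equal to 1. *)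
pose N := (2 * n%:Z - 2 : int); pose rho : nat -> int := fun k => n%:Z - k%:Z.
have rho_gt0 (k : 'I_n.+1) : 0 < affD_conf e N rho k.
  have : (k <= n)%N by rewrite -ltnS.
  rewrite /affD_conf => /(relabel_le hn e); move: (relabel n e k) => i le_in.
  by rewrite /affD_root /N /rho; split_ifs; lia.
have := @cox_game_lt0 _ _ laced (affD_conf e N rho) (u * v)^-1%g f rho_gt0.
rewrite -(cox_lengthV (s f * _)%g) invgM invgK cox_genV cox_lengthV {1}down ltnSn => /(_ erefl).
rewrite invgM (cox_gameM laced).
have up : 0 < cox_game u^-1%g (affD_conf e N rho) (node n e).
  apply: (cox_game_gt0 laced) => //.
  rewrite -(cox_lengthV (s _ * _)%g) invgM invgK cox_genV cox_lengthV.
  by apply: (min_coset_rep_gt uJ); rewrite Jnode eq_sym node_neq.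
have [y yE] : exists y, cox_game u^-1%g (affD_conf e N rho) = affD_conf e N y.
  have [z <-] := word_prod_surj u^-1%g; rewrite (cox_gameE laced).
  pose ws := map (fun i : 'I_n.+1 => relabel n e i) z.
  have zE : z = letters n (map (relabel n e) ws) by rewrite letters_relabel.
  exists (affD_acts n N ws rho); rewrite zE game_conf //.
  by rewrite all_map; apply/allP => i _ /=; rewrite relabel_le // -ltnS.
rewrite yE in up *.
pose z := affD_acts n N (rev (segment1 n p)) y.
have vE : cox_game v^-1%g (affD_conf e N y) = affD_conf e N z.
  rewrite /v sigmaE -word_prod_rev (cox_gameE laced) /letters -map_rev -map_rev game_conf //.
  by rewrite all_rev segment1_le.
have yz : @affD_conf n e N y = affD_conf e N (affD_acts n N (segment1 n p) z).
  rewrite -(game_conf hn e N z (segment1_le vp)) -vE -(cox_gameE laced) -sigmaE -(cox_gameM laced).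
  by rewrite mulgV (cox_game1 laced).
have := affD_conf_inj hn yz; rewrite vE.
have pn' : (n <= p.1 <= 2 * n - 2)%N by lia.
move=> H; have := H 1%N; have := H 2%N; rewrite !acts_high //.
have := up; rewrite /affD_conf -{1}node_relabel inordK ?relabelK ?ltnS ?relabel_le; try lia.
have -> : relabel n e f = 0%N.
  have le_fn : (f <= n)%N by rewrite -ltnS.
  by have := relabel_node e (relabel_le hn e le_fn); rewrite relabelK // val_node // eqxx => /esym/eqP.
have N_gt0 : 0 < N by rewrite /N; lia.
by rewrite /affD_root pn; split_ifs; lia.
Qed.

(** Generators other than the two end nodes 0 and 1 are handled by the minimality of the rightmost
    segment. For the end node opposite to e, the two rightmost segments a decide: a^-1 moves
    [delta (node e)] by a single firing at node e, which does not reach the opposite end node, so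
    [min_coset_repM_ascent] applies. *)
Lemma chain_elt e ps : chain ps ->
  [/\ min_coset_rep (gens_but n e) (elt e ps), len (elt e ps) = sumn (map fst ps)
    & factors_as e (elt e ps) ps].
Proof.
have [k] := ubnP (size ps); elim: k ps e => // k IH [|p ps] e lek /=.
  by rewrite elt_nil cox_length1; split=> //; exact: min_coset_rep1.
case=> vp pq cps; have [uJ lenu fu] := IH ps (~~ e) lek cps.
have [vJ lenv] := sigma_min e vp; have vP := sigma_parabolic e vp.
have lenw : len (elt e (p :: ps)) = (p.1 + sumn (map fst ps))%N.
  by rewrite elt_cons (min_coset_repM uJ vP) lenu lenv addnC.
split=> //; last first.
  split.
    by move=> w1; move: lenw; rewrite w1 cox_length1; case: vp => /andP[]; lia.
  exists (elt (~~ e) ps), (sigma n e p); split; last by [].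
  by rewrite elt_cons; split=> //; exact: min_coset_repM uJ vP.
rewrite elt_cons; apply: min_coset_repP => i Ji.
have [iJ|] := boolP (i \in gens_but n (~~ e)).
  rewrite -mulgA (min_coset_repM uJ vP) (min_coset_repM uJ) ?ltn_add2l.
    exact: min_coset_rep_gt vJ Ji.
  exact: parabolicM vP (parabolic_gen _ iJ).
rewrite Jnode negbK => /eqP iE; rewrite {}iE in Ji *.
case: ps lek pq cps uJ lenu fu lenw => [|q ps] lek pq cps uJ lenu fu lenw.
  by rewrite elt_nil !mul1g; exact: min_coset_rep_gt vJ Ji.
have [pn|pn] := ltnP p.1 (2 * n - 2); last first.
  by apply: sigma_top_ascent => //; case: vp => /andP[]; lia.
case: cps => vq _ cps.
have [u'J _ _] := IH ps e (ltnW lek) cps.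
rewrite elt_cons negbK -(mulgA _ (sigma _ _ _)).
have aE : (sigma n (~~ e) q * sigma n e p)%g = elt e [:: p; q].
  by rewrite !elt_cons elt_nil mul1g.
apply: (min_coset_repM_ascent laced (Jnode e)) => //.
  by rewrite aE; apply: min_coset_rep_gt Ji; exact: elt_pair.
rewrite invgM (cox_gameM laced) (delta_parabolic laced (Jnode e)); last first.
  by apply: parabolicV; rewrite -{1}(negbK e); exact: sigma_parabolic.
have [v' -> v'J] := sigma_ends e vp pn.
rewrite invgM cox_genV (cox_gameM laced) (delta_parabolic laced (Jnode e)); last exact: parabolicV.
rewrite (cox_game_gen laced) /fire (negbTE (node_neq e)).
rewrite affD_matrix_adj; last by rewrite eq_sym node_neq.
rewrite /affD_adj !val_node // /affD_edge /delta (negbTE (node_neq e)).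
by case: ifP => //; case: (e) => /=; lia.
Qed.

Lemma factors_uniq e w ps ps' : factors_as e w ps -> factors_as e w ps' -> ps = ps'.
Proof.
elim: ps e w ps' => [|p ps IH] e w [|p' ps'] //=; first by move=> -> [].
  by move=> [w1 _] w1'.
move=> [_ [u [v [[wE uJ vJ _] [vp vE fu]]]]] [_ [u' [v' [[wE' u'J v'J _] [vp' vE' fu']]]]].
have [uu' vv'] : u = u' /\ v = v' by apply: parabolic_decomp_uniq uJ u'J vJ v'J _; rewrite -wE.
congr (_ :: _); first by apply: (sigma_inj (e := e)) => //; rewrite -vE vv'.
by apply: IH fu _; rewrite uu'.
Qed.

(** The two rightmost segments form a suffix, with additive lengths, of a minimal representative, so
    they are themselves minimal and their word is ascending; [asc_okpair] turns this into the
    condition on the two parts. *)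
Lemma factors_chain e w ps : min_coset_rep (gens_but n e) w -> factors_as e w ps ->
  w = elt e ps /\ chain ps.
Proof.
elim: ps e w => [|p ps IH] e w wJ /=; first by move=> ->; rewrite elt_nil.
move=> [_ [u [v [[wE uJ vP lenw] [vp vE fu]]]]].
have [uE cps] := IH _ _ uJ fu; split; first by rewrite elt_cons -uE -vE.
split=> //; case: ps {IH fu} uE cps => // q ps uE [vq qq cps].
have [u'J lenu' _] := chain_elt e cps.
have [_ lenu _] := @chain_elt (~~ e) (q :: ps) (And3 vq qq cps).
have [[vJ lenv] [v'J lenv']] := (sigma_min e vp, sigma_min (~~ e) vq).
pose a := elt e [:: p; q].
have aE : (sigma n (~~ e) q * sigma n e p)%g = a by rewrite /a !elt_cons elt_nil mul1g.
have wa : w = (elt e ps * a)%g by rewrite -aE wE uE vE elt_cons negbK mulgA.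
have lea : (len a <= q.1 + p.1)%N by rewrite -aE -lenv -lenv' cox_lengthM.
have lew := cox_lengthM (elt e ps) a.
have lenw' : len w = (sumn (map fst ps) + (q.1 + p.1))%N.
  by rewrite lenw vE lenv uE lenu /= addnA (addnC q.1).
rewrite -wa lenw' lenu' leq_add2l in lew.
have lena : len a = (q.1 + p.1)%N by apply/eqP; rewrite eqn_leq lea lew.
have aJ : min_coset_rep (gens_but n e) a.
  apply: (@min_coset_rep_suffix _ _ _ (elt e ps)); last by rewrite -wa.
  by rewrite -wa lenw' lena lenu'.
have le_pq : all (all (leq^~ n)) (map (segment1 n) [:: p; q]) by rewrite /= !segment1_le.
have lenE : len a = size (letters n (gword e (map (segment1 n) [:: p; q]))).
  by rewrite lena size_map size_gword /= !size_segment1 // addn0 addnC.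
have := @min_coset_rep_ascending _ _ laced _ _ (Jnode e) (letters n _) aJ lenE.
rewrite -(conf_base_point hn) ascending_gword //= acts_base_point // asc_okpair //.
by case/and3P.
Qed.

Lemma factors_exist e w : min_coset_rep (gens_but n e) w -> exists ps, factors_as e w ps.
Proof.
have [k] := ubnP (len w); elim: k w e => // k IH w e lek wJ.
have [->|/eqP w1] := eqVneq w 1%g; first by exists [::].
have [u [v [wE uJ vP lenw]]] := parabolic_decomp (gens_but n (~~ e)) w.
have vJ : min_coset_rep (gens_but n e) v.
  by apply: (@min_coset_rep_suffix _ _ _ u); rewrite -wE.
have [v1|[p vp vE]] := parabolic_min_sigma vP vJ.
  (* With v = 1 the element w would be minimal for both subgroups, and a right descent would have to
     be both end nodes at once. *)
  have [i down] := right_descent w1.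
  have : i \notin gens_but n e.
    by apply/negP => /(min_coset_rep_gt wJ); rewrite ltnNge ltnW.
  have : i \notin gens_but n (~~ e).
    by rewrite v1 mulg1 in wE; apply/negP => /(min_coset_rep_gt uJ); rewrite -wE ltnNge ltnW.
  by rewrite !Jnode !negbK => /eqP-> /eqP/esym/eqP; rewrite eq_sym (negbTE (node_neq e)).
have [|ps fu] := IH u (~~ e) _ uJ.
  rewrite -ltnS; apply: leq_trans lek; rewrite lenw vE (sigma_min e vp).2.
  by case: vp => /andP[]; lia.
by exists (p :: ps); split=> //; exists u, v.
Qed.

Lemma colored_partitionP w : min_coset_rep (gens_but n 0) w ->
  w = elt false (colored_partition w) /\ chain (colored_partition w).
Proof.
move=> wJ; apply: (@factors_chain false) => //.
have : exists ps, [set ps | factors_as false w ps]%classic ps by exact: (@factors_exist false).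
exact: xgetPex.
Qed.

Lemma colored_partition_elt ps : chain ps -> colored_partition (elt false ps) = ps.
Proof.
move=> cps; have [_ _ fps] := chain_elt false cps.
apply: (@factors_uniq false (elt false ps)) => //.
by apply: (@xgetPex _ _ [set ps0 | factors_as false (elt false ps) ps0]%classic); exists ps.
Qed.

Lemma elt_inj ps ps' : chain ps -> chain ps' -> elt false ps = elt false ps' -> ps = ps'.
Proof.
by move=> cps cps' e; rewrite -(colored_partition_elt cps) e colored_partition_elt.
Qed.

End Chains.

(** * Palindromic Poincaré polynomials *)

Section Palindromic.
Local Open Scope ring_scope.
Variable n : nat.
Implicit Types (u v w : affD n) (r : seq (affD n)).

(** Finiteness: the interval consists of products of words no longer than the length of w. Without
    it the sum defining [poincare] would take its default value 0. *)
Lemma lower_interval_enum w :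
  exists2 r, uniq r & forall v, v \in r <-> lower_interval w v.
Proof.
pose wordsn k := [seq tval t | t : k.-tuple 'I_n.+1].
pose r : seq (affD n) := flatten [seq map (word_prod (@affD_matrix n)) (wordsn k) | k <- iota 0 (cox_length w).+1].
exists (undup [seq v <- r | `[< lower_interval w v >]]); first exact: undup_uniq.
move=> v; rewrite mem_undup mem_filter; split=> [/andP[/asboolP]//|vw].
apply/andP; split; first exact/asboolP.
have [x sx xv] := cox_length_witness v.
apply/flattenP; exists (map (word_prod (@affD_matrix n)) (wordsn (size x))).
  apply/mapP; exists (size x) => //; rewrite mem_iota /= sx add0n ltnS.
  by case: vw => _; exact: bruhat_length.
rewrite -xv; apply: map_f; apply/mapP; exists (in_tuple x) => //.
by rewrite mem_enum.
Qed.

Lemma poincare_coef w : exists2 r, uniq r /\ (forall v, v \in r <-> lower_interval w v)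
  & forall i, (poincare w)`_i = (count (fun v => cox_length v == i) r)%:R.
Proof.
have [r ur rP] := lower_interval_enum w; exists r => // i.
rewrite /poincare (_ : lower_interval w = [set` r]%classic); last first.
  by apply/seteqP; split=> v /rP.
rewrite -fsbig_seq // coef_sum -sum1_count natr_sum [RHS]big_mkcond /=.
by apply: eq_bigr => v _; rewrite coefXn eq_sym; case: eqP.
Qed.

Lemma involution_palindromic w (c : affD n -> affD n) :
  (forall v, lower_interval w v -> [/\ lower_interval w (c v), c (c v) = v
     & (cox_length (c v) + cox_length v = cox_length w)%N]) -> palindromic w.
Proof.
move=> cP; have [r [ur rP] coefE] := poincare_coef w.
move=> i le_iw; rewrite !coefE; congr (_%:R).
have perm_r : perm_eq r (map c r).
  apply: uniq_perm => //.
    by rewrite map_inj_in_uniq // => u v /rP/cP[_ cu _] /rP/cP[_ cv _] cuv; rewrite -cu cuv cv.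
  move=> v; apply/idP/mapP=> [/rP vw|[u /rP uw ->]]; last by apply/rP; case: (cP u uw).
  by have [cvw cc _] := cP v vw; exists (c v) => //; apply/rP.
rewrite (permP perm_r) count_map; apply: eq_in_count => v /rP/cP[_ _ /= lens].
by apply/eqP/eqP; lia.
Qed.

Lemma not_palindromic w v1 v2 k : (k <= cox_length w)%N ->
  lower_interval w v1 -> lower_interval w v2 -> v1 <> v2 ->
  (cox_length v1 + k = cox_length w)%N -> (cox_length v2 + k = cox_length w)%N ->
  (forall u v, lower_interval w u -> lower_interval w v ->
    cox_length u = k -> cox_length v = k -> u = v) -> ~ palindromic w.
Proof.
move=> le_kw v1w v2w v12 len1 len2 uniqk /(_ k le_kw).
have [r [ur rP] ->] := poincare_coef w; have [r' [ur' rP'] ->] := poincare_coef w.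
move/eqP; rewrite eqr_nat => /eqP eqc.
have le1 : (count (fun v => cox_length v == k) r <= 1)%N.
  rewrite -size_filter; case E: (filter _ r) => [|u [|v l]] //.
  have : uniq (filter (fun v => cox_length v == k) r) by rewrite filter_uniq.
  have inr z : z \in filter (fun v => cox_length v == k) r -> lower_interval w z /\ cox_length z = k.
    by rewrite mem_filter => /andP[/eqP ? /rP].
  have [|uw lu] := inr u; first by rewrite E mem_head.
  have [|vw lv] := inr v; first by rewrite E !inE eqxx orbT.
  by rewrite E /= inE (uniqk u v) // eqxx.
have le2 : (2 <= count (fun v => cox_length v == (cox_length w - k)%N) r')%N.
  rewrite -size_filter; apply: (@uniq_leq_size _ [:: v1; v2]).
    by rewrite /= inE andbT; apply/eqP.
  move=> v; rewrite !inE mem_filter => /orP[]/eqP->; apply/andP; split; try exact/rP'.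
    by rewrite -len1 addnK.
  by rewrite -len2 addnK.
by move: le2; rewrite -eqc ltnNge le1.
Qed.

End Palindromic.

(** * One-row shapes *)

Definition deletion (T : Type) (x y : seq T) : Prop :=
  exists a i b, y = a ++ i :: b /\ x = a ++ b.

Lemma deletion_ctx (T : Type) (l r x y : seq T) :
  deletion x y -> deletion (l ++ x ++ r) (l ++ y ++ r).
Proof. by move=> [a [i [b [-> ->]]]]; exists (l ++ a), i, (b ++ r); rewrite -!catA. Qed.

Lemma deletion_map (T U : Type) (f : T -> U) (x y : seq T) :
  deletion x y -> deletion (map f x) (map f y).
Proof. by move=> [a [i [b [-> ->]]]]; exists (map f a), (f i), (map f b); rewrite !map_cat. Qed.

Lemma deletion_behead (T : Type) (i : T) (x : seq T) : deletion x (i :: x).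
Proof. by exists [::], i, x. Qed.

Section LowerIntervals.
Local Open Scope ring_scope.
Variables (n : nat) (hn : (4 <= n)%N).
Implicit Types (e : bool) (p q : part) (ps : seq part) (ss : seq (seq nat)) (z : color)
  (j k : nat) (sh : seq nat).

Local Notation M := (@affD_matrix n).
Local Notation len w := (@cox_length _ M w%g).
Local Notation elt := (elt n false).
Local Notation chain := (chain n).
Implicit Types u v w : affD n.

Lemma deletion_gword e l s s' r : deletion s' s ->
  deletion (gword n e (l ++ s' :: r)) (gword n e (l ++ s :: r)).
Proof.
elim: l e => [|s1 l IH] e d /=.
  by have := deletion_ctx (gword n (~~ e) r) [::] (deletion_map (relabel n e) d); rewrite !cats0.
exact: (deletion_ctx [::] _ (IH (~~ e) d)).
Qed.

Lemma deletion_gword_rcons e l i : deletion (gword n e l) (gword n e (l ++ [:: [:: i]])).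
Proof.
elim: l e => [|s1 l IH] e /=; first exact: deletion_behead.
exact: (deletion_ctx [::] _ (IH (~~ e))).
Qed.

Lemma gelt_bruhat e ss ss' : deletion (gword n e ss') (gword n e ss) ->
  (len (gelt n e ss') < len (gelt n e ss))%N -> bruhat_le (gelt n e ss') (gelt n e ss).
Proof.
move=> /(deletion_map (inord : nat -> 'I_n.+1))[a [i [b [eq1 eq2]]]].
by rewrite /gelt /letters eq1 eq2; exact: bruhat_delete.
Qed.

Lemma elt_bruhat ps ps' : chain ps -> chain ps' ->
  deletion (gword n false (map (segment1 n) ps')) (gword n false (map (segment1 n) ps)) ->
  (sumn (map fst ps') < sumn (map fst ps))%N -> bruhat_le (elt ps') (elt ps).
Proof.
move=> cps cps' d lt; apply: gelt_bruhat => //.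
have [_ l1 _] := chain_elt hn false cps; have [_ l2 _] := chain_elt hn false cps'.
by rewrite [ltnLHS]l2 [ltnRHS]l1.
Qed.

Lemma elt_lower_interval ps ps' : chain ps' -> bruhat_le (elt ps') (elt ps) ->
  lower_interval (elt ps) (elt ps').
Proof. by move=> cps' le; split=> //; case: (chain_elt hn false cps'). Qed.

(** The letter to delete is the leading one, except when a part n shrinks to color b: the segment of
    n begins with n - 1, n, of which b keeps the first and c the second. *)
Lemma segment_deletion p q : valid_part n p -> valid_part n q -> p.1 = q.1.+1 ->
  deletion (segment1 n q) (segment1 n p).
Proof.
move=> vp vq pq; case/(valid_part_cases hn): vp pq => [[pn p2] pq|->/= pq|->/= pq|[pn p2] pq].
- rewrite !segment1_low ?pq; try lia.
  by rewrite downS; exact: deletion_behead.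
- rewrite segment1_b // (segment1_low (p := q)); last by lia.
  by rewrite pq downS; exact: deletion_behead.
- rewrite segment1_c // (segment1_low (p := q)); last by lia.
  by rewrite (_ : q.1 = (n - 2)%N); [exact: deletion_behead | lia].
- have [pE|ne] := eqVneq p.1 n; last first.
    rewrite !segment1_high; try lia.
    rewrite (_ : p.1 - n + 1 = (q.1 - n + 1).+1)%N /=; last by lia.
    rewrite (_ : (2 * n - p.1 - 1).+1 = 2 * n - q.1 - 1)%N; last by lia.
    exact: deletion_behead.
  rewrite (segment1_high hn (p := p)); last by lia.
  rewrite pE (_ : n - n + 1 = 1)%N /=; last by lia.
  rewrite (_ : 2 * n - n - 1 = n - 1)%N; last by lia.
  case/(valid_part_cases hn): vq pq => [[]|->|->|[]]; try lia; move=> _.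
    rewrite segment1_b // [X in down X](_ : (n - 1)%N = (n - 2).+1) ?downS; try lia.
    by exists [:: (n - 1)%N], n, (down (n - 2)); split=> //=; congr (_ :: _); lia.
  by rewrite segment1_c //; exact: deletion_behead.
Qed.

Lemma part_pred p : valid_part n p -> (1 < p.1)%N -> exists2 q, valid_part n q & p.1 = q.1.+1.
Proof.
move=> vp p1; have [pN|pN] := eqVneq p.1 n.
  by exists ((n - 1)%N, Some color_b); [exact: valid_mid | rewrite /=; lia].
have [pN'|pN'] := leqP p.1 (n - 1)%N.
  by exists ((p.1 - 1)%N, None); [apply: valid_low => //; lia | rewrite /=; lia].
exists ((p.1 - 1)%N, None); last by rewrite /=; lia.
by case: vp => /andP[_ pn] _; apply: valid_high => //; lia.
Qed.

Lemma row_bruhat p q : valid_part n p -> valid_part n q -> (q.1 < p.1)%N ->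
  bruhat_le (elt [:: q]) (elt [:: p]).
Proof.
have [k] := ubnP p.1; elim: k p => // k IH p lek vp vq qp.
have step r : valid_part n r -> p.1 = r.1.+1 -> bruhat_le (elt [:: r]) (elt [:: p]).
  move=> vr pr; apply: elt_bruhat => //=; last by lia.
  by rewrite !/gword /=; apply: deletion_map; exact: segment_deletion.
have [pq|pq] := eqVneq p.1 q.1.+1; first exact: step.
have [|r vr pr] := part_pred vp; first by case: vq => /andP[]; lia.
by apply: bruhat_trans (step r vr pr); apply: IH => //; lia.
Qed.

Lemma row_bruhat1 p : valid_part n p -> bruhat_le (elt [::]) (elt [:: p]).
Proof.
move=> vp; have v1 : valid_part n (1%N, None) by apply: valid_low => //; lia.
have le1 : bruhat_le (elt [::]) (elt [:: (1%N, None)]).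
  apply: elt_bruhat => //=; rewrite /= segment1_low /=; last by lia.
  exact: deletion_behead.
have [p1|p1] := leqP p.1 1; last by apply: bruhat_trans le1 _; exact: row_bruhat.
suff -> : p = (1%N, None) by [].
case: p vp p1 => j c [/= /andP[j1 _] cP] p1; have jE : j = 1%N by lia.
rewrite jE; congr (_, _); case: c cP => // c [+ _] => /(_ ltac:(by [])); lia.
Qed.

(** Everything below an element of W_S' stays in W_S', where the nontrivial minimal representatives
    are single segments; at equal length a Bruhat relation is an equality, which separates the two
    colors. *)
Lemma row_lower_interval p v : valid_part n p -> lower_interval (elt [:: p]) v ->
  v = elt [::] \/ exists q, [/\ valid_part n q, v = elt [:: q] & (q.1 < p.1)%N \/ q = p].
Proof.
move=> vp [vJ vp_le].
have eltE q : elt [:: q] = sigma n false q by rewrite elt_cons elt_nil mul1g.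
have vP : parabolic (gens_but n 1) v.
  apply: (bruhat_parabolic vp_le).
  by have := sigma_parabolic hn false vp; rewrite -eltE.
have [->|[q vq vE]] := parabolic_min_sigma hn (e := false) vP vJ.
  by left; rewrite elt_nil.
right; exists q; split; [by [] | by rewrite eltE |].
have := bruhat_length vp_le; rewrite eltE vE.
have [_ [_ lp]] := (vq, sigma_min hn false vp); have [_ lq] := sigma_min hn false vq.
rewrite [leqLHS]lq [leqRHS]lp leq_eqVlt => /orP[/eqP qp|]; last by left.
right; apply: (sigma_inj hn (e := false)) => //; rewrite -vE -eltE.
by apply: bruhat_eq vp_le _; rewrite vE eltE [LHS]lq [RHS]lp.
Qed.

Lemma chain1 p : valid_part n p -> chain [:: p].
Proof. by []. Qed.

Lemma row_palindromic p : valid_part n p -> (p.1 <= n - 1)%N \/ p.1 = (2 * n - 2)%N ->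
  palindromic (elt [:: p]).
Proof.
move=> vp pn.
(* Complementation of lengths, with the empty shape opposite to p. A part n - 1 lies properly below
   p only for p.1 = 2n - 2, where its length is its own complement; both colors are kept fixed. *)
pose rowc ps := if ps is q :: _ then if q == p then [::] else
  if q.1 == (n - 1)%N then [:: q] else [:: ((p.1 - q.1)%N, None)] else [:: p].
apply: (involution_palindromic (c := fun v => elt (rowc (colored_partition v)))) => v.
have lenE ps : chain ps -> len (elt ps) = sumn (map fst ps).
  by move=> cps; case: (chain_elt hn false cps).
have p1 : (1 <= p.1)%N by case: vp => /andP[].
case/(row_lower_interval vp) => [->|[q [vq -> qp]]].
  rewrite colored_partition_elt //= colored_partition_elt //= eqxx !lenE //=.
  split; [by apply: elt_lower_interval; last exact: bruhat_refl | by [] | by lia].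
have q1 : (1 <= q.1)%N by case: vq => /andP[].
rewrite colored_partition_elt //=; case: eqP => [->|/eqP ne_qp].
  rewrite colored_partition_elt //= !lenE //=.
  split; [by apply: elt_lower_interval; last exact: row_bruhat1 | by [] | by lia].
have lt_qp : (q.1 < p.1)%N by case: qp => // qp; rewrite qp eqxx in ne_qp.
case: eqP => [qn|/eqP qn].
  rewrite colored_partition_elt //= (negbTE ne_qp) qn eqxx !lenE //=.
  split; [by apply: elt_lower_interval; last exact: row_bruhat | by [] | by lia].
set q' := ((p.1 - q.1)%N, None).
have vq' : valid_part n q'.
  case: pn => pn; first by apply: valid_low => //; lia.
  have [le|gt] := leqP q.1 (n - 2)%N; [apply: valid_high => // | apply: valid_low => //]; lia.
have q2 : q.2 = None by case: vq qn => _ [H _]; case: q.2 H => // c H /eqP; case; apply: H.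
rewrite colored_partition_elt //= (_ : (q' == p) = false); last first.
  by apply/eqP => /(congr1 fst) /=; lia.
rewrite (_ : (p.1 - q.1 == n - 1)%N = false); last by case: pn; lia.
rewrite !lenE //=; split; [ | | by lia].
  by apply: elt_lower_interval => //; apply: row_bruhat => //=; lia.
by congr (elt [:: _]); rewrite [RHS]surjective_pairing q2 /q' /=; congr (_, _); lia.
Qed.

(** The length complementary to n - 1 is p.1 - (n - 1), at most n - 2, and only one part has that
    size; for p.1 = 2n - 2 it would be n - 1 itself. *)
Lemma row_not_palindromic p : valid_part n p -> (n <= p.1 <= 2 * n - 3)%N ->
  ~ palindromic (elt [:: p]).
Proof.
move=> vp pn.
have lenE ps : chain ps -> len (elt ps) = sumn (map fst ps).
  by move=> cps; case: (chain_elt hn false cps).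
have vmid c := valid_mid hn c.
apply: (@not_palindromic _ _ (elt [:: ((n - 1)%N, Some color_b)])
  (elt [:: ((n - 1)%N, Some color_c)]) (p.1 - (n - 1))%N).
- by rewrite lenE //=; lia.
- by apply: elt_lower_interval => //; apply: row_bruhat => //=; lia.
- by apply: elt_lower_interval => //; apply: row_bruhat => //=; lia.
- by move/(elt_inj hn (chain1 (vmid _)) (chain1 (vmid _))).
- by rewrite !lenE //=; lia.
- by rewrite !lenE //=; lia.
move=> u v /(row_lower_interval vp)[->|[q [vq -> _]]] /(row_lower_interval vp)[->|[q' [vq' -> _]]];
  rewrite !lenE //=; try lia.
move=> qE q'E; congr (elt [:: _]).
have None2 r : valid_part n r -> (r.1 < n - 1)%N -> r = (r.1, None).
  by case: r => j [c|] // [_ [H _]] /=; have := H ltac:(by []); rewrite /=; lia.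
have [lq lq'] : (q.1 < n - 1 /\ q'.1 < n - 1)%N by lia.
by rewrite [LHS](None2 q vq lq) [RHS](None2 q' vq' lq'); congr (_, _); lia.
Qed.

End LowerIntervals.

(** * Staircases *)

Section StrictShapes.
Implicit Types (j k : nat) (sh : seq nat).
Local Open Scope nat_scope.

Definition strict_shape k sh :=
  sorted (fun a b => b < a) sh && all (fun j => 1 <= j <= k) sh.

Lemma staircaseS k : staircase k.+1 = k.+1 :: staircase k.
Proof. exact: downS. Qed.

Lemma mem_staircase k j : (j \in staircase k) = (1 <= j <= k).
Proof. by rewrite mem_rev mem_iota add1n ltnS. Qed.

Let gt_trans : transitive (fun a b : nat => b < a).
Proof. by move=> b a c ab bc; exact: ltn_trans bc ab. Qed.

Lemma strict_shape_cons k j sh :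
  strict_shape k (j :: sh) = (1 <= j <= k) && strict_shape j.-1 sh.
Proof.
rewrite /strict_shape /= (path_sortedE gt_trans); apply/idP/idP.
  case/andP=> /andP[ltj ->] /andP[-> /allP shk] /=; apply/allP => i ish.
  by have := shk i ish; have := allP ltj i ish; lia.
case/andP=> jk /andP[-> /allP shj]; rewrite jk !andbT /=.
by apply/andP; split; apply/allP => i /shj; lia.
Qed.

Lemma strict_shape_leq k k' sh : k <= k' -> strict_shape k sh -> strict_shape k' sh.
Proof.
by move=> kk' /andP[srt /allP shk]; rewrite /strict_shape srt; apply/allP => i /shk; lia.
Qed.

Lemma strict_staircase k : strict_shape k (staircase k).
Proof. by elim: k => // k IH; rewrite staircaseS strict_shape_cons leqnn. Qed.

Lemma strict_filter a k : strict_shape k (filter a (staircase k)).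
Proof.
have /andP[srt /allP shk] := strict_staircase k; apply/andP; split.
  exact: sorted_filter.
by apply/allP => j; rewrite mem_filter => /andP[_ /shk].
Qed.

Lemma strict_shapeE k sh : strict_shape k sh -> [seq j <- staircase k | j \in sh] = sh.
Proof.
move=> str; have /andP[srt /allP shk] := str.
have /andP[srt' _] := strict_filter (mem sh) k.
apply: (irr_sorted_eq gt_trans) => //; first by move=> j; rewrite ltnn.
by move=> j; rewrite mem_filter mem_staircase andb_idr // => /shk.
Qed.

Definition shape_compl k sh := [seq j <- staircase k | j \notin sh].

Lemma shape_complK k sh : strict_shape k sh -> shape_compl k (shape_compl k sh) = sh.
Proof.
move=> str; rewrite -[RHS](strict_shapeE str); apply: eq_in_filter => j jk.
by rewrite mem_filter jk andbT negbK.
Qed.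

Lemma sumn_shape_compl k sh : strict_shape k sh ->
  sumn (shape_compl k sh) + sumn sh = sumn (staircase k).
Proof.
move=> str; rewrite -{2}(strict_shapeE str) !sumnE !big_filter addnC.
by rewrite [RHS](bigID (mem sh)).
Qed.

End StrictShapes.

Section Staircases.
Local Open Scope ring_scope.
Variables (n : nat) (hn : (4 <= n)%N).
Implicit Types (e : bool) (p q : part) (ps : seq part) (z : color) (j k : nat) (sh : seq nat).

Local Notation M := (@affD_matrix n).
Local Notation len w := (@cox_length _ M w%g).
Local Notation elt := (elt n false).
Local Notation chain := (chain n).
Local Notation segs ps := (map (segment1 n) ps).
Implicit Types u v w : affD n.

Lemma valid_color z j : (1 <= j <= n - 1)%N ->
  valid_part n (j, if j == (n - 1)%N then Some z else None).
Proof.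
move=> jn; case: eqP => [->|]; first exact: valid_mid.
by move=> ?; apply: valid_low => //; lia.
Qed.

Lemma color_shape_fst z sh : map fst (color_shape n z sh) = sh.
Proof. by rewrite /color_shape -map_comp map_id. Qed.

Lemma chain_color z k sh : (k <= n - 1)%N -> strict_shape k sh -> chain (color_shape n z sh).
Proof.
elim: sh k => // j sh IH k kn; rewrite strict_shape_cons => /andP[jk str].
split; [by apply: valid_color; lia | | by apply: IH str; lia].
case: sh str {IH} => // i sh; rewrite strict_shape_cons => /andP[ij _] /=.
by rewrite /okpair /=; apply/orP; left; lia.
Qed.

(** Parts that already agree with the staircase are skipped; the first one that falls short can be
    raised by 1, since what precedes it leaves room, and a shape that merely ends too early receives
    a new part 1. *)
Lemma strict_incr z k sh : (k <= n - 1)%N -> strict_shape k sh -> sh <> staircase k ->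
  exists sh', [/\ strict_shape k sh', sumn sh' = (sumn sh).+1 &
    forall e, deletion (gword n e (segs (color_shape n z sh)))
                       (gword n e (segs (color_shape n z sh')))].
Proof.
elim: k sh => [|k IH] [|j sh] kn //.
- by rewrite strict_shape_cons; lia.
- move=> _ _; exists [:: 1%N]; split=> // e.
  rewrite /= segment1_low /=; last by lia.
  exact: deletion_behead.
rewrite strict_shape_cons => /andP[jk str] ne.
have [lt_jk|ge_jk] := ltnP j k.+1.
  exists (j.+1 :: sh); split=> //.
    by rewrite strict_shape_cons lt_jk /=; apply: strict_shape_leq str; lia.
  move=> e; apply: (@deletion_gword n e [::]).
  by apply: segment_deletion => //; apply: valid_color; lia.
have jE : j = k.+1 by lia.
rewrite {}jE /= in str ne *.
have [|sh' [str' sum' del']] := IH sh (ltnW kn) str.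
  by move=> shE; apply: ne; rewrite shE staircaseS.
exists (k.+1 :: sh'); split; first by rewrite strict_shape_cons leqnn.
  by rewrite /= sum' addnS.
by move=> e; exact: (deletion_ctx [::] _ (del' (~~ e))).
Qed.

Lemma staircase_bruhat z k sh : (k <= n - 1)%N -> strict_shape k sh ->
  bruhat_le (elt (color_shape n z sh)) (elt (color_shape n z (staircase k))).
Proof.
move=> kn; have [d] := ubnP (sumn (shape_compl k sh)).
elim: d sh => // d IH sh led str.
have [->|/eqP ne] := eqVneq sh (staircase k); first exact: bruhat_refl.
have [sh' [str' sum' del']] := strict_incr z kn str ne.
have := sumn_shape_compl str; have := sumn_shape_compl str' => s1 s2.
apply: bruhat_trans (IH sh' _ str'); last by lia.
apply: (elt_bruhat hn) => //; try exact: chain_color kn _.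
by rewrite !color_shape_fst sum'.
Qed.

Lemma relabel_low e k i : (1 <= i <= k)%N -> (k <= n - 2)%N -> (relabel n e i <= k)%N.
Proof. by move=> ik kn; case: e; rewrite /relabel ?/swap_ends; split_ifs; lia. Qed.

Lemma color_letters e z k sh : (k <= n - 2)%N -> strict_shape k sh ->
  all (leq^~ k) (gword n e (segs (color_shape n z sh))).
Proof.
move=> kn /andP[_]; elim: sh e => //= j sh IH e /andP[jk shk].
rewrite all_cat IH // segment1_low /=; last by lia.
by rewrite all_map; apply/allP => i; rewrite mem_rev mem_iota /= => ij; apply: (@relabel_low e k); lia.
Qed.

(* For k = n - 1 the support misses one generator: the labels of the first row
   are swapped, so that color b stands for s_n there. *)
Definition staircase_support k z : pred nat := fun i =>
  if (k <= n - 2)%N then (i <= k)%N else i != (if z is color_b then (n - 1)%N else n).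

Lemma staircase_letters k z : (k <= n - 1)%N ->
  all (staircase_support k z) (gword n false (segs (color_shape n z (staircase k)))).
Proof.
move=> kn; rewrite /staircase_support; have [kn'|kn'] := leqP k (n - 2).
  by apply: color_letters => //; exact: strict_staircase.
have -> : k = (n - 2).+1 by lia.
have low i : (i <= n - 2)%N -> i != (if z is color_b then (n - 1)%N else n).
  by case: z; lia.
rewrite staircaseS /= all_cat (_ : (n - 2).+1 = (n - 1)%N) ?eqxx; last by lia.
apply/andP; split.
  apply: sub_all (color_letters true z (leqnn _) (strict_staircase _)) => i; exact: low.
have dn : all (fun i => i != (if z is color_b then (n - 1)%N else n)) (map (relabel n false) (down (n - 2))).
  rewrite all_map; apply/allP => i; rewrite mem_rev mem_iota /= => ij.
  by apply: low; apply: (@relabel_low false (n - 2)); lia.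
case: z {low} dn => dn.
  rewrite segment1_b // (_ : (n - 1)%N = (n - 2).+1); last by lia.
  rewrite downS /= (_ : (n - 2).+1 = (n - 1)%N) ?dn ?andbT; last by lia.
  by rewrite /relabel /swap_ends; split_ifs; lia.
rewrite segment1_c //= dn andbT.
by rewrite /relabel /swap_ends; split_ifs; lia.
Qed.

Lemma low_part z p : valid_part n p -> (p.1 <= n - 2)%N ->
  p = (p.1, if p.1 == (n - 1)%N then Some z else None).
Proof.
case/(valid_part_cases hn) => [[pn p2] _|->/=|->/=|[]]; try lia.
rewrite [LHS]surjective_pairing p2; case: eqP => //; lia.
Qed.

Lemma chain_low z p ps : chain (p :: ps) -> (p.1 <= n - 2)%N ->
  p :: ps = color_shape n z (map fst (p :: ps)) /\ strict_shape p.1 (map fst (p :: ps)).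
Proof.
elim: ps p => [|q ps IH] p [vp pq cps] pn; have p1 : (1 <= p.1)%N by case: vp => /andP[].
  by split; [rewrite /= -low_part | rewrite strict_shape_cons leqnn p1].
have qp : (q.1 < p.1)%N by move: pq; rewrite /okpair; case/orP=> // /andP[]; lia.
have [qE strq] := IH q cps ltac:(lia).
split; first by rewrite [in LHS]qE [in LHS](low_part z vp pn).
rewrite [map _ _]/= strict_shape_cons leqnn p1 /=.
by apply: strict_shape_leq strq; lia.
Qed.

(** A first part that is too large would use a letter outside the support: its own leading letter if
    it is at most n - 2, one of n - 1, n otherwise. For k = n - 1 the support also fixes the color,
    and since the labels alternate between segments, a second part n - 1 of the same color would
    need exactly the missing letter. *)
Lemma staircase_support_chain k z ps : (1 <= k <= n - 1)%N -> chain ps ->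
  all (staircase_support k z) (gword n false (segs ps)) ->
  ps = color_shape n z (map fst ps) /\ strict_shape k (map fst ps).
Proof.
move=> kn; case: ps => [//|p ps] cps; have [vp pq cps'] := cps.
rewrite /= all_cat => /andP[supp' /allP supp].
have suppi i : i \in segment1 n p -> staircase_support k z (relabel n false i).
  by move=> ip; apply: supp; exact: map_f.
have dn i j : (1 <= i <= j)%N -> i \in down j by rewrite mem_rev mem_iota; lia.
have swN1 : relabel n false (n - 1) = n by rewrite /relabel /swap_ends; split_ifs; lia.
have swN : relabel n false n = (n - 1)%N by rewrite /relabel /swap_ends; split_ifs; lia.
have [pn|pn] := leqP p.1 (n - 2)%N.
  have [pE strp] := chain_low z cps pn; split=> //.
  apply: strict_shape_leq strp; have [kn'|kn'] := leqP k (n - 2); last by lia.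
  have := suppi p.1; rewrite segment1_low // dn; last by case: vp => /andP[]; lia.
  move/(_ isT); rewrite /staircase_support kn' /relabel /swap_ends.
  by split_ifs; lia.
have suppN : (n \in segment1 n p) -> (n - 1)%N \in segment1 n p -> False.
  move=> /suppi + /suppi; rewrite swN swN1 /staircase_support.
  by case: ifP => ?; [lia | case: (z) => /eqP ? /eqP ?].
case/(valid_part_cases hn): vp pn suppi suppN => [[]|pE|pE|[pn' _]] pn suppi suppN; try lia.
- have := suppi (n - 1)%N; rewrite pE segment1_b // dn; last by lia.
  move/(_ isT); rewrite swN1 /staircase_support; case: ifP => kn'; first by lia.
  case: z supp' supp {suppi} => supp' supp; last by rewrite eqxx.
  move=> _; have kE : k = (n - 1)%N by lia.
  case: ps cps pq cps' supp' => [|q ps] cps pq cps' supp'.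
    by split; [rewrite /= eqxx | rewrite [map _ _]/= strict_shape_cons /strict_shape /=; lia].
  have [qn|qn] := leqP q.1 (n - 2)%N.
    have [qE strq] := chain_low color_b cps' qn.
    split; first by rewrite [in LHS]qE /= eqxx.
    rewrite [map _ _]/= strict_shape_cons /= kE leqnn; apply/andP; split; first lia.
    by apply: strict_shape_leq strq; lia.
  have qE : q = ((n - 1)%N, Some color_b).
    move: pq; rewrite pE /okpair /=; case/orP=> [|/andP[/eqP //]]; lia.
  move: supp'; rewrite /= all_cat => /andP[_ /allP supp2].
  have : staircase_support k color_b (relabel n true (n - 1)).
    by apply: supp2; apply: (map_f (relabel n true)); rewrite qE segment1_b // dn //; lia.
  by rewrite /staircase_support kn' /relabel eqxx.
- have := suppi n; rewrite pE segment1_c // mem_head => /(_ isT).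
  rewrite swN /staircase_support; case: ifP => kn'; first by lia.
  case: z supp' supp {suppi} => supp' supp; first by rewrite eqxx.
  move=> _; have kE : k = (n - 1)%N by lia.
  case: ps cps pq cps' supp' => [|q ps] cps pq cps' supp'.
    by split; [rewrite /= eqxx | rewrite [map _ _]/= strict_shape_cons /strict_shape /=; lia].
  have [qn|qn] := leqP q.1 (n - 2)%N.
    have [qE strq] := chain_low color_c cps' qn.
    split; first by rewrite [in LHS]qE /= eqxx.
    rewrite [map _ _]/= strict_shape_cons /= kE leqnn; apply/andP; split; first lia.
    by apply: strict_shape_leq strq; lia.
  have qE : q = ((n - 1)%N, Some color_c).
    move: pq; rewrite pE /okpair /=; case/orP=> [|/andP[/eqP //]]; lia.
  move: supp'; rewrite /= all_cat => /andP[_ /allP supp2].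
  have : staircase_support k color_c (relabel n true n).
    by apply: supp2; apply: (map_f (relabel n true)); rewrite qE segment1_c // mem_head.
  by rewrite /staircase_support kn' /relabel eqxx.
- case: suppN; rewrite segment1_high // ?mem_cat ?mem_head ?orbT //; try lia.
  by rewrite mem_iota; lia.
Qed.

Lemma gword_le e ss : all (all (leq^~ n)) ss -> all (leq^~ n) (gword n e ss).
Proof.
elim: ss e => //= s1 ss IH e /andP[le1 le_ss]; rewrite all_cat IH //= all_map.
by apply: sub_all le1 => i; exact: relabel_le.
Qed.

(** The interval stays in the parabolic subgroup of the support. The word of v given by its colored
    partition is reduced, so all its letters lie in the support, and this restricts the parts. *)
Lemma staircase_lower_interval k z v : (1 <= k <= n - 1)%N ->
  lower_interval (elt (color_shape n z (staircase k))) v ->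
  exists2 sh, strict_shape k sh & v = elt (color_shape n z sh).
Proof.
move=> kn [vJ vw]; have kn' : (k <= n - 1)%N by lia.
pose J : {pred 'I_n.+1} := [pred i : 'I_n.+1 | staircase_support k z i].
have JE ps : chain ps -> all (mem J) (letters n (gword n false (segs ps))) =
    all (staircase_support k z) (gword n false (segs ps)).
  move=> cps; rewrite all_map; apply: eq_in_all => i ips.
  rewrite /= inE /= inordK // ltnS.
  exact: (allP (gword_le false (segments_le hn (chain_valid cps)))).
have vP : parabolic J v.
  apply: (bruhat_parabolic vw); eexists; last by [].
  rewrite JE; first exact: staircase_letters.
  by apply: chain_color kn' _; exact: strict_staircase.
have [vE cps] := colored_partitionP hn vJ.
have [_ lenE _] := chain_elt hn false cps.
have := @reduced_word_letters _ M J (letters n (gword n false (segs (colored_partition v))))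
  (cox_gen_inj (affD_laced n)).
rewrite JE // => supp.
have [|||psE str] := @staircase_support_chain k z (colored_partition v) => //; last first.
  by exists (map fst (colored_partition v)); rewrite -?psE.
apply: supp; last by move: vP; rewrite {1}vE.
rewrite [RHS]lenE size_map size_gword -map_comp; congr sumn.
by apply/eq_in_map => p /(chain_valid cps)/(size_segment1 hn).
Qed.

Lemma staircase_palindromic k z : (k <= n - 1)%N ->
  palindromic (elt (color_shape n z (staircase k))).
Proof.
move=> kn; have [->|k0] := posnP k.
  apply: (involution_palindromic (c := id)) => v vw; split=> //.
  case: vw => _ /bruhat_length; rewrite [elt _]elt_nil cox_length1 leqn0 => /eqP ->.
  by [].
apply: (involution_palindromic (c := fun v =>
  elt (color_shape n z (shape_compl k (underlying_shape (colored_partition v)))))) => v.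
case/staircase_lower_interval; first by rewrite k0.
move=> sh str ->.
have cc sh' : strict_shape k sh' -> chain (color_shape n z sh') by exact: chain_color.
have lenE sh' : strict_shape k sh' -> len (elt (color_shape n z sh')) = sumn sh'.
  by move=> str'; case: (chain_elt hn false (cc _ str')) => _ -> _; rewrite color_shape_fst.
have strc : strict_shape k (shape_compl k sh) by exact: strict_filter.
have shapeE sh' : strict_shape k sh' ->
    underlying_shape (colored_partition (elt (color_shape n z sh'))) = sh'.
  by move=> str'; rewrite (colored_partition_elt hn (cc _ str')) /underlying_shape color_shape_fst.
rewrite (shapeE sh) // (shapeE (shape_compl k sh)) // shape_complK //.
rewrite !lenE ?strict_staircase //; split=> //; last exact: sumn_shape_compl.
by apply: (elt_lower_interval hn); [exact: cc | exact: staircase_bruhat].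
Qed.

End Staircases.

(** * Spirals *)

Ltac evals E := split_ifs; rewrite ?E; try lia; split_ifs; try lia.

Section Spirals.
Local Open Scope ring_scope.
Variables (n : nat) (hn : (4 <= n)%N).
Implicit Types (e : bool) (ss : seq (seq nat)) (x y : nat -> int) (i j k l m d r : nat) (z : color).

Local Notation M := (@affD_matrix n).
Local Notation len w := (@cox_length _ M w%g).
Local Notation acts := (affD_acts n 1).
Local Notation asc := (affD_asc n 1).
Local Notation T s x := (swap_coords n 1 (acts s x)).
Local Notation gasc := (gasc n).
Local Notation gpoint := (gpoint n).
Local Notation D := (down (n - 1)).

Lemma acts_rev_iota m d x k : (0 < m)%N -> (m + d <= n)%N -> acts (rev (iota m d)) x k =
  if (m <= k < m + d)%N then x k.+1 else if k == (m + d)%N then x m else x k.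
Proof.
elim: d k => [|d IH] k m0 md; first by split_ifs; coords x.
rewrite -addn1 iotaD rev_cat /= /affD_act !IH; try lia.
by coords x.
Qed.

Lemma asc_rev_iota m d x : (0 < m)%N -> (m + d <= n)%N ->
  (forall k, (m <= k < m + d)%N -> x k.+1 < x m) -> asc (rev (iota m d)) x.
Proof.
elim: d => [|d IH] m0 md H //.
rewrite -addn1 iotaD rev_cat /= IH; try lia; last by move=> k ?; apply: H; lia.
have := H (m + d)%N; rewrite /affD_root !acts_rev_iota; try lia.
by coords x.
Qed.

Lemma swap_acts_down j x k : (1 <= j <= n - 1)%N -> (1 <= k <= n)%N -> T (down j) x k =
  if k == 1%N then 1 - x 2%N
  else if k == n then (if j == (n - 1)%N then - x 1%N else - x n)
  else if (k <= j)%N then x k.+1 else if k == j.+1 then x 1%N else x k.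
Proof. by move=> jn kn; rewrite /swap_coords !acts_down; try lia; coords x. Qed.

(** A segment [D] followed by the change of frame shifts the coordinates: 1 - x_2 enters in front
    and -x_1 at the end. In terms of 1 - x_1, x_2, ..., x_n this is a window sliding along the
    sequence - floor(m / n), which gives the closed form. *)
Lemma spiral_point r k : (1 <= k <= n)%N -> gpoint (nseq r D) base_point k =
  if k == 1%N then 1 + (r %/ n)%N%:Z else - ((r + k - 1) %/ n)%N%:Z.
Proof.
elim: r k => [|r IH] k kn.
  rewrite /base_point /=; case: eqP => _; first by rewrite div0n.
  by rewrite divn_small //; lia.
rewrite -[nseq _ _]/(nseq (1 + r) D) addnC nseqD gpoint_cat [gpoint (nseq 1 D) _]/=.
rewrite swap_acts_down //; last by lia.
have -> : (r.+1 + k - 1 = r + k)%N by lia.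
case: eqP => [k1|k1].
  by rewrite IH /=; [rewrite (_ : r + 2 - 1 = r.+1)%N; lia | lia].
case: eqP => [->|kN].
  rewrite eqxx IH /=; last by lia.
  by rewrite divnDr // divnn; case: (n) hn => //= n' _; lia.
rewrite (_ : (k <= n - 1)%N); last by lia.
rewrite IH /=; last by lia.
case: eqP => [|_]; first by lia.
by rewrite addnS subn1.
Qed.

Lemma spiral_asc r : gasc (nseq r D) base_point.
Proof.
elim: r => // r IH; rewrite -[nseq _ _]/(nseq (1 + r) D) addnC nseqD gasc_cat IH /= andbT.
apply/(asc_down hn) => [|k kn]; first lia.
rewrite !spiral_point; try lia; rewrite eqxx; case: eqP => [|_]; first by lia.
by move: (_ %/ _)%N (_ %/ _)%N => a b; lia.
Qed.

(** The sizes run from l + d - 1 down to l, so [stairs 1 d] is the staircase of d. *)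
Definition stairs l d := map down (rev (iota l d)).

Lemma stairsS l d : stairs l d.+1 = down (l + d) :: stairs l d.
Proof. by rewrite /stairs -addn1 iotaD rev_cat. Qed.

(** Each segment puts 1 - x_2 in front, and over the integers 1 - x_2 exceeds x_j exactly when x_2 +
    x_j <= 0; in later segments x_3, x_4, ... take the role of x_2. *)
Lemma stairs_asc l d x : (1 <= l)%N -> (l + d <= n - 1)%N ->
  (forall i, (2 <= i <= l + d)%N -> x i < x 1%N) ->
  (forall i j, (2 <= i < j)%N -> (j <= l + d)%N -> (i <= d)%N -> x i + x j <= 0) ->
  gasc (stairs l d) x.
Proof.
elim: d x => // d IH x l1 ld H1 H2; rewrite stairsS /=; apply/andP; split.
  by apply/(asc_down hn) => [|k kn]; [lia | apply: H1; lia].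
have [->//|d0] := posnP d.
apply: IH => //; first lia.
  move=> i il; rewrite !swap_acts_down; try lia; split_ifs.
  by have := H2 2%N i.+1; lia.
move=> i j ij jl id; rewrite !swap_acts_down; try lia; split_ifs.
by apply: H2; lia.
Qed.

Lemma stairs_point l d x i : (1 <= l)%N -> (l + d <= n - 1)%N -> (1 <= i <= l)%N ->
  gpoint (stairs l d) x i =
  if i == 1%N then (if d == 0%N then x 1%N else 1 - x d.+1) else x (i + d)%N.
Proof.
elim: d x i => [|d IH] x i l1 ld il.
  by rewrite /= addn0; case: eqP => [->|].
rewrite stairsS /= IH; try lia.
have [->|d0] := posnP d; rewrite ?swap_acts_down; try lia; by coords x.
Qed.

(** The diagram symmetry exchanging n - 1 and n, applied only for color c: it carries words of color
    b to words of color c, and [negate_last] is its effect on points. *)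
Definition flip z i : nat := if z is color_b then i else
  if i == (n - 1)%N then n else if i == n then (n - 1)%N else i.

Definition negate_last z x : nat -> int := fun k =>
  if z is color_b then x k else if k == n then - x n else x k.

Lemma root_flip z i x : (i <= n)%N ->
  affD_root n 1 (flip z i) (negate_last z x) = affD_root n 1 i x.
Proof.
case: z => // le_in; move E: (flip color_c i) => i'; move: E; rewrite /flip.
by split_ifs => <- {i'}; rewrite /affD_root /negate_last; coords x.
Qed.

Lemma act_flip z i x : (i <= n)%N ->
  affD_act n 1 (flip z i) (negate_last z x) = negate_last z (affD_act n 1 i x).
Proof.
case: z => // le_in; apply/funext => k; move E: (flip color_c i) => i'; move: E; rewrite /flip.
by split_ifs => <- {i'}; rewrite /affD_act /negate_last; coords x.
Qed.

Lemma acts_flip z ws x : all (leq^~ n) ws ->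
  acts (map (flip z) ws) (negate_last z x) = negate_last z (acts ws x).
Proof. by elim: ws => //= i ws IH /andP[le_in /IH->]; exact: act_flip. Qed.

Lemma asc_flip z ws x : all (leq^~ n) ws ->
  asc (map (flip z) ws) (negate_last z x) = asc ws x.
Proof.
by elim: ws => //= i ws IH /andP[le_in le_ws]; rewrite IH // acts_flip // root_flip.
Qed.

Lemma swap_negate_last z x : swap_coords n 1 (negate_last z x) = negate_last z (swap_coords n 1 x).
Proof. by apply/funext => k; case: z => //; rewrite /swap_coords /negate_last; coords x. Qed.

Lemma gasc_flip z ss x : all (all (leq^~ n)) ss ->
  gasc (map (map (flip z)) ss) (negate_last z x) = gasc ss x.
Proof.
elim: ss x => //= s1 ss IH x /andP[le1 le_ss].
by rewrite asc_flip // acts_flip // swap_negate_last IH.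
Qed.

Lemma gpoint_flip z ss x : all (all (leq^~ n)) ss ->
  gpoint (map (map (flip z)) ss) (negate_last z x) = negate_last z (gpoint ss x).
Proof.
elim: ss x => //= s1 ss IH x /andP[le1 le_ss].
by rewrite acts_flip // swap_negate_last IH.
Qed.

Lemma negate_last_base z : negate_last z base_point = base_point.
Proof.
apply/funext => k; case: z => //; rewrite /negate_last /base_point; split_ifs; lia.
Qed.

Lemma negate_last_inj z x y k : negate_last z x k = negate_last z y k -> x k = y k.
Proof. by case: z => //; rewrite /negate_last; case: eqP => // -> /oppr_inj. Qed.

Lemma flip_le z i : (i <= n)%N -> (flip z i <= n)%N.
Proof. by move=> ?; case: z => //; rewrite /flip; split_ifs; lia. Qed.

(** The number of segments is kept, even when one becomes empty: its parity decides in which frame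
    the final point is to be read. *)
Definition seg_deletion ss' ss : Prop :=
  exists (l : seq (seq nat)) (s s' : seq nat) (r : seq (seq nat)), [/\ ss = l ++ s :: r, ss' = l ++ s' :: r & deletion s' s].

Definition below ss' ss : Prop :=
  [/\ all (all (leq^~ n)) ss', gasc ss' base_point & seg_deletion ss' ss].

Lemma seg_deletion_map (f : nat -> nat) ss' ss :
  seg_deletion ss' ss -> seg_deletion (map (map f) ss') (map (map f) ss).
Proof.
move=> [l [s [s' [r [-> -> d]]]]].
exists (map (map f) l), (map f s), (map f s'), (map (map f) r).
by rewrite !map_cat; split=> //; exact: deletion_map.
Qed.

Lemma seg_deletion_size ss' ss : seg_deletion ss' ss ->
  size ss' = size ss /\ (sumn (map size ss')).+1 = sumn (map size ss).
Proof.
move=> [l [s [s' [r [-> -> [a [i [b [-> ->]]]]]]]]].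
rewrite !size_cat /= !map_cat !sumn_cat /= !size_cat /=; split=> //; lia.
Qed.

Lemma below_flip z ss' ss : below ss' ss ->
  below (map (map (flip z)) ss') (map (map (flip z)) ss).
Proof.
move=> [le_ss asc_ss del]; split; last exact: seg_deletion_map.
  rewrite all_map; apply: sub_all le_ss => s /=; rewrite all_map.
  by apply: sub_all => i; exact: flip_le.
by rewrite -(negate_last_base z) gasc_flip.
Qed.

Lemma below_bruhat ss' ss : all (all (leq^~ n)) ss -> gasc ss base_point -> below ss' ss ->
  bruhat_le (gelt n false ss') (gelt n false ss).
Proof.
move=> le_ss asc_ss [le_ss' asc_ss' del].
have [_ l1] := gelt_min hn false le_ss asc_ss.
have [_ l2] := gelt_min hn false le_ss' asc_ss'.
have [_ sz] := seg_deletion_size del.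
apply: gelt_bruhat; last by rewrite [ltnLHS]l2 [ltnRHS]l1 -sz.
by case: del => [l [s [s' [r [-> -> d]]]]]; exact: deletion_gword.
Qed.

Lemma chain_sum_small (ps : seq part) k : (1 <= k <= 2)%N -> chain n ps ->
  sumn (map fst ps) = k -> ps = [:: (k, None)].
Proof.
have pos p : valid_part n p -> (1 <= p.1)%N by case=> /andP[].
have None2 p : valid_part n p -> (p.1 <= 2)%N -> p = (p.1, None).
  by move=> vp p2; rewrite {1}(low_part hn color_b vp) ?ifF //; lia.
case: ps => [|p [|q ps]] kn //=; first by lia.
  by move=> [vp _ _] sm; rewrite (None2 p) //=; [congr [:: (_, _)] |]; lia.
move=> [vp pq [vq _ _]] sm; have := pos p vp; have := pos q vq.
by move: pq; rewrite /okpair => /orP[|/andP[_]]; lia.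
Qed.

(** As n >= 4, the sizes 1 and 2 carry no color, and two parts of a chain never add up to 2 or less.
    At length 3 there are already (3) and (2, 1), so colength 2 is the last useful one. *)
Lemma small_length_unique (u v : affD n) k : (1 <= k <= 2)%N ->
  min_coset_rep (gens_but n 0) u -> min_coset_rep (gens_but n 0) v ->
  cox_length u = k -> cox_length v = k -> u = v.
Proof.
move=> kn uJ vJ lu lv.
have [uE cu] := colored_partitionP hn uJ; have [vE cv] := colored_partitionP hn vJ.
have [_ lu' _] := chain_elt hn false cu; have [_ lv' _] := chain_elt hn false cv.
have pu : colored_partition u = [:: (k, None)].
  by apply: chain_sum_small => //; rewrite -lu'; move: lu; rewrite {1}uE.
have pv : colored_partition v = [:: (k, None)].
  by apply: chain_sum_small => //; rewrite -lv'; move: lv; rewrite {1}vE.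
by rewrite uE vE pu pv.
Qed.

Lemma not_palindromic_small (w v1 v2 : affD n) k : (1 <= k <= 2)%N ->
  lower_interval w v1 -> lower_interval w v2 -> v1 <> v2 ->
  (cox_length v1 + k = cox_length w)%N -> (cox_length v2 + k = cox_length w)%N ->
  ~ palindromic w.
Proof.
move=> kn v1w v2w ne l1 l2; apply: (not_palindromic _ v1w v2w ne l1 l2); first by lia.
by move=> u v [uJ _] [vJ _]; exact: small_length_unique.
Qed.

Lemma gelt_neq ss1 ss2 : all (all (leq^~ n)) ss1 -> all (all (leq^~ n)) ss2 ->
  size ss1 = size ss2 ->
  (exists2 k, (1 <= k <= n)%N & gpoint ss1 base_point k <> gpoint ss2 base_point k) ->
  gelt n false ss1 <> gelt n false ss2.
Proof.
move=> le1 le2 sz [k kn ne] eqg; apply: ne.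
have := gelt_point hn false le1; rewrite eqg gelt_point // sz => cE.
by rewrite (affD_conf_inj hn cE).
Qed.

Lemma flip_segments z ss : all (all (leq^~ n)) ss -> gasc ss base_point ->
  all (all (leq^~ n)) (map (map (flip z)) ss) /\ gasc (map (map (flip z)) ss) base_point.
Proof.
move=> le_ss asc_ss; split; last by rewrite -(negate_last_base z) gasc_flip.
rewrite all_map; apply: sub_all le_ss => s /=; rewrite all_map.
by apply: sub_all => i; exact: flip_le.
Qed.

Lemma below_not_palindromic z ss ss1 ss2 :
  all (all (leq^~ n)) ss -> gasc ss base_point -> below ss1 ss -> below ss2 ss ->
  (exists2 k, (1 <= k <= n)%N & gpoint ss1 base_point k <> gpoint ss2 base_point k) ->
  ~ palindromic (gelt n false (map (map (flip z)) ss)).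
Proof.
move=> le_ss asc_ss b1 b2 [k kn ne].
have [fle fasc] := flip_segments z le_ss asc_ss.
have [f1 f2] := (below_flip z b1, below_flip z b2).
have [[fle1 fasc1 del1] [fle2 fasc2 del2]] := (f1, f2).
have [[sz1 sm1] [sz2 sm2]] := (seg_deletion_size del1, seg_deletion_size del2).
have [J1 l1] := gelt_min hn false fle1 fasc1; have [J2 l2] := gelt_min hn false fle2 fasc2.
have [_ l] := gelt_min hn false fle fasc.
apply: (@not_palindromic_small _ (gelt n false (map (map (flip z)) ss1))
  (gelt n false (map (map (flip z)) ss2)) 1) => //.
- by split=> //; exact: below_bruhat.
- by split=> //; exact: below_bruhat.
- apply: gelt_neq => //; first by rewrite sz1.
  have [[le1 _ _] [le2 _ _]] := (b1, b2).
  by exists k => // H; apply: ne; apply: (@negate_last_inj z); rewrite -!gpoint_flip // negate_last_base.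
- by rewrite [X in (X + _)%N]l1 [RHS]l -sm1 addn1.
- by rewrite [X in (X + _)%N]l2 [RHS]l -sm2 addn1.
Qed.

Lemma below2_not_palindromic z ss (m1 m2 ss1 ss2 : seq (seq nat)) :
  all (all (leq^~ n)) ss -> gasc ss base_point -> below m1 ss -> below m2 ss ->
  below ss1 m1 -> below ss2 m2 ->
  (exists2 k, (1 <= k <= n)%N & gpoint ss1 base_point k <> gpoint ss2 base_point k) ->
  ~ palindromic (gelt n false (map (map (flip z)) ss)).
Proof.
move=> le_ss asc_ss c1 c2 b1 b2 [k kn ne].
have [fle fasc] := flip_segments z le_ss asc_ss.
have [[f1 f2] [g1 g2]] := ((below_flip z b1, below_flip z b2), (below_flip z c1, below_flip z c2)).
have [[fle1 fasc1 del1] [fle2 fasc2 del2]] := (f1, f2).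
have [[gle1 gasc1 gdel1] [gle2 gasc2 gdel2]] := (g1, g2).
have [[sz1 sm1] [sz2 sm2]] := (seg_deletion_size del1, seg_deletion_size del2).
have [[gz1 gm1] [gz2 gm2]] := (seg_deletion_size gdel1, seg_deletion_size gdel2).
have [J1 l1] := gelt_min hn false fle1 fasc1; have [J2 l2] := gelt_min hn false fle2 fasc2.
have [_ l] := gelt_min hn false fle fasc.
apply: (@not_palindromic_small _ (gelt n false (map (map (flip z)) ss1))
  (gelt n false (map (map (flip z)) ss2)) 2) => //.
- split=> //; apply: bruhat_trans (below_bruhat fle fasc g1); exact: below_bruhat.
- split=> //; apply: bruhat_trans (below_bruhat fle fasc g2); exact: below_bruhat.
- apply: gelt_neq => //; first by rewrite sz1 gz1 sz2.
  have [[le1 _ _] [le2 _ _]] := (b1, b2).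
  by exists k => // H; apply: ne; apply: (@negate_last_inj z); rewrite -!gpoint_flip // negate_last_base.
- by rewrite [X in (X + _)%N]l1 [RHS]l -gm1 -sm1 addn2.
- by rewrite [X in (X + _)%N]l2 [RHS]l -gm2 -sm2 addn2.
Qed.

(** Deleting the letter m stops x_1 at place m and lets x_(m+1) travel on to place j + 1 in its
    stead. *)
Lemma deletion_down j m : (1 <= m <= j)%N ->
  deletion (rev (iota m.+1 (j - m)) ++ down (m - 1)) (down j).
Proof.
move=> mj; exists (rev (iota m.+1 (j - m))), m, (down (m - 1)); split=> //.
have jE : (j = (m - 1) + (1 + (j - m)))%N by lia.
rewrite /down {1}jE iotaD rev_cat (_ : (1 + (m - 1) = m)%N); last by lia.
by rewrite /= rev_cons -cats1 -catA.
Qed.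

Lemma deletion_downS j : deletion (down j) (down j.+1).
Proof. by rewrite downS; exact: deletion_behead. Qed.

Lemma rev_iota_le m d : (m + d <= n.+1)%N -> all (leq^~ n) (rev (iota m d)).
Proof. by move=> md; apply/allP => i; rewrite mem_rev mem_iota; lia. Qed.

Lemma nseq_down_le r : all (all (leq^~ n)) (nseq r D).
Proof. by rewrite all_nseq rev_iota_le ?orbT //; lia. Qed.

Lemma stairs_le l d : (l + d <= n.+1)%N -> all (all (leq^~ n)) (stairs l d).
Proof.
move=> ld; rewrite all_map; apply/allP => j; rewrite mem_rev mem_iota => jl /=.
by apply: rev_iota_le; lia.
Qed.

(** * Shapes with all parts equal to n - 1 *)

Lemma spiral_coord c a k : (a < n)%N -> (1 <= k <= n)%N ->
  gpoint (nseq (c * n + a) D) base_point k =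
  if k == 1%N then 1 + c%:Z else if (a + k <= n)%N then - c%:Z else - c.+1%:Z.
Proof.
move=> an kn; have n0 : (0 < n)%N by lia.
rewrite spiral_point //; case: eqP => [_|k1]; first by rewrite divnMDl // divn_small // addn0.
rewrite (_ : (c * n + a + k - 1 = c * n + (a + k - 1))%N); last by lia.
case: leqP => akn; rewrite divnMDl //; first by rewrite divn_small ?addn0 //; lia.
rewrite (_ : (a + k - 1 = 1 * n + (a + k - 1 - n))%N); last by lia.
by rewrite divnMDl // divn_small ?addn0 ?addn1 //; lia.
Qed.

Lemma nseq_rcons (U : Type) r (u : U) : (0 < r)%N -> nseq r u = nseq r.-1 u ++ [:: u].
Proof. by case: r => // r _; rewrite /= -[RHS](nseqD r 1) addn1. Qed.

Lemma seg_deletion_last (l r : seq (seq nat)) (s s' : seq nat) : deletion s' s -> seg_deletion (l ++ s' :: r) (l ++ s :: r).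
Proof. by exists l, s, s', r. Qed.

Lemma seg_deletion_last2 (l r : seq (seq nat)) (t s s' : seq nat) :
  deletion s' s -> seg_deletion (l ++ [:: t, s' & r]) (l ++ [:: t, s & r]).
Proof. by move=> d; exists (rcons l t), s, s', r; rewrite !cat_rcons. Qed.

Lemma spiral_not_palindromic z r : (2 <= r)%N ->
  ~ palindromic (gelt n false (map (map (flip z)) (nseq r D))).
Proof.
move=> r2; have n0 : (0 < n)%N by lia.
pose c := (r %/ n)%N; pose a := (r %% n)%N.
have rE : r = (c * n + a)%N by exact: divn_eq.
have an : (a < n)%N by rewrite ltn_mod.
clearbody c a.
have le_D : all (leq^~ n) D by apply: rev_iota_le; lia.
have le_dn j : (j <= n)%N -> all (leq^~ n) (down j) by move=> jn; apply: rev_iota_le; lia.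
have le_r := nseq_down_le r; have asc_r := spiral_asc r.
have [a2|a2] := leqP 2 a.
  (* The last coordinate equal to -c can travel past the coordinates -(c+1)
     in place of x_1. *)
  have r1E : (r.-1 = c * n + (a - 1))%N by lia.
  pose m := (n - a)%N; pose E := rev (iota m.+1 (n - 1 - m)) ++ down (m - 1).
  pose x := gpoint (nseq r.-1 D) base_point.
  have xE k : (1 <= k <= n)%N -> x k =
      if k == 1%N then 1 + c%:Z else if (a - 1 + k <= n)%N then - c%:Z else - c.+1%:Z.
    by rewrite /x r1E; apply: spiral_coord; lia.
  have xmono k : (2 <= k <= n)%N -> x k < x 1%N by move=> kn; evals xE.
  have nE : nseq r D = nseq r.-1 D ++ [:: D] by apply: nseq_rcons; lia.
  apply: (@below_not_palindromic z _ (nseq r.-1 D ++ [:: down (n - 2)]) (nseq r.-1 D ++ [:: E])) => //.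
  - split; [by rewrite all_cat nseq_down_le /= le_dn //; lia| |].
      rewrite gasc_cat spiral_asc /= andbT; apply/(asc_down hn) => [|k kn]; first lia.
      by apply: xmono; lia.
    rewrite nE; apply: seg_deletion_last; rewrite (_ : (n - 1)%N = (n - 2).+1); last by lia.
    exact: deletion_downS.
  - split; [| |by rewrite nE; apply: seg_deletion_last; apply: deletion_down; lia].
      by rewrite all_cat nseq_down_le /= all_cat rev_iota_le ?le_dn //; lia.
    rewrite gasc_cat spiral_asc /= andbT -/x affD_asc_cat; apply/andP; split.
      apply: asc_rev_iota; try lia; move=> k kn; rewrite !acts_down; try lia.
      by evals xE.
    by apply/(asc_down hn) => [|k kn]; [lia | apply: xmono; lia].
  - exists m; first lia.
    rewrite !gpoint_cat /= -/x /swap_coords affD_acts_cat !acts_rev_iota ?acts_down; try lia.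
    by evals xE.
have c1 : (1 <= c)%N by case: c rE => //; lia.
have r2E : nseq r D = nseq (r - 2) D ++ [:: D; D].
  by rewrite -(nseqD _ 2); congr nseq; lia.
(* For a = 0 two letters are deleted. From the intermediate word [mid], whose last segment has lost
   its letter n - 1, one witness shortens that segment again; the other deletes the letter 1 of the
   segment before it, so that x_2 = 1 - c travels past the coordinates -c. *)
have [a0|a1] := posnP a.
  pose x := gpoint (nseq (r - 2) D) base_point.
  have rE2 : (r - 2 = c.-1 * n + (n - 2))%N by case: c c1 rE => // c' _ ->; rewrite mulSn /=; lia.
  have xE k : (1 <= k <= n)%N -> x k =
      if k == 1%N then c%:Z else if k == 2%N then 1 - c%:Z else - c%:Z.
    by move=> kn; rewrite /x rE2 spiral_coord; try lia; split_ifs; lia.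
  pose mid := nseq (r - 2) D ++ [:: D; down (n - 2)].
  have TDx k : (1 <= k <= n)%N -> T D x k = if k == 1%N then c%:Z else - c%:Z.
    by move=> kn; rewrite swap_acts_down //; try lia; evals xE.
  have ascD : asc D x.
    by apply/(asc_down hn) => [|k kn]; [lia | evals xE].
  have bmid : below mid (nseq r D).
    split; [by rewrite all_cat nseq_down_le /= le_D le_dn //; lia| |].
      rewrite gasc_cat spiral_asc /= -/x ascD andbT /=; apply/(asc_down hn) => [|k kn]; first lia.
      by evals TDx.
    rewrite r2E /mid; apply: seg_deletion_last2.
    by rewrite (_ : (n - 1)%N = (n - 2).+1); [exact: deletion_downS | lia].
  apply: (@below2_not_palindromic z _ mid mid (nseq (r - 2) D ++ [:: D; down (n - 3)])
    (nseq (r - 2) D ++ [:: rev (iota 2 (n - 2)); down (n - 2)])) => //.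
  - split; [by rewrite all_cat nseq_down_le /= le_D le_dn //; lia| |].
      rewrite gasc_cat spiral_asc /= -/x ascD andbT /=; apply/(asc_down hn) => [|k kn]; first lia.
      by evals TDx.
    rewrite /mid; apply: seg_deletion_last2.
    by rewrite (_ : (n - 2)%N = (n - 3).+1); [exact: deletion_downS | lia].
  - split; [by rewrite all_cat nseq_down_le /= rev_iota_le ?le_dn //; lia| |].
      rewrite gasc_cat spiral_asc /= -/x andbT; apply/andP; split.
        apply: asc_rev_iota; try lia; move=> k kn; evals xE.
      apply/(asc_down hn) => [|k kn]; first lia.
      by rewrite /swap_coords !acts_rev_iota; try lia; evals xE.
    rewrite /mid; apply: (@seg_deletion_last _ [:: down (n - 2)]).
    have := @deletion_down (n - 1) 1; rewrite cats0 (_ : n - 1 - 1 = n - 2)%N; last by lia.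
    by apply; lia.
  - exists (n - 1)%N; first lia.
    rewrite !gpoint_cat /= -/x.
    rewrite !swap_acts_down; try lia; split_ifs.
    by rewrite /swap_coords !acts_rev_iota; try lia; evals xE.
pose x := gpoint (nseq (r - 2) D) base_point.
(* For a = 1 the first r - 2 segments lead to the point (c, -c, ..., -c), and the letter n - 1 can
   be deleted from either of the last two segments. *)
have aE : a = 1%N by lia.
have rE2 : (r - 2 = c.-1 * n + (n - 1))%N by case: c c1 rE => // c' _ ->; rewrite mulSn /=; lia.
have xE k : (1 <= k <= n)%N -> x k = if k == 1%N then c%:Z else - c%:Z.
  by move=> kn; rewrite /x rE2 spiral_coord; try lia; split_ifs; lia.
have TDx k : (1 <= k <= n)%N -> T D x k = if k == 1%N then 1 + c%:Z else - c%:Z.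
  by move=> kn; rewrite swap_acts_down //; try lia; evals xE.
have ascj j : (1 <= j <= n - 1)%N -> asc (down j) x.
  by move=> jn; apply/(asc_down hn) => [|k kn]; [lia | evals xE].
have Tx k : (1 <= k <= n)%N -> T (down (n - 2)) x k =
    if k == 1%N then 1 + c%:Z else if (k <= n - 2)%N then - c%:Z else c%:Z.
  by move=> kn; rewrite swap_acts_down //; try lia; evals xE.
apply: (@below_not_palindromic z _ (nseq (r - 2) D ++ [:: D; down (n - 2)])
  (nseq (r - 2) D ++ [:: down (n - 2); D])) => //.
- split; [by rewrite all_cat nseq_down_le /= le_D le_dn //; lia| |].
    rewrite gasc_cat spiral_asc /= -/x ascj ?andbT /=; last by lia.
    apply/(asc_down hn) => [|k kn]; first lia.
    by evals TDx.
  rewrite r2E; apply: seg_deletion_last2.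
  by rewrite (_ : (n - 1)%N = (n - 2).+1); [exact: deletion_downS | lia].
- split; [by rewrite all_cat nseq_down_le /= le_D le_dn //; lia| |].
    rewrite gasc_cat spiral_asc /= -/x ascj ?andbT /=; last by lia.
    apply/(asc_down hn) => [|k kn]; first lia.
    by evals Tx.
  rewrite r2E; apply: (@seg_deletion_last _ [:: D]).
  by rewrite (_ : (n - 1)%N = (n - 2).+1); [exact: deletion_downS | lia].
exists (n - 1)%N; first lia.
rewrite !gpoint_cat /= -/x !swap_acts_down; try lia.
by evals xE.
Qed.

(** * Parts n - 1 followed by a staircase *)

Lemma stairs_split l l' d : stairs l (d + l')%N = stairs (l + l') d ++ stairs l l'.
Proof. by rewrite /stairs addnC iotaD rev_cat map_cat. Qed.

(* Here it is x_2 = -c that can travel past the coordinates -(c+1) in place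
   of x_1. *)
Lemma stairs_two_points (c : int) m x : (2 <= m <= n - 1)%N -> 0 <= c ->
  (forall i, (1 <= i <= m.+1)%N -> x i =
    if i == 1%N then 1 + c else if i == 2%N then - c else - (c + 1)) ->
  [/\ gasc (rev (iota 2 (m - 1)) :: stairs 1 (m - 1)) x,
      gasc (down m :: stairs 2 (m - 2) ++ [:: [::]]) x &
      gpoint (rev (iota 2 (m - 1)) :: stairs 1 (m - 1)) x 1%N <>
      gpoint (down m :: stairs 2 (m - 2) ++ [:: [::]]) x 1%N].
Proof.
move=> mn c0 xE.
pose x' := T (down m) x; pose y := T (rev (iota 2 (m - 1))) x.
have x'E i : (1 <= i <= m)%N -> x' i = if i == 1%N then 1 + c else - (c + 1).
  by move=> im; rewrite /x' swap_acts_down; try lia; evals xE.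
have yE i : (1 <= i <= m)%N -> y i = if i == 1%N then - c else - (c + 1).
  by move=> im; rewrite /y /swap_coords !acts_rev_iota; try lia; evals xE.
split.
- apply/andP; split.
    by apply: asc_rev_iota; try lia; move=> k kn; evals xE.
  by apply: (@stairs_asc 1 (m - 1)); try lia; rewrite -/y => *; evals yE.
- rewrite /=; apply/andP; split; first by apply/(asc_down hn) => [|k kn]; [lia | evals xE].
  rewrite gasc_cat /= andbT.
  by apply: (@stairs_asc 2 (m - 2)); try lia; rewrite -/x' => *; evals x'E.
rewrite /= gpoint_cat -/x' -/y /= {1}/swap_coords /= !stairs_point; try lia.
by split_ifs; rewrite ?x'E ?yE; try lia; split_ifs; lia.
Qed.

Lemma spiral_stairs_not_palindromic z r : (2 <= r)%N ->
  ~ palindromic (gelt n false (map (map (flip z)) (nseq r D ++ stairs 1 (n - 2)))).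
Proof.
move=> r2; have n0 : (0 < n)%N by lia.
pose c := (r %/ n)%N; pose a := (r %% n)%N.
have rE : r = (c * n + a)%N by exact: divn_eq.
have an : (a < n)%N by rewrite ltn_mod.
clearbody c a.
have le_D : all (leq^~ n) D by apply: rev_iota_le; lia.
have le_dn j : (j <= n)%N -> all (leq^~ n) (down j) by move=> jn; apply: rev_iota_le; lia.
have le_ss : all (all (leq^~ n)) (nseq r D ++ stairs 1 (n - 2)).
  by rewrite all_cat nseq_down_le stairs_le //; lia.
pose y := gpoint (nseq r D) base_point.
have yE k : (1 <= k <= n)%N -> y k =
    if k == 1%N then 1 + c%:Z else if (a + k <= n)%N then - c%:Z else - c.+1%:Z.
  by rewrite /y {1}rE; exact: spiral_coord.
have asc_stairs l d : (1 <= l)%N -> (l + d <= n - 1)%N -> gasc (stairs l d) y.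
  by move=> l1 ld; apply: (@stairs_asc l d) => // *; evals yE.
have asc_ss : gasc (nseq r D ++ stairs 1 (n - 2)) base_point.
  by rewrite gasc_cat spiral_asc; apply: asc_stairs; lia.
have del1 : deletion [::] (down 1) by exact: deletion_downS.
have [a2|a2] := leqP 2 a.
  (* The prefix [P] ends just before the segment of size a, at a point where x_2 = -c and the places
     3, ..., a + 1 hold -(c + 1). For a = n - 1 that segment is the last [D]; otherwise it belongs
     to the staircase. *)
  have [P [ssE leP ascP xE]] : exists P, [/\ nseq r D ++ stairs 1 (n - 2) = P ++ down a :: stairs 1 (a - 1),
      all (all (leq^~ n)) P, gasc P base_point &
      forall i, (1 <= i <= a.+1)%N -> gpoint P base_point i =
        if i == 1%N then 1 + c%:Z else if i == 2%N then - c%:Z else - (c%:Z + 1)].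
    have [an'|an'] := eqVneq a (n - 1)%N.
      exists (nseq r.-1 D); split; [|exact: nseq_down_le|exact: spiral_asc|].
        rewrite (@nseq_rcons _ r D) -?catA /=; last by lia.
        by rewrite an' (_ : n - 1 - 1 = n - 2)%N //; lia.
      move=> i ia; rewrite (_ : r.-1 = c * n + (a - 1))%N; last by lia.
      by rewrite spiral_coord; try lia; split_ifs; lia.
    exists (nseq r D ++ stairs a.+1 (n - 2 - a)); split.
    - rewrite -catA; congr (_ ++ _).
      have e : (n - 2 = (n - 2 - a) + a)%N by lia.
      have ea : a = (a - 1).+1 by lia.
      by rewrite {1}e stairs_split add1n {3}ea stairsS add1n -ea.
    - by rewrite all_cat nseq_down_le stairs_le //; lia.
    - by rewrite gasc_cat spiral_asc; apply: asc_stairs; lia.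
    move=> i ia; rewrite gpoint_cat -/y stairs_point; try lia.
    by evals yE.
  have [|//|asc2 asc1 ne] := stairs_two_points (c := c%:Z) (m := a) _ _ xE; first by lia.
  have stE : stairs 1 (a - 1) = stairs 2 (a - 2) ++ [:: down 1].
    by rewrite (_ : a - 1 = (a - 2) + 1)%N ?stairs_split //; lia.
  rewrite ssE in le_ss asc_ss *.
  apply: (@below_not_palindromic z _ (P ++ down a :: stairs 2 (a - 2) ++ [:: [::]])
    (P ++ rev (iota 2 (a - 1)) :: stairs 1 (a - 1))) => //.
  - split; [|by rewrite gasc_cat ascP|].
      by rewrite all_cat leP /= le_dn ?all_cat ?stairs_le //; lia.
    by rewrite stE -!cat_cons !catA; apply: seg_deletion_last.
  - split; [|by rewrite gasc_cat ascP|].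
      by rewrite all_cat leP /= rev_iota_le ?stairs_le //; lia.
    apply: seg_deletion_last.
    by have := @deletion_down a 1; rewrite cats0; apply; lia.
  - by exists 1%N; [lia | rewrite !gpoint_cat => /esym].
have c1 : (1 <= c)%N by case: c rE {yE} => //; lia.
have stE : stairs 1 (n - 2) = stairs 2 (n - 3) ++ [:: down 1].
  by rewrite (_ : n - 2 = (n - 3) + 1)%N ?stairs_split //; lia.
(* For a = 0 one may delete the final segment of size 1, or the letter n - 1 of the last [D]. *)
have [a0|a1] := posnP a.
  pose x := gpoint (nseq r.-1 D) base_point.
  have xE k : (1 <= k <= n)%N -> x k = if k == 1%N then c%:Z else - c%:Z.
    move=> kn; rewrite /x (_ : r.-1 = c.-1 * n + (n - 1))%N; last first.
      by case: c c1 rE {yE} => // c' _ ->; rewrite mulSn /=; lia.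
    by rewrite spiral_coord; try lia; split_ifs; lia.
  have Tx k : (1 <= k <= n)%N -> T (down (n - 2)) x k =
      if k == 1%N then 1 + c%:Z else if (k <= n - 2)%N then - c%:Z else c%:Z.
    by move=> kn; rewrite swap_acts_down //; try lia; evals xE.
  have nE : nseq r D = nseq r.-1 D ++ [:: D] by apply: nseq_rcons; lia.
  apply: (@below_not_palindromic z _ (nseq r D ++ stairs 2 (n - 3) ++ [:: [::]])
    (nseq r.-1 D ++ down (n - 2) :: stairs 1 (n - 2))) => //.
  - split; [by rewrite !all_cat nseq_down_le stairs_le //; lia| |].
      by rewrite !gasc_cat spiral_asc /= andbT; apply: asc_stairs; lia.
    by rewrite stE !catA; exact: seg_deletion_last.
  - split; [by rewrite !all_cat nseq_down_le /= le_dn ?stairs_le //; lia| |].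
      rewrite gasc_cat spiral_asc /= -/x; apply/andP; split.
        by apply/(asc_down hn) => [|k kn]; [lia | evals xE].
      by apply: (@stairs_asc 1 (n - 2)); try lia; move=> *; evals Tx.
    rewrite nE -catA; apply: seg_deletion_last.
    by rewrite (_ : (n - 1)%N = (n - 2).+1); [exact: deletion_downS | lia].
  exists 1%N; first lia.
  rewrite !gpoint_cat -/y /= -/x {1}/swap_coords /= !stairs_point; try lia.
  by split_ifs; rewrite ?Tx ?yE; try lia; split_ifs; lia.
have aE : a = 1%N by lia.
have r2E : nseq r D = nseq (r - 2) D ++ [:: D; D].
  by rewrite -(nseqD _ 2); congr nseq; lia.
pose x := gpoint (nseq (r - 2) D) base_point.
have xE k : (1 <= k <= n)%N -> x k = if k == 1%N then c%:Z else - c%:Z.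
  move=> kn; rewrite /x (_ : r - 2 = c.-1 * n + (n - 1))%N; last first.
    by case: c c1 rE {yE} => // c' _ ->; rewrite mulSn /=; lia.
  by rewrite spiral_coord; try lia; split_ifs; lia.
have Tx k : (1 <= k <= n)%N -> T (down (n - 2)) x k =
    if k == 1%N then 1 + c%:Z else if (k <= n - 2)%N then - c%:Z else c%:Z.
  by move=> kn; rewrite swap_acts_down //; try lia; evals xE.
pose x2 := T D (T (down (n - 2)) x).
have x2E k : (1 <= k <= n - 1)%N -> x2 k =
    if k == 1%N then 1 + c%:Z else if (k <= n - 3)%N then - c%:Z else c%:Z.
  by move=> kn; rewrite /x2 swap_acts_down //; try lia; evals Tx.
have asc3 : gasc (stairs 3 (n - 4)) y by apply: asc_stairs; lia.
have y3E i : (1 <= i <= 3)%N -> gpoint (stairs 3 (n - 4)) y i = if i == 1%N then 1 + c%:Z else - c%:Z.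
  by move=> i3; rewrite stairs_point; try lia; evals yE.
have stE2 : stairs 2 (n - 3) = stairs 3 (n - 4) ++ [:: down 2].
  by rewrite (_ : n - 3 = (n - 4) + 1)%N ?stairs_split //; lia.
(* For a = 1 both witnesses lose the final segment of size 1. Then either the segment of size 2
   shrinks to 1, or the last [D] but one loses its letter n - 1; the latter produces two coordinates
   c for which a final segment of size 1 would not be an ascent, hence the detour through [mid]. *)
pose mid := nseq r D ++ stairs 2 (n - 3) ++ [:: [::]].
have bmid : below mid (nseq r D ++ stairs 1 (n - 2)).
  split; [by rewrite !all_cat nseq_down_le stairs_le //; lia| |].
    by rewrite !gasc_cat spiral_asc /= andbT; apply: asc_stairs; lia.
  by rewrite /mid stE !catA; exact: seg_deletion_last.
apply: (@below2_not_palindromic z _ mid mid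
  (nseq r D ++ stairs 3 (n - 4) ++ [:: down 1; [::]])
  (nseq (r - 2) D ++ [:: down (n - 2), D & stairs 2 (n - 3) ++ [:: [::]]])) => //.
- split; [by rewrite !all_cat nseq_down_le stairs_le /= ?andbT; lia| |].
    rewrite !gasc_cat spiral_asc asc3 -/y.
    have asc1 : asc (down 1) (gpoint (stairs 3 (n - 4)) y).
      by apply/(asc_down hn) => [|k kn]; [lia | evals y3E].
    by rewrite [gasc [:: _; _] _]/(_ && _) asc1.
  exists (nseq r D ++ stairs 3 (n - 4)), (down 2), (down 1), [:: [::]].
  by rewrite /mid stE2 -!catA; split=> //; exact: deletion_downS.
- split; [by rewrite !all_cat nseq_down_le /= le_D le_dn ?all_cat ?stairs_le //; lia| |].
    rewrite gasc_cat spiral_asc /= -/x; apply/and3P; split.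
    + by apply/(asc_down hn) => [|k kn]; [lia | evals xE].
    + by apply/(asc_down hn) => [|k kn]; [lia | evals Tx].
    + rewrite gasc_cat /= andbT -/x2; apply: (@stairs_asc 2 (n - 3)); try lia; move=> *; evals x2E.
  rewrite /mid r2E -catA; apply: seg_deletion_last.
  by rewrite (_ : (n - 1)%N = (n - 2).+1); [exact: deletion_downS | lia].
exists 1%N; first lia.
have T0 x0 : T [::] x0 1%N = 1 - x0 1%N by [].
have -> : gpoint (nseq r D ++ stairs 3 (n - 4) ++ [:: down 1; [::]]) base_point 1%N = - c%:Z.
  rewrite !gpoint_cat -/y -[gpoint [:: _; _] _]/(T [::] (T (down 1) _)).
  rewrite T0 swap_acts_down; try lia.
  by rewrite eqxx y3E /=; lia.
have -> : gpoint (nseq (r - 2) D ++ [:: down (n - 2), D & stairs 2 (n - 3) ++ [:: [::]]]) base_point 1%N = c%:Z.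
  rewrite gpoint_cat -/x -[gpoint [:: _, _ & _] _]/(gpoint (stairs 2 (n - 3) ++ [:: [::]]) x2).
  rewrite gpoint_cat -[gpoint [:: [::]] _]/(T [::] _) T0.
  by rewrite stairs_point; try lia; evals x2E.
by lia.
Qed.

End Spirals.

(** * Classification *)

Section Classification.
Variables (n : nat) (hn : 4 <= n).
Implicit Types (p q : part) (ps l r : seq part) (z : color) (j k a : nat) (sh : seq nat).

Local Notation elt := (elt n false).
Local Notation chain := (chain n).
Local Notation segs ps := (map (segment1 n) ps).
Local Notation D := (down (n - 1)).
Local Notation total ps := (sumn (map fst ps)).

Lemma chain_catr l r : chain (l ++ r) -> chain r.
Proof. by elim: l => // p l IH [_ _ /IH]. Qed.

Lemma chain_catl l r : chain (l ++ r) -> chain l.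
Proof. by elim: l => // p l IH [vp pq /IH cl]; split=> //; case: l pq {IH cl}. Qed.

Lemma chain_replace l p q r : chain (l ++ p :: r) -> valid_part n q -> q.1 < p.1 ->
  (if r is h :: _ then okpair n q h else true) -> chain (l ++ q :: r).
Proof.
elim: l => [|x l IH]; first by move=> [_ _ cr] vq _ qr; split=> //; case: r qr {cr}.
move=> [vx xl cl] vq qp qr; split; [by [] | | exact: IH].
case: l xl {IH cl} => //=; rewrite /okpair => /orP[xp|/andP[/eqP px _]].
  by rewrite (ltn_trans qp).
by rewrite -px qp.
Qed.

Lemma dec_bruhat l p q r : chain (l ++ p :: r) -> chain (l ++ q :: r) -> p.1 = q.1.+1 ->
  bruhat_le (elt (l ++ q :: r)) (elt (l ++ p :: r)).
Proof.
move=> cp cq pq; have [vp _ _] := chain_catr cp; have [vq _ _] := chain_catr cq.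
apply: (elt_bruhat hn) => //; last by rewrite !map_cat !sumn_cat /= pq; lia.
by rewrite !map_cat; apply: deletion_gword; exact: segment_deletion.
Qed.

Lemma drop_bruhat l : chain (l ++ [:: (1, None)]) ->
  bruhat_le (elt l) (elt (l ++ [:: (1, None)])).
Proof.
move=> cl; apply: (elt_bruhat hn) => //; first exact: chain_catl cl.
  by rewrite !map_cat /= segment1_low /=; [exact: deletion_gword_rcons | lia].
by rewrite !map_cat sumn_cat /=; lia.
Qed.

Lemma part1 p : valid_part n p -> p.1 <= 1 -> p = (1, None).
Proof.
move=> vp p1; have p1' : p.1 = 1 by case: vp => /andP[]; lia.
by rewrite {1}(low_part hn color_b vp) p1' ?ifF //; lia.
Qed.

(** The last part can be lowered by 1, or dropped if it is 1, without affecting the conditions on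
    the parts before it. *)
Lemma dec_last l r : r <> [::] -> chain (l ++ r) ->
  exists t, [/\ chain (l ++ t), bruhat_le (elt (l ++ t)) (elt (l ++ r)) & total r = (total t).+1].
Proof.
case/lastP: r => // r p _; rewrite -cats1 catA => cr.
have [vp _ _] := chain_catr cr.
have [p1|p1] := leqP p.1 1.
  rewrite (part1 vp p1) in cr *; exists r; split; [exact: chain_catl cr | exact: drop_bruhat |].
  by rewrite map_cat sumn_cat /=; lia.
have [q vq pq] := part_pred hn vp p1.
have cq : chain ((l ++ r) ++ [:: q]) by apply: chain_replace cr vq _ _; rewrite ?pq.
exists (r ++ [:: q]); rewrite catA; split=> //; first exact: dec_bruhat.
by rewrite !map_cat !sumn_cat /= pq; lia.
Qed.

Lemma chain_not_palindromic k ps ps1 ps2 : 1 <= k <= 2 -> chain ps -> chain ps1 -> chain ps2 ->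
  ps1 <> ps2 -> bruhat_le (elt ps1) (elt ps) -> bruhat_le (elt ps2) (elt ps) ->
  total ps1 + k = total ps -> total ps2 + k = total ps -> ~ palindromic (elt ps).
Proof.
move=> kn c c1 c2 ne b1 b2 s1 s2.
have [_ l _] := chain_elt hn false c.
have [J1 l1 _] := chain_elt hn false c1; have [J2 l2 _] := chain_elt hn false c2.
apply: (@not_palindromic_small n hn _ (elt ps1) (elt ps2) k) => //.
- by move/(elt_inj hn c1 c2).
- by rewrite [X in X + _]l1 [RHS]l.
- by rewrite [X in X + _]l2 [RHS]l.
Qed.

Definition tight ps := forall l p q r, ps = l ++ [:: p, q & r] ->
  forall p', valid_part n p' -> p.1 = p'.1.+1 -> ~ okpair n p' q.

(** Lowering p and lowering the tail after it would give two distinct elements of colength 1,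
    against a single element of length 1. *)
Lemma palindromic_tight ps : chain ps -> palindromic (elt ps) -> tight ps.
Proof.
move=> cps pal l p q r psE p' vp' pp' pq; move: pal; rewrite {}psE in cps *.
have cp' : chain (l ++ [:: p', q & r]) by apply: chain_replace cps vp' _ _; rewrite ?pp'.
rewrite (_ : l ++ [:: p, q & r] = (l ++ [:: p]) ++ (q :: r)) in cps *; last by rewrite -catA.
have [|t [ct bt st]] := @dec_last (l ++ [:: p]) (q :: r) _ cps; first by [].
apply: (@chain_not_palindromic 1 _ (l ++ [:: p', q & r]) ((l ++ [:: p]) ++ t)) => //.
- rewrite -catA => /eqP; rewrite eqseq_cat // eqxx /= eqseq_cons => /andP[/eqP p'E _].
  by move: pp'; rewrite p'E; lia.
- by rewrite -catA; apply: dec_bruhat => //; rewrite -catA in cps.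
- by rewrite !map_cat !sumn_cat /= pp'; lia.
- by move: st; rewrite !map_cat !sumn_cat /=; lia.
Qed.

Lemma tight_behead p ps : tight (p :: ps) -> tight ps.
Proof. by move=> t l p1 q r psE; apply: (t (p :: l) p1 q r); rewrite psE. Qed.

(** The counterpart of [stairs] for parts, with sizes a + k - 1 down to a; it is meant for sizes at
    most n - 2, which carry no color. *)
Definition drange a k : seq part := [seq (j, None) | j <- rev (iota a k)].

Lemma drangeS a k : drange a k.+1 = (a + k, None) :: drange a k.
Proof. by rewrite /drange -addn1 iotaD rev_cat. Qed.

Lemma drange_rcons a k : drange a k.+1 = rcons (drange a.+1 k) (a, None).
Proof. by rewrite /drange /= rev_cons map_rcons. Qed.

(** From the last part towards the front, tightness makes each part exceed the next by exactly 1
    until n - 1 is reached. From there on it forces equality: a part n could be lowered to the color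
    of the neighbour n - 1, and a larger part could be lowered by 1. *)
Lemma tight_structure p ps : chain (p :: ps) -> tight (p :: ps) -> (last p ps).1 <= n - 1 ->
  exists (r : nat) z a k, [/\ p :: ps = nseq r (n - 1, Some z) ++ drange a k,
    1 <= a, a + k <= n - 1, 0 < r -> a + k = n - 1 & 0 < r \/ 0 < k].
Proof.
elim: ps p => [|q ps IH] p [vp pq cps] tps.
  move=> /= pn; have p1 : 1 <= p.1 by case: vp => /andP[].
  have [pn'|pn'] := leqP p.1 (n - 2).
    exists 0, color_b, p.1, 1; split=> //; try lia.
    by rewrite drangeS /= addn0 {1}(low_part hn color_b vp pn') ifF //; lia.
  have [z pE] : exists z, p = (n - 1, Some z).
    by case/(valid_part_cases hn): vp => [[]|->|->|[]]; try lia; eexists.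
  by exists 1, z, (n - 1), 0; split=> //; try lia; rewrite pE.
move=> lastn; have [//|r [z [a [k [qE a1 akn rak rk]]]]] := IH q cps (tight_behead tps).
have tpq p' : valid_part n p' -> p.1 = p'.1.+1 -> ~ okpair n p' q by exact: (tps [::]).
have v1 : 1 < p.1.
  have [[/andP[q1 _] _] _ _] := cps.
  by move: pq; rewrite /okpair => /orP[|/andP[_]]; lia.
have [p' vp' pp'] := part_pred hn vp v1.
case: r qE rak rk => [|r] qE rak rk.
  case: k qE akn rak rk => [|k] qE akn rak rk; first by case: rk.
  move: qE; rewrite drangeS /= => -[qE psE].
  have qp : q.1 < p.1 by move: pq; rewrite /okpair qE /=; case/orP=> // /andP[/eqP <-]; rewrite /=; lia.
  have pE : p.1 = q.1.+1.
    by apply/eqP; rewrite eqn_leq qp andbT leqNgt; apply/negP => lt; case: (tpq p') => //; rewrite /okpair; apply/orP; left; lia.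
  rewrite qE /= in pE.
  have [pn|pn] := leqP p.1 (n - 2).
    exists 0, color_b, a, k.+2; split=> //; try lia.
    rewrite !drangeS /= qE psE {1}(low_part hn color_b vp pn) ifF ?pE ?addnS //; lia.
  have [z' pE'] : exists z', p = (n - 1, Some z').
    by case/(valid_part_cases hn): vp => [[]|->|->|[]]; try lia; eexists.
  exists 1, z', a, k.+1; split=> //; try lia.
  by rewrite drangeS /= pE' qE psE.
move: qE => /= -[qE psE].
have [pn|pn] := eqVneq p q.
  exists r.+2, z, a, k; split=> //; try lia.
  by rewrite /= pn qE psE.
have qp : n - 1 < p.1.
  by move: pq; rewrite /okpair qE /= => /orP[//|/andP[/eqP pE _]]; rewrite qE pE eqxx in pn.
have [pE|pE] := eqVneq p.1 n.
  case: (tpq q); [by rewrite qE; exact: valid_mid | by rewrite qE pE /=; lia |].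
  by rewrite /okpair eqxx qE /= leqnn orbT.
by case: (tpq p') => //; rewrite /okpair qE /=; apply/orP; left; lia.
Qed.

(** For any other last part two elements of equal colength 1 or 2 arise. Tightness leaves only p = q
    when q.1 >= n, and p.1 = q.1 + 1 when 1 < q.1 < n - 1. *)
Lemma palindromic_two_rows l p q : chain (l ++ [:: p; q]) -> palindromic (elt (l ++ [:: p; q])) ->
  q.1 = 1 \/ q.1 = n - 1.
Proof.
move=> cps pal; have tps := palindromic_tight cps pal.
have tpq p' : valid_part n p' -> p.1 = p'.1.+1 -> ~ okpair n p' q by exact: (tps l p q [::]).
have [vp pq [vq _ _]] := chain_catr cps.
have q0 : 1 <= q.1 by case: vq => /andP[].
have [q1|q1] := eqVneq q.1 1; first by left.
have [qn|qn] := eqVneq q.1 (n - 1); first by right.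
exfalso; have [q' vq' qq'] := part_pred hn vq ltac:(lia).
have v1 : 1 < p.1 by move: pq; rewrite /okpair; case/orP=> [|/andP[/eqP <-]]; lia.
have [p' vp' pp'] := part_pred hn vp v1.
have lE (u v : part) : l ++ [:: u; v] = (l ++ [:: u]) ++ [:: v] by rewrite -catA.
have cq' : chain (l ++ [:: p; q']).
  by rewrite lE; rewrite lE in cps; apply: chain_replace cps vq' _ _; rewrite ?qq'.
have bq' : bruhat_le (elt (l ++ [:: p; q'])) (elt (l ++ [:: p; q])).
  by rewrite !lE; rewrite !lE in cps cq'; exact: dec_bruhat.
have total2 u v : total (l ++ [:: u; v]) = total l + (u.1 + v.1).
  by rewrite map_cat sumn_cat /= addn0.
have [qhigh|qlow] := leqP n q.1.
  have pE : p = q.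
    move: pq; rewrite /okpair => /orP[qp|/andP[/eqP//]].
    have [/eqP p'q|p'q] := eqVneq p'.1 q.1; last first.
      by case: (tpq p') => //; rewrite /okpair; apply/orP; left; lia.
    case: (tpq q) => //; first by rewrite pp' (eqP p'q).
    by rewrite /okpair eqxx /= orbC; apply/orP; left; lia.
  (* A last part n can be lowered to either color of n - 1. *)
  have [qE|qE] := eqVneq q.1 n.
    have vm z := valid_mid hn z.
    have cz z : chain (l ++ [:: p; (n - 1, Some z)]).
      by rewrite lE; rewrite lE in cps; apply: chain_replace cps (vm z) _ _ => //=; lia.
    apply: (chain_not_palindromic (k := 1) _ cps (cz color_b) (cz color_c)) pal => //.
    - by move/eqP; rewrite eqseq_cat // eqxx /= => /eqP [].
    - by rewrite !lE; rewrite !lE in cps; apply: dec_bruhat => //; [rewrite -lE; exact: cz | rewrite /=; lia].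
    - by rewrite !lE; rewrite !lE in cps; apply: dec_bruhat => //; [rewrite -lE; exact: cz | rewrite /=; lia].
    - by rewrite !total2 /=; lia.
    - by rewrite !total2 /=; lia.
  (* Colength 2: the last copy of q is lowered twice, or both copies are lowered once. *)
  have [q'' vq'' qq''] := part_pred hn vq' ltac:(lia).
  have c1 : chain (l ++ [:: p; q'']).
    by rewrite lE; rewrite lE in cq'; apply: chain_replace cq' vq'' _ _; rewrite ?qq''.
  have c2 : chain (l ++ [:: q'; q']).
    apply: chain_replace cq' vq' _ _; first by rewrite pE; lia.
    by rewrite /okpair eqxx /=; apply/orP; right; lia.
  apply: (chain_not_palindromic (k := 2) _ cps c1 c2) pal => //.
  - by move/eqP; rewrite eqseq_cat // eqxx /= => /eqP [pq' _]; move: qq'; rewrite -pq' pE; lia.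
  - apply: bruhat_trans bq'; rewrite !lE; rewrite !lE in cq' c1; exact: dec_bruhat.
  - by apply: bruhat_trans bq'; apply: dec_bruhat => //; rewrite pE.
  - by rewrite !total2; lia.
  - by rewrite !total2 pE; lia.
have qp : q.1 < p.1 by move: pq; rewrite /okpair => /orP[//|/andP[/eqP <-]]; lia.
have pE : p.1 = q.1.+1.
  by apply/eqP; rewrite eqn_leq qp andbT leqNgt; apply/negP => lt; case: (tpq p') => //; rewrite /okpair; apply/orP; left; lia.
(* Colength 2 again: once q has been lowered, either the last part is lowered or dropped in turn, or
   p is lowered. *)
have [||t [ct bt st]] := @dec_last (l ++ [:: p]) [:: q'] _ _; [by [] | by rewrite -lE |].
have c2 : chain (l ++ [:: p'; q']).
  by apply: chain_replace cq' vp' _ _; [lia | rewrite /okpair; apply/orP; left; lia].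
apply: (chain_not_palindromic (k := 2) _ cps ct c2) pal => //.
- by rewrite -catA => /eqP; rewrite eqseq_cat // eqxx /= eqseq_cons => /andP[/eqP pp'' _]; move: pp'; rewrite pp''; lia.
- by apply: bruhat_trans bq'; rewrite [l ++ [:: p; q']]lE.
- by apply: bruhat_trans bq'; exact: dec_bruhat.
- by move: st; rewrite total2 !map_cat !sumn_cat /=; lia.
- by rewrite !total2; lia.
Qed.

Lemma segment1_flip z : segment1 n (n - 1, Some z) = map (flip n z) D.
Proof.
have DE : D = (n - 1) :: down (n - 2) by rewrite (_ : n - 1 = (n - 2).+1) ?downS //; lia.
case: z; first by rewrite segment1_b // map_id.
rewrite segment1_c // DE /= eqxx; congr (_ :: _); rewrite -[LHS]map_id.
by apply/eq_in_map => i; rewrite mem_rev mem_iota => ij; rewrite /flip !ifF //; lia.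
Qed.

Lemma drange_flip z a k : a + k <= n - 1 -> segs (drange a k) = map (map (flip n z)) (stairs a k).
Proof.
move=> ak; rewrite /drange /stairs -!map_comp; apply/eq_in_map => j.
rewrite mem_rev mem_iota /= => ja; rewrite segment1_low /=; last by lia.
rewrite -[LHS]map_id; apply/eq_in_map => i; rewrite mem_rev mem_iota => ij.
by case: z => //=; rewrite !ifF //; lia.
Qed.

Lemma palindromic_shape ps : chain ps -> palindromic (elt ps) ->
  (exists2 j, 1 <= j <= n - 1 \/ j = 2 * n - 2 & map fst ps = [:: j]) \/
  (exists2 k, k <= n - 1 & map fst ps = staircase k).
Proof.
case: ps => [_ _|p ps]; first by right; exists 0.
case: ps => [|p2 ps] cps pal.
  have [vp _ _] := cps; left; exists p.1 => //.
  have [p1 pn] : 1 <= p.1 /\ p.1 <= 2 * n - 2 by case: vp => /andP[].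
  have [le|gt] := leqP p.1 (n - 1); first by left; rewrite p1.
  right; have [//|ne] := eqVneq p.1 (2 * n - 2).
  by case: (row_not_palindromic hn vp _ pal); lia.
have tps := palindromic_tight cps pal; right.
have [l [p' [q psE]]] : exists l p' q, [:: p, p2 & ps] = l ++ [:: p'; q].
  case/lastP: ps {cps pal tps} => [|ps q]; first by exists [::], p, p2.
  case/lastP: ps => [|ps q']; first by exists [:: p], p2, q.
  by exists [:: p, p2 & ps], q', q; rewrite -!cats1 -!catA.
have lastE : last p (p2 :: ps) = q.
  by rewrite -[LHS]/(last p [:: p, p2 & ps]) psE last_cat.
have qE : q.1 = 1 \/ q.1 = n - 1.
  by rewrite psE in cps pal; exact: palindromic_two_rows cps pal.
have [|r [z [a [k [E a1 akn rak rk]]]]] := tight_structure cps tps.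
  by rewrite lastE; lia.
move: pal; rewrite E; case: k E akn rak rk => [|k] E akn rak rk.
  case: r E rak rk => [|[|r]] E rak rk; [by case: rk | by [] |].
  rewrite cats0 => pal; case: (@spiral_not_palindromic n hn z r.+2) => //.
  suff <- : segs (nseq r.+2 (n - 1, Some z)) = map (map (flip n z)) (nseq r.+2 D) by [].
  by rewrite !map_nseq segment1_flip.
(* The smallest part a is at most n - 2 here, so of the two values possible for the last part it is
   1. *)
have aE : a = 1.
  have : last p (p2 :: ps) = (a, None).
    by rewrite -[LHS]/(last p [:: p, p2 & ps]) E drange_rcons -cats1 catA last_cat.
  by rewrite lastE => qa; move: qE; rewrite qa /=; lia.
subst a; have fst_drange i : map fst (drange 1 i) = staircase i.
  by rewrite /drange -map_comp map_id.
case: r E rak rk => [|[|r]] E rak rk pal.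
- by exists k.+1; [lia | rewrite /= fst_drange].
- exists (n - 1) => //; rewrite /= fst_drange.
  by rewrite (_ : n - 1 = k.+2) ?staircaseS //; lia.
case: (@spiral_stairs_not_palindromic n hn z r.+2) => //.
suff <- : segs (nseq r.+2 (n - 1, Some z) ++ drange 1 k.+1) =
  map (map (flip n z)) (nseq r.+2 D ++ stairs 1 (n - 2)) by [].
rewrite !map_cat !map_nseq segment1_flip (drange_flip z); last by lia.
by rewrite (_ : n - 2 = k.+1) //; lia.
Qed.

(** Only the first part can have size n - 1, so its color serves for the whole shape; for k < n - 1
    any z will do. *)
Lemma staircase_colored k ps : k <= n - 1 -> chain ps -> map fst ps = staircase k ->
  exists z, ps = color_shape n z (staircase k).
Proof.
case: k ps => [|k] [|p ps] kn cps; rewrite ?staircaseS //=; first by exists color_b.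
move=> -[pk psk]; have [vp pq cps'] := cps.
have [pn|pn] := leqP p.1 (n - 2).
  have [psE _] := chain_low hn color_b cps pn; exists color_b.
  by rewrite psE /= pk psk.
have pE : p.1 = n - 1 by lia.
have [z zE] : exists z, p = (n - 1, Some z).
  by case/(valid_part_cases hn): vp pE => [[]|->|->|[]]; try lia; eexists.
exists z; rewrite /= -pk pE eqxx zE; congr (_ :: _).
case: ps psk cps' {cps pq} => [|q ps] psk cps'; first by rewrite -psk.
have qn : q.1 <= n - 2 by move: psk; case: k kn pk => [|k] kn pk //=; rewrite staircaseS => -[]; lia.
by have [psE _] := chain_low hn z cps' qn; rewrite psE -psk.
Qed.

Lemma row_colored ps : chain ps -> map fst ps = [:: n - 1] ->
  exists z, ps = color_shape n z [:: n - 1].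
Proof.
case: ps => [|p [|]] // [vp _ _] [pE]; rewrite /color_shape /= eqxx.
by case/(valid_part_cases hn): vp pE => [[]|->|->|[]]; try lia; eexists.
Qed.

Lemma shape_palindromic ps : chain ps ->
  (exists2 j, 1 <= j <= n - 1 \/ j = 2 * n - 2 & map fst ps = [:: j]) \/
  (exists2 k, k <= n - 1 & map fst ps = staircase k) -> palindromic (elt ps).
Proof.
move=> cps [[j jn psE]|[k kn psE]].
  case: ps cps psE => [|p [|]] // [vp _ _] [pE].
  by apply: row_palindromic => //; rewrite pE; case: jn; [case/andP; left | right].
have [z ->] := staircase_colored kn cps psE; exact: staircase_palindromic.
Qed.

End Classification.

Local Open Scope classical_set_scope.

Theorem theorem7p9 (n : nat) (hn : (4 <= n)%N) :
  (forall w : affD n, min_coset_rep (gens_but n 0) w ->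
     (palindromic w <->
      ((exists2 j : nat, ((1 <= j <= n - 1)%N \/ j = (2 * n - 2)%N) &
          underlying_shape (colored_partition w) = [:: j]) \/
       (exists2 k : nat, (k <= n - 1)%N &
          underlying_shape (colored_partition w) = staircase k)))) /\
  (forall sh : seq nat, sh = [:: (n - 1)%N] \/ sh = staircase (n - 1) ->
     exists wb wc : affD n,
       [/\ wb <> wc,
           colored_partition wb = color_shape n color_b sh,
           colored_partition wc = color_shape n color_c sh &
           [set w : affD n | [/\ min_coset_rep (gens_but n 0) w, palindromic w &
                                 underlying_shape (colored_partition w) = sh]]
           = [set wb; wc]]).
Proof.
split=> [w wJ|sh shE].
  have [wE cps] := colored_partitionP hn wJ; rewrite {1}wE.
  by split; [exact: palindromic_shape | exact: shape_palindromic].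
have sh_strict : strict_shape (n - 1) sh.
  case: shE => ->; last exact: strict_staircase.
  by rewrite strict_shape_cons /strict_shape /=; lia.
have [t shE'] : exists t, sh = (n - 1)%N :: t.
  case: shE => ->; first by exists [::].
  by exists (staircase (n - 2)); rewrite (_ : (n - 1)%N = (n - 2).+1) ?staircaseS //; lia.
have cc z := chain_color hn z (leqnn _) sh_strict.
exists (elt n false (color_shape n color_b sh)), (elt n false (color_shape n color_c sh)).
split; [|by rewrite colored_partition_elt|by rewrite colored_partition_elt|].
  by move/(elt_inj hn (cc _) (cc _)); rewrite shE' /color_shape /= eqxx.
have wz z : [/\ min_coset_rep (gens_but n 0) (elt n false (color_shape n z sh)),
    palindromic (elt n false (color_shape n z sh)) &
    underlying_shape (colored_partition (elt n false (color_shape n z sh))) = sh].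
  have [J _ _] := chain_elt hn false (cc z).
  rewrite colored_partition_elt // /underlying_shape color_shape_fst; split=> //.
  apply: shape_palindromic => //; rewrite color_shape_fst.
  case: shE => ->; [left; exists (n - 1)%N => //; left; lia | right].
  by exists (n - 1)%N.
apply/seteqP; split=> [w [wJ _ wsh]|w [->|->]]; try exact: wz.
have [wE cps] := colored_partitionP hn wJ.
have [z zE] : exists z, colored_partition w = color_shape n z sh.
  case: shE wsh => -> wsh; first exact: row_colored.
  exact: staircase_colored.
by rewrite wE zE; case: z {zE}; [left | right].
Qed.
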